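(* Let $d\ge 1$, $m>0$, $\tau>0$, $\beta>0$, $t_\iota\in\mathbb{R}$, and let $U\colon[t_\iota,\infty)\times\mathbb{R}^d\to\mathbb{R}_+$, $(t,q)\mapsto U_t(q)$, be a sufficiently regular and confining time-dependent potential (in the sense of the standing assumptions in the context). Write $x=(q,p)\in\mathbb{R}^d\times\mathbb{R}^d$. Let $\rho_t(x)$ be the solution, for $t\ge t_\iota$, of the Fokker-Planck equation $$\Big(\partial_t+\Big\langle\frac{p}{m},\partial_q\Big\rangle-\big\langle(\partial U_t)(q),\partial_p\big\rangle-\Big\langle\partial_p,\frac{p}{\tau}\Big\rangle-\frac{m}{\beta\tau}\,\partial_p^2\Big)\rho_t(x)=0$$ with initial datum a probability density $\rho_{t_\iota}$ on $\mathbb{R}^{2d}$ at time $t_\iota$. Then for every $t\ge t_\iota$ and $x=(q,p)\in\mathbb{R}^{2d}$, $$\rho_t(x)=e^{-\frac{\beta\|p\|^2}{2m}}\ \mathrm{E}_{\mathcal{P}^\flat}\!\left(e^{\frac{\beta\|\mathscr{p}_{t_\iota}\|^2}{2m}}\,\rho_{t_\iota}(\mathscr{x}_{t_\iota})\,\exp\Big(-\frac{\beta}{m}\int_{t_\iota}^t\big\langle(\partial U_s)(\mathscr{q}_s),\mathscr{p}_s\big\rangle ds\Big)\ \Big|\ \mathscr{x}_t=x\right),$$ where $\mathcal{P}^\flat$ is the path measure generated by the backward process $\mathscr{x}_s=(\mathscr{q}_s,\mathscr{p}_s)$, $$d^\flat\mathscr{q}_s=\frac{\mathscr{p}_s}{m}\,ds,\qquad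 d^\flat\mathscr{p}_s=\Big(\frac{\mathscr{p}_s}{\tau}-(\partial U_s)(\mathscr{q}_s)\Big)ds+\sqrt{\frac{2m}{\tau\beta}}\,dw_s .$$
   Context: Notation: $\partial U_t$ is the gradient of $U_t$ in $q$; $\partial_q,\partial_p$ are gradients in $q$ and $p$; $\langle\cdot,\cdot\rangle$ and $\|\cdot\|$ are the Euclidean inner product and norm; $\langle\partial_p,\frac{p}{\tau}\rangle$ acts on a function $\rho$ as the divergence $\langle\partial_p,\frac{p}{\tau}\rho\rangle$; $\partial_p^2$ is the Laplacian in $p$. Backward process: $w$ is a standard $d$-dimensional Wiener process, and $d^\flat\mathscr{x}_s=\mathscr{x}_s-\mathscr{x}_{s-ds}$. Conditioned on $\mathscr{x}_t=x=(q,p)$, the process is run backward in time from time $t$: for $s\in[t_\iota,t]$, $$\mathscr{q}_s=q-\int_s^t\frac{\mathscr{p}_r}{m}\,dr,\qquad \mathscr{p}_s=p-\int_s^t\Big(\frac{\mathscr{p}_r}{\tau}-(\partial U_r)(\mathscr{q}_r)\Big)dr-\sqrt{\frac{2m}{\tau\beta}}\,(w_t-w_s),$$ adapted to the backward filtration in which the $\sigma$-algebra at time $s$ is generated by $\{w_t-w_r : s\le r\le t\}$. Standing assumptions: $U$ is sufficiently regular and confining. This is understood to guarantee that the Fokker-Planck equation has a (sufficiently regular) solution fully specified by its initial datum and integrable over $\mathbb{R}^{2d}$, that the backward stochastic differential equation is well posed, and the integrability needed for the following process to be a true martingale with respect to the backward filtration: $s\mapsto e^{-\frac{\beta}{m}\int_s^t\langle(\partial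 U_r)(\mathscr{q}_r),\mathscr{p}_r\rangle dr}\,e^{\frac{\beta\|\mathscr{p}_s\|^2}{2m}}\,\rho_s(\mathscr{x}_s)$, $s\in[t_\iota,t]$. *)

(* Defs.v *)
From HB Require Import structures.
From mathcomp Require Export all_boot all_order all_algebra.
From mathcomp Require Export all_classical all_reals all_analysis.

Set Implicit Arguments.
Unset Strict Implicit.
Unset Printing Implicit Defensive.

Export Order.TTheory GRing.Theory Num.Theory.
Export numFieldNormedType.Exports.

Local Open Scope classical_set_scope.
Local Open Scope ring_scope.

Section vector_calculus.
Context {R : realType} {d : nat}.
Implicit Types (u v x : 'rV[R]_d) (f : 'rV[R]_d -> R).

(* The norm that the library puts on 'rV[R]_d is the sup norm; it is used here
   only for the topology, which is the Euclidean one. *)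
Definition dot u v : R := \sum_(i < d) u 0 i * v 0 i.

Definition enorm u : R := Num.sqrt (dot u u).

Definition partial (i : 'I_d) f x : R := 'D_(delta_mx 0 i) f x.

Definition has_partial (i : 'I_d) f x : Prop := derivable f x (delta_mx 0 i).

Definition grad f x : 'rV[R]_d := \row_i partial i f x.

Definition divergence (F : 'rV[R]_d -> 'rV[R]_d) x : R :=
  \sum_(i < d) partial i (fun y => F y 0 i) x.

Definition laplacian f x : R := \sum_(i < d) partial i (partial i f) x.

End vector_calculus.

(* Iterated Lebesgue integral over R^n. It is only applied to nonnegative
   continuous functions, for which Tonelli's theorem makes it the integral
   against the Lebesgue measure of R^n. *)
Fixpoint rV_integral {R : realType} (n : nat) :
    ('rV[R]_n -> \bar R) -> \bar R :=
  match n return ('rV[R]_n -> \bar R) -> \bar R with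
  | 0 => fun f => f 0
  | n'.+1 => fun f =>
      (\int[lebesgue_measure]_x
         rV_integral (fun v : 'rV[R]_n' =>
           f (row_mx (const_mx x : 'rV[R]_1) v)))%E
  end.

Section fokker_planck.
Context {R : realType} {d : nat}.
Implicit Types (U : R -> 'rV[R]_d -> R) (rho : R -> 'rV[R]_d -> 'rV[R]_d -> R).

Definition phase_integral (f : 'rV[R]_d -> 'rV[R]_d -> R) : \bar R :=
  rV_integral (fun q => rV_integral (fun p => (f q p)%:E)).

Definition probability_density (f : 'rV[R]_d -> 'rV[R]_d -> R) : Prop :=
  (forall q p, 0 <= f q p) /\ phase_integral f = 1%E.

Record regular_potential (ti : R) U : Prop := {
  potential_ge0 : forall t q, ti <= t -> 0 <= U t q;
  potential_differentiable : forall t q, ti <= t -> differentiable (U t) q;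
  force_continuous :
    {within [set z : R * 'rV[R]_d | ti <= z.1],
       continuous (fun z => grad (U z.1) z.2)} }.

Definition fokker_planck_equation (m tau beta : R) U rho t q p : Prop :=
  derive1 (fun s => rho s q p) t
  + dot (m^-1 *: p) (grad (fun q' => rho t q' p) q)
  - dot (grad (U t) q) (grad (rho t q) p)
  - divergence (fun p' => rho t q p' *: (tau^-1 *: p')) p
  - m / (beta * tau) * laplacian (rho t q) p = 0.

Definition jointly_continuous_on (A : set R) rho : Prop :=
  {within [set z : R * ('rV[R]_d * 'rV[R]_d) | A z.1],
     continuous (fun z => rho z.1 z.2.1 z.2.2)}.

(* Classical solution of the Cauchy problem: the equation and the derivatives
   in it are required for t > ti, with continuity up to the initial time. *)
Record fokker_planck_solution (ti m tau beta : R) U rho : Prop := {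
  fp_continuous : jointly_continuous_on `[ti, +oo[ rho;
  fp_derivable_t : forall t q p, ti < t ->
    derivable (fun s => rho s q p) t 1;
  fp_derivable_q : forall t q p i, ti < t ->
    has_partial i (fun q' => rho t q' p) q;
  fp_derivable_p : forall t q p i, ti < t -> has_partial i (rho t q) p;
  fp_derivable_pp : forall t q p i j, ti < t ->
    has_partial j (partial i (rho t q)) p;
  fp_continuous_t :
    jointly_continuous_on `]ti, +oo[ (fun t q p => derive1 (fun s => rho s q p) t);
  fp_continuous_q : forall i,
    jointly_continuous_on `]ti, +oo[
      (fun t q p => partial i (fun q' => rho t q' p) q);
  fp_continuous_p : forall i,
    jointly_continuous_on `]ti, +oo[ (fun t q p => partial i (rho t q) p);
  fp_continuous_pp : forall i j,
    jointly_continuous_on `]ti, +oo[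
      (fun t q p => partial j (partial i (rho t q)) p);
  fp_equation : forall t q p, ti < t ->
    fokker_planck_equation m tau beta U rho t q p;
  fp_integrable : forall t, ti <= t ->
    (phase_integral (fun q p => `|rho t q p|%R) < +oo)%E }.

End fokker_planck.

Section processes.
Context {R : realType} {d : nat} {disp : measure_display}
  {Omega : measurableType disp} (P : probability Omega R).

Definition mutually_independent (I : finType) (X : I -> Omega -> R) : Prop :=
  forall B : I -> set R, (forall i, measurable (B i)) ->
    P [set omega | forall i, B i (X i omega)] =
    (\prod_(i : I) P (X i @^-1` B i))%E.

(* Only increments of w enter the backward dynamics, so the value of w at the
   initial time is left free. The increments are taken over nondegenerate
   intervals, because normal_prob 0 0 is not the Dirac mass at 0. *)
Record wiener_process (ti : R) (w : R -> Omega -> 'rV[R]_d) : Prop := {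
  wiener_measurable : forall s i, ti <= s ->
    measurable_fun setT (fun omega => w s omega 0 i);
  wiener_continuous : forall omega,
    {within `[ti, +oo[, continuous (fun s => w s omega)};
  wiener_gaussian : forall r s i (B : set R), ti <= r -> r < s ->
    measurable B ->
    P [set omega | B ((w s omega - w r omega) 0 i)] =
    normal_prob 0 (Num.sqrt (s - r)) B;
  wiener_independent : forall (n : nat) (u : nat -> R),
    ti <= u 0%N -> (forall k, (k < n)%N -> u k < u k.+1) ->
    mutually_independent (fun (ki : 'I_n * 'I_d) omega =>
      (w (u ki.1.+1) omega - w (u ki.1) omega) 0 ki.2) }.

Definition backward_increment_events (w : R -> Omega -> 'rV[R]_d) (t s : R) :
    set (set Omega) :=
  [set A | exists r i (B : set R),
     (s <= r <= t) /\ measurable B /\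
     A = [set omega | B ((w t omega - w r omega) 0 i)]].

Definition backward_filtration (w : R -> Omega -> 'rV[R]_d) (t s : R) :
    set (set Omega) :=
  <<s backward_increment_events w t s >>.

Definition backward_adapted (ti t : R) (w X : R -> Omega -> 'rV[R]_d) : Prop :=
  forall s i (B : set R), ti <= s -> s <= t -> measurable B ->
    backward_filtration w t s [set omega | B (X s omega 0 i)].

Record backward_solution (ti m tau beta : R) (U : R -> 'rV[R]_d -> R)
    (w : R -> Omega -> 'rV[R]_d) (t : R) (q p : 'rV[R]_d)
    (qs ps : R -> Omega -> 'rV[R]_d) : Prop := {
  backward_adapted_q : backward_adapted ti t w qs;
  backward_adapted_p : backward_adapted ti t w ps;
  backward_continuous_q : forall omega,
    {within `[ti, t], continuous (fun s => qs s omega)};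
  backward_continuous_p : forall omega,
    {within `[ti, t], continuous (fun s => ps s omega)};
  backward_equation : {ae P, forall omega, forall s i, ti <= s -> s <= t ->
    qs s omega 0 i = q 0 i
      - \int[lebesgue_measure]_(r in `[s, t]) (ps r omega 0 i / m) /\
    ps s omega 0 i = p 0 i
      - \int[lebesgue_measure]_(r in `[s, t])
          (ps r omega 0 i / tau - grad (U r) (qs r omega) 0 i)
      - Num.sqrt (2 * m / (tau * beta)) * (w t omega - w s omega) 0 i} }.

Definition work_integral (U : R -> 'rV[R]_d -> R) (qs ps : R -> Omega -> 'rV[R]_d)
    (s t : R) (omega : Omega) : R :=
  \int[lebesgue_measure]_(r in `[s, t]) dot (grad (U r) (qs r omega)) (ps r omega).

Definition weighted_density (m beta : R) (U : R -> 'rV[R]_d -> R)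
    (rho : R -> 'rV[R]_d -> 'rV[R]_d -> R) (qs ps : R -> Omega -> 'rV[R]_d)
    (t s : R) (omega : Omega) : R :=
  expR (- (beta / m) * work_integral U qs ps s t omega)
  * expR (beta * enorm (ps s omega) ^+ 2 / (2 * m))
  * rho s (qs s omega) (ps s omega).

(* Time runs downwards from t, so that "sigma has occurred by time s" reads
   s <= sigma. *)
Definition backward_stopping_time (ti t : R) (w : R -> Omega -> 'rV[R]_d)
    (sigma : Omega -> R) : Prop :=
  (forall omega, ti <= sigma omega <= t) /\
  (forall s, ti <= s -> s <= t ->
     backward_filtration w t s [set omega | s <= sigma omega]).

(* Uniform integrability of (M_sigma) over all stopping times sigma (Doob's
   class D): for a local martingale on a compact time interval this is exactly
   the integrability that makes it a true martingale. *)
Definition class_D (ti t : R) (w : R -> Omega -> 'rV[R]_d)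
    (M : R -> Omega -> R) : Prop :=
  forall eps : R, 0 < eps -> exists K : R,
    forall sigma, backward_stopping_time ti t w sigma ->
      (\int[P]_(omega in [set omega | K < `|M (sigma omega) omega| ]%R)
         `|M (sigma omega) omega|%R%:E <= eps%:E)%E.

End processes.

(* Main.v *)
(* Put kappa = beta / m and h_s(q,p) = exp (kappa |p|^2 / 2) rho_s(q,p). The
   exponential weight turns the Fokker-Planck equation into the backward equation
   that cancels the drift of M_s = exp (- kappa W_s) h_s(q_s,p_s), where W_s is the
   work done over [s,t], so that M is a local martingale as time runs down from t.
   No stochastic integral is needed: the bounded stopping time sigma at which the
   path leaves a box is treated with a uniform grid of [a,t]. Over one cell a Taylor
   expansion splits the increment of M into a noise term, which is linear and
   quadratic in the Wiener increment with coefficients measurable at the later end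
   point, hence of zero mean by independence, and a remainder at most
   o(1) (mesh + |dw|^2). Summing, and using fourth moments of the increments to
   control the remainder in L^1, gives E M_sigma = M_t. As the boxes grow and a
   tends to ti, M_sigma tends to M_ti along each path, and the class (D) hypothesis
   lets the expectation pass to the limit. *)
Require Import Defs.
From mathcomp Require Import all_boot all_order all_algebra.
From mathcomp Require Import all_classical all_reals all_analysis.
From mathcomp Require Import measurable_realfun.
From mathcomp Require Import ring lra.

Set Implicit Arguments.
Unset Strict Implicit.
Unset Printing Implicit Defensive.

Local Open Scope classical_set_scope.
Local Open Scope ring_scope.

(** The weight works because [sg] ^ 2 = 2 m / (tau beta) is tied to kappa by sg^2 kappa = 2 / tau,
    the fluctuation-dissipation relation: all zero-order terms of the equation for h cancel except
    kappa times the power, and this one is compensated by the exponential of the work. Two obstacles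
    shape the argument. First, h and its derivatives are bounded only on compact sets of times
    strictly above ti, whence the boxes and a > ti. Second, the modulus of continuity of a path is
    random, so the o(1) in the remainder is reached at a mesh that depends on the path. The L^1
    estimate therefore combines a fine bound, valid eventually along each path, with a crude bound
    whose constant serves all paths and all meshes. Both are measured against 1 + Q, where Q is the
    sum of the squared Wiener increments; the second moment of Q, bounded in the mesh, controls the
    event that Q is large. All estimates of remainders concern one deterministic path. Probability
    enters only through the centred noise, the moments of Q and the limits of expectations. *)

Ltac nneg := repeat first [ assumption | exact: ler0n | exact: ler01
  | exact: sqr_ge0 | exact: expR_ge0 | exact: normr_ge0
  | apply: addr_ge0 | apply: mulr_ge0 | apply: exprn_ge0 | rewrite invr_ge0 | apply: sumr_ge0 => ? _ ].

(** * Taylor bounds in one and several variables *)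

(** Heine-Cantor for a function continuous only within [K], by the near-covering form of
    compactness. The [near] conclusion lets finitely many such requirements be intersected. *)
Lemma compact_uniform_oscillation {R : realType} {T : pseudoMetricType R}
    (K : set T) (f : T -> R) (eps : R) :
  compact K -> {within K, continuous f} -> 0 < eps ->
  \forall eta \near (0 : R)^'+,
    forall x y, K x -> K y -> ball x eta y -> `|f x - f y| <= eps.
Proof.
move=> Kcpt fK eps0.
move/compact_near_coveringP : Kcpt => /(_ R (0^'+) (fun eta x =>
  forall y, K x -> K y -> ball x eta y -> `|f x - f y| <= eps) _) H.
apply: filterS (H _) => {H} [eta H x y Kx|]; first exact: H.
  move=> x Kx.
  move/subspace_continuousP : fK => /(_ x Kx)/cvgrPdist_lt/(_ (eps / 2)).
  rewrite divr_gt0// => /(_ isT); rewrite /prop_near1 /within/=.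
  move=> /nbhs_ballP[e0 /= e00 H].
  exists (ball x (e0 / 2), [set eta | 0 < eta < e0 / 2]); first split => /=.
  - by apply: nbhsx_ballx; rewrite divr_gt0.
  - near=> z; apply/andP; split; first by near: z; exact: nbhs_right_gt.
    by near: z; apply: nbhs_right_lt; rewrite divr_gt0.
  move=> [u eta] /= [xu /andP[eta0 etae]] y Ku Ky uy.
  have Hu : `|f x - f u| < eps / 2.
    by apply: H => //; apply: (@le_ball _ _ _ (e0 / 2)) => //; lra.
  have Hy : `|f x - f y| < eps / 2.
    apply: H => //; rewrite (_ : e0 = e0 / 2 + e0 / 2); last by lra.
    apply: ball_triangle xu _.
    by apply: le_ball uy; exact: ltW.
  rewrite (_ : f u - f y = (f x - f y) - (f x - f u)); last by ring.
  by apply: le_trans (ler_normB _ _) _; lra.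
Unshelve. all: by end_near. Qed.

Section one_variable.
Context {R : realType}.
Implicit Types (f df : R -> R) (x y c theta : R).

Lemma mean_value_approx f df x y c theta :
  (forall z, Num.min x y <= z <= Num.max x y -> is_derive z 1 f (df z)) ->
  (forall z, Num.min x y <= z <= Num.max x y -> `|df z - c| <= theta) ->
  `|f y - f x - c * (y - x)| <= theta * `|y - x|.
Proof.
suff wlg (a b : R) : a <= b ->
    (forall z, a <= z <= b -> is_derive z 1 f (df z)) ->
    (forall z, a <= z <= b -> `|df z - c| <= theta) ->
    `|f b - f a - c * (b - a)| <= theta * `|b - a|.
  have [xy|yx] := boolP (x <= y); rewrite ?(min_l xy) ?(max_r xy); first exact: wlg.
  move: yx; rewrite -ltNge => /ltW yx; rewrite (min_r yx) (max_l yx).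
  move=> fd fc; rewrite (_ : f y - f x - c * (y - x) = - (f x - f y - c * (x - y))).
    by rewrite normrN [`|y - x|]distrC; exact: (wlg _ _ yx fd fc).
  by ring.
move=> ab fd fc; have [|z|z zab ->] := @MVT_segment R f df a b ab.
- by move=> z; rewrite in_itv/= => /andP[az zb]; apply: fd; rewrite !ltW.
- apply: derivable_within_continuous => {}z; rewrite in_itv/= => zab.
  by have [] := fd _ zab.
- by rewrite -mulrBl normrM ler_wpM2r// fc.
Qed.

(** [mean_value_approx] is used twice: on [df], to bound the derivative of the remainder [g] by
    theta |y - x|, and then on [g] itself. This is why the constant is theta and not theta / 2. *)
Lemma taylor2_approx f df ddf x y c theta :
  (forall z, Num.min x y <= z <= Num.max x y -> is_derive z 1 f (df z)) ->
  (forall z, Num.min x y <= z <= Num.max x y -> is_derive z 1 df (ddf z)) ->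
  (forall z, Num.min x y <= z <= Num.max x y -> `|ddf z - c| <= theta) ->
  `|f y - f x - df x * (y - x) - c / 2 * (y - x) ^+ 2| <= theta * (y - x) ^+ 2.
Proof.
move=> fd dfd ddfc.
pose g (z : R) := f z - df x * (z - x) - c / 2 * (z - x) ^+ 2.
pose dg (z : R) := df z - df x - c * (z - x).
have gd (z : R) : Num.min x y <= z <= Num.max x y -> is_derive z 1 g (dg z).
  move=> zxy; have fdz := fd z zxy.
  rewrite /g; apply: is_derive_eq; rewrite /dg /GRing.scale/=.
  by rewrite !(mulr0, mul0r, addr0, subr0, mulr1); field.
have bd (z : R) : Num.min x y <= z <= Num.max x y -> `|dg z - 0| <= theta * `|y - x|.
  move=> zxy; rewrite subr0.
  have sub (u : R) : Num.min x z <= u <= Num.max x z -> Num.min x y <= u <= Num.max x y.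
    move: zxy; rewrite !ge_min !le_max => /andP[/orP[]? /orP[]?] /andP[/orP[]? /orP[]?];
    apply/andP; split; apply/orP; lra.
  apply: le_trans (@mean_value_approx df ddf x z c theta _ _) _ => //.
  - by move=> u /sub/dfd.
  - by move=> u /sub/ddfc.
  rewrite ler_wpM2l//; first exact: le_trans (ddfc _ zxy).
  move: zxy; rewrite ge_min le_max.
  by case: (lerP x z) => ?; case: (lerP x y) => ? /andP[/orP[]? /orP[]?];
    rewrite ?ger0_norm ?ler0_norm; lra.
have := mean_value_approx gd bd.
rewrite mul0r subr0 /g subrr expr0n/= !mulr0 !subr0 -[leRHS]mulrA -normrM -expr2.
rewrite (ger0_norm (sqr_ge0 _)) (_ : _ - f x = f y - f x - df x * (y - x) - c / 2 * (y - x) ^+ 2)//.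
by ring.
Qed.

End one_variable.

Section several_variables.
Context {R : realType} {d : nat}.
Implicit Types (f : 'rV[R]_d -> R) (x y z : 'rV[R]_d) (i j : 'I_d).

(* Multivariate expansions are obtained by moving from x to y one coordinate at a
   time, through the points [splice x y k]. *)
Definition splice x y (k : nat) : 'rV[R]_d :=
  \row_j (if (j < k)%N then y 0 j else x 0 j).

Definition in_hull x y z : Prop := forall j,
  Num.min (x 0 j) (y 0 j) <= z 0 j <= Num.max (x 0 j) (y 0 j).

Lemma splice0 x y : splice x y 0 = x.
Proof. by apply/rowP => j; rewrite mxE. Qed.

Lemma splice_full x y : splice x y d = y.
Proof. by apply/rowP => j; rewrite mxE ltn_ord. Qed.

(** Parametrised by the value [u] of coordinate [i] itself, so that the one-variable bounds apply
    verbatim between [x 0 i] and [y 0 i]. *)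
Definition segment_at x y i (u : R) : 'rV[R]_d :=
  splice x y i + (u - x 0 i) *: delta_mx 0 i.

Lemma segment_at_start x y i : segment_at x y i (x 0 i) = splice x y i.
Proof. by rewrite /segment_at subrr scale0r addr0. Qed.

Lemma segment_at_end x y i : segment_at x y i (y 0 i) = splice x y i.+1.
Proof.
apply/rowP => j; rewrite !mxE eqxx/= [(j < i.+1)%N]ltnS [(j <= i)%N]leq_eqVlt val_eqE.
case: eqVneq => [->|_] /=; last by rewrite mulr0 addr0.
by rewrite ltnn mulr1 addrC subrK.
Qed.

Lemma in_hull_segment_at x y i u :
  Num.min (x 0 i) (y 0 i) <= u <= Num.max (x 0 i) (y 0 i) ->
  in_hull x y (segment_at x y i u).
Proof.
move=> ui j; rewrite !mxE eqxx/=.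
have [->|_] := eqVneq j i; first by rewrite ltnn mulr1 addrC subrK.
by rewrite mulr0 addr0; case: ifP; rewrite ge_min le_max !lexx ?orbT.
Qed.

Lemma is_derive_segment_at f x y i u :
  has_partial i f (segment_at x y i u) ->
  is_derive u 1 (f \o segment_at x y i) (partial i f (segment_at x y i u)).
Proof.
move=> fd.
have E : (fun h : R => h^-1 *: ((f \o segment_at x y i) (h *: 1 + u) -
    (f \o segment_at x y i) u)) =
  (fun h : R => h^-1 *: (f (h *: delta_mx 0 i + segment_at x y i u) -
    f (segment_at x y i u))).
  apply/funext => h /=; congr (_ *: (f _ - _)).
  rewrite /segment_at [h *: 1]mulr1 -addrA scalerDl addrCA.
  by congr (_ + _); rewrite -scalerDl; congr (_ *: _); ring.
by split; rewrite /derivable /derive /partial /derive /has_partial E.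
Qed.

Lemma increment_splice f x y :
  f y - f x = \sum_(i < d) (f (splice x y i.+1) - f (splice x y i)).
Proof.
rewrite -[in LHS](splice_full x y) -[in X in _ - X](splice0 x y).
rewrite -(big_mkord xpredT (fun k : nat => f (splice x y k.+1) - f (splice x y k))).
by rewrite telescope_sumr.
Qed.

Lemma first_order_approx f x y (c : 'I_d -> R) (theta : R) :
  (forall i z, in_hull x y z -> has_partial i f z) ->
  (forall i z, in_hull x y z -> y 0 i != x 0 i ->
     `|partial i f z - c i| <= theta) ->
  `|f y - f x - \sum_(i < d) c i * (y 0 i - x 0 i)|
    <= theta * \sum_(i < d) `|y 0 i - x 0 i|.
Proof.
move=> fd fc; rewrite increment_splice -sumrB mulr_sumr.
apply: le_trans (ler_norm_sum _ _ _) _; apply: ler_sum => i _.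
have [yx|yx] := eqVneq (y 0 i) (x 0 i).
  by rewrite -segment_at_end yx segment_at_start !subrr mulr0 subrr normr0 mulr0.
have := @mean_value_approx R (f \o segment_at x y i)
  (fun u => partial i f (segment_at x y i u)) (x 0 i) (y 0 i) (c i) theta.
rewrite /= segment_at_end segment_at_start; apply.
- by move=> u ui; apply: is_derive_segment_at; apply: fd; exact: in_hull_segment_at.
- by move=> u ui; apply: fc => //; exact: in_hull_segment_at.
Qed.

(* Since coordinate i moves after the coordinates j < i, a mixed derivative is met
   only once, as [partial j (partial i f)] with j < i. *)
Definition taylor_weight i j : R :=
  if (j < i)%N then 1 else if j == i then 2^-1 else 0.

(** The one-variable Taylor formula for coordinate [i] is centred at [splice x y i]; carrying its
    first-order coefficient back to [x] with [first_order_approx] creates the cross terms j < i.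
    Each of the two errors costs at most theta S |y_i - x_i|, whence 2 theta. *)
Lemma second_order_approx f x y (c : 'I_d -> 'I_d -> R) (theta : R) :
  (forall i z, in_hull x y z -> has_partial i f z) ->
  (forall i j z, in_hull x y z -> has_partial j (partial i f) z) ->
  (forall i j z, in_hull x y z -> `|partial j (partial i f) z - c i j| <= theta) ->
  `|f y - f x - \sum_(i < d) partial i f x * (y 0 i - x 0 i)
    - \sum_(i < d) \sum_(j < d)
        taylor_weight i j * c i j * (y 0 i - x 0 i) * (y 0 j - x 0 j)|
    <= 2 * theta * (\sum_(i < d) `|y 0 i - x 0 i|) ^+ 2.
Proof.
move=> fd fdd fc; set S := \sum_(i < d) `|_|.
have S_ge i : `|y 0 i - x 0 i| <= S.
  by rewrite /S (bigD1 i)//= lerDl sumr_ge0.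
rewrite increment_splice -!sumrB expr2 mulrA {2}/S mulr_sumr.
apply: le_trans (ler_norm_sum _ _ _) _; apply: ler_sum => i _.
set D := y 0 i - x 0 i.
have sub z : in_hull x (splice x y i) z -> in_hull x y z.
  move=> zh j; have := zh j; rewrite mxE; case: ifP => // _.
  by rewrite minxx maxxx => /le_anti <-; rewrite ge_min le_max !lexx.
have th0 : 0 <= theta.
  have xh : in_hull x y x by move=> j; rewrite ge_min le_max !lexx.
  exact: le_trans (normr_ge0 _) (fc i i x xh).
have A : `|f (splice x y i.+1) - f (splice x y i) -
    partial i f (splice x y i) * D - c i i / 2 * D ^+ 2| <= theta * D ^+ 2.
  have := @taylor2_approx R (f \o segment_at x y i)
    (fun u => partial i f (segment_at x y i u))
    (fun u => partial i (partial i f) (segment_at x y i u))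
    (x 0 i) (y 0 i) (c i i) theta.
  rewrite /= segment_at_end segment_at_start; apply.
  - by move=> u ui; apply: is_derive_segment_at; apply: fd; exact: in_hull_segment_at.
  - move=> u ui; apply: is_derive_segment_at; apply: fdd; exact: in_hull_segment_at.
  - by move=> u ui; apply: fc => //; exact: in_hull_segment_at.
have B : `|partial i f (splice x y i) - partial i f x -
    \sum_(j < d) (if (j < i)%N then c i j * (y 0 j - x 0 j) else 0)| <= theta * S.
  have := @first_order_approx (partial i f) x (splice x y i) (c i) theta.
  have -> : \sum_(j < d) c i j * (splice x y i 0 j - x 0 j) =
      \sum_(j < d) (if (j < i)%N then c i j * (y 0 j - x 0 j) else 0).
    by apply: eq_bigr => j _; rewrite mxE; case: ifP => // _; rewrite subrr mulr0.
  move=> H; apply: le_trans (H _ _) _.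
  - by move=> j z /sub; exact: fdd.
  - by move=> j z /sub + _; exact: fc.
  rewrite ler_wpM2l//; apply: ler_sum => j _; rewrite mxE.
  by case: ifP => // _; rewrite subrr normr0.
have -> : \sum_(j < d) taylor_weight i j * c i j * D * (y 0 j - x 0 j) =
    (\sum_(j < d) (if (j < i)%N then c i j * (y 0 j - x 0 j) else 0)) * D
    + c i i / 2 * D ^+ 2.
  rewrite (bigD1 i)//= [in RHS](bigD1 i)//= ltnn add0r addrC mulr_suml.
  rewrite {2}/taylor_weight ltnn eqxx; congr (_ + _); last by rewrite -/D; field.
  apply: eq_bigr => j ji; rewrite /taylor_weight (negbTE ji).
  by case: ifP => _; ring.
set s := \sum_(j < d) _ in B *.
rewrite (_ : _ - _ = (f (splice x y i.+1) - f (splice x y i) -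
    partial i f (splice x y i) * D - c i i / 2 * D ^+ 2) +
    (partial i f (splice x y i) - partial i f x - s) * D); last by ring.
apply: le_trans (ler_normD _ _) _; rewrite normrM.
apply: (@le_trans _ _ (theta * S * `|D| + theta * S * `|D|)).
  apply: lerD; last by rewrite ler_wpM2r.
  apply: le_trans A _; rewrite -real_normK ?num_real// expr2 mulrA.
  by rewrite ler_wpM2r// ler_wpM2l//; exact: S_ge.
by rewrite le_eqVlt; apply/orP; left; apply/eqP; ring.
Qed.

End several_variables.

(** Cauchy-Schwarz against the constant 1, from ab <= (a^2 + b^2) / 2. *)
Lemma sqr_sum_le {R : realFieldType} (I : finType) (a : I -> R) :
  (\sum_i a i) ^+ 2 <= #|I|%:R * \sum_i a i ^+ 2.
Proof.
rewrite expr2 mulr_suml.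
apply: (@le_trans _ _ (\sum_i \sum_j (a i ^+ 2 / 2 + a j ^+ 2 / 2))).
  apply: ler_sum => i _; rewrite mulr_sumr; apply: ler_sum => j _.
  by have := sqr_ge0 (a i - a j); rewrite !expr2; nra.
under eq_bigr do rewrite big_split/= sumr_const.
rewrite big_split/= sumr_const sumrMnl -!mulr_suml -mulrnDl -mulr_natl.
by rewrite le_eqVlt; apply/orP; left; apply/eqP; field.
Qed.

(** Taylor with c = 0: the size of the second derivative serves as its oscillation. *)
Lemma expR_second_order {R : realType} (x X : R) : `|x| <= X ->
  `|expR x - 1 - x| <= expR X * x ^+ 2.
Proof.
move=> xX; have := @taylor2_approx R expR expR expR 0 x 0 (expR X).
rewrite expR0 !subr0 mul1r mul0r mul0r subr0; apply.
move=> z zx; rewrite subr0 ger0_norm ?expR_ge0// ler_expR.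
  apply: le_trans xX; move: zx => /andP[_] /le_trans; apply.
  by rewrite ge_max normr_ge0 ler_norm.
Qed.

(** * Algebra of a single time step *)

Section one_step.
Context {R : realType} {d : nat}.

(* The part of the increment of h over a time step delta that has zero mean when w
   is a Wiener increment; the compensator [(i == j)%:R * delta] accounts for the
   Laplacian. *)
Definition noise_term (sg : R) (hp : 'I_d -> R) (hpp : 'I_d -> 'I_d -> R)
    (delta : R) (w : 'I_d -> R) : R :=
  - sg * (\sum_i hp i * w i) +
  sg ^+ 2 * \sum_i \sum_j @taylor_weight R d i j * hpp i j *
    (w i * w j - (i == j)%:R * delta).

Lemma taylor_weight_bound (i j : 'I_d) : `|@taylor_weight R d i j| <= 1.
Proof.
rewrite /taylor_weight; case: ifP => _; first by rewrite normr1.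
by case: ifP => _; rewrite ?normr0// ger0_norm; lra.
Qed.

Lemma ler_sum_cst (F : 'I_d -> R) (c : R) :
  (forall i, F i <= c) -> \sum_i F i <= d%:R * c.
Proof.
move=> Fc; apply: (@le_trans _ _ (\sum_(i < d) c)); first exact: ler_sum.
by rewrite sumr_const card_ord mulr_natl.
Qed.

Lemma ler_norm_sum_cst (F : 'I_d -> R) (c : R) :
  (forall i, `|F i| <= c) -> `|\sum_i F i| <= d%:R * c.
Proof. by move=> Fc; apply: le_trans (ler_norm_sum _ _ _) _; exact: ler_sum_cst. Qed.

(** Purely algebraic: values and derivatives at the later end point are plain numbers, and the
    Taylor expansion is a hypothesis. The displacements are [- Dq i] and [- (Dp i + sg * w i)]
    because time runs down. The equation turns the drift and the diagonal part of the quadratic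
    noise into kappa g h0 delta. [theta] stands for oscillations and [eta] for the size of a cell;
    both stay below [B], so that their higher powers are absorbed in [C]. *)
Lemma unweighted_step_bound (sg kappa B : R) : 0 <= sg -> 0 <= kappa -> 1 <= B ->
  exists2 C, 0 <= C & forall (delta theta eta h0 h1 ht g : R)
    (hq hp b v w Dq Dp : 'I_d -> R) (hpp : 'I_d -> 'I_d -> R),
  0 <= delta -> delta <= eta -> eta <= B -> 0 <= theta -> theta <= B ->
  (forall i, `|hq i| <= B) -> (forall i, `|hp i| <= B) ->
  (forall i j, `|hpp i j| <= B) ->
  (forall i, `|b i| <= B) -> (forall i, `|v i| <= B) ->
  (forall i, `|Dq i - delta * v i| <= theta * delta) ->
  (forall i, `|Dp i - delta * b i| <= theta * delta) ->
  (forall i, `|Dp i + sg * w i| <= eta) ->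
  - ht - \sum_i hq i * v i - \sum_i hp i * b i +
    sg ^+ 2 / 2 * (\sum_i hpp i i) - kappa * g * h0 = 0 ->
  `|h1 - h0 - (- delta * ht + \sum_i hq i * - Dq i
      + \sum_i hp i * - (Dp i + sg * w i)
      + \sum_i \sum_j taylor_weight i j * hpp i j
           * - (Dp i + sg * w i) * - (Dp j + sg * w j))|
   <= theta * (delta + \sum_i `|Dq i| + 2 * (\sum_i `|Dp i + sg * w i|) ^+ 2) ->
  `|h1 - h0 - kappa * g * h0 * delta - noise_term sg hp hpp delta w|
    <= C * (theta + eta) * (delta + \sum_i w i ^+ 2).
Proof.
move=> sg0 kappa0 B1.
have B0 : 0 <= B by lra.
pose n : R := d%:R.
have n0 : 0 <= n by exact: ler0n.
(* The three summands pay for replacing the displacements by drift times delta at first order, for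
   the products of [Dp] with the displacement at second order, and for the Taylor remainder. *)
exists (2 * n * B + n * n * (B * (2 * B + 2 * B * (1 + 2 * B))) +
  (1 + n * (2 * B) + 2 * (n * n * (8 * B ^+ 3) + n * (2 * sg ^+ 2)))).
  by nneg.
move=> delta theta eta h0 h1 ht g hq hp b v w Dq Dp hpp d0 deta etaB th0 thB.
move=> hqB hpB hppB bB vB DqE DpE DwE pde.
set Dx := fun i => Dp i + sg * w i.
set T := (X in `|_ - X|).
move=> taylor.
set S := \sum_i w i ^+ 2.
have S0 : 0 <= S by apply: sumr_ge0 => i _; exact: sqr_ge0.
have eta0 : 0 <= eta by lra.
have bound (D c : R) : `|D - delta * c| <= theta * delta -> `|c| <= B ->
    `|D| <= 2 * B * delta.
  move=> H1 H2; rewrite -[D](subrK (delta * c)).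
  apply: le_trans (ler_normD _ _) _; rewrite normrM (ger0_norm d0).
  by nra.
have DqB i : `|Dq i| <= 2 * B * delta by exact: bound (DqE i) (vB i).
have DpB i : `|Dp i| <= 2 * B * delta by exact: bound (DpE i) (bB i).
have first_rem : theta * (delta + \sum_i `|Dq i| + 2 * (\sum_i `|Dx i|) ^+ 2)
   <= (1 + n * (2 * B) + 2 * (n * n * (8 * B ^+ 3) + n * (2 * sg ^+ 2))) *
      theta * (delta + S).
  rewrite [leRHS]mulrAC mulrC ler_wpM2r//.
  have H1 : \sum_i `|Dq i| <= n * (2 * B * delta) by exact: ler_sum_cst.
  have H2 : (\sum_i `|Dx i|) ^+ 2 <= n * (n * (8 * B ^+ 3 * delta) + 2 * sg ^+ 2 * S).
    apply: le_trans (sqr_sum_le _) _; rewrite card_ord ler_wpM2l//.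
    rewrite /S mulr_sumr -/n.
    have -> : n * (8 * B ^+ 3 * delta) = \sum_(i < d) (8 * B ^+ 3 * delta).
      by rewrite sumr_const card_ord -[RHS]mulr_natl.
    rewrite -big_split/=; apply: ler_sum => i _.
    rewrite real_normK ?num_real// /Dx.
    have := DpB i; have := sqr_ge0 (Dp i - sg * w i) => H3 H4.
    have H5 : Dp i ^+ 2 <= 4 * B ^+ 3 * delta.
      rewrite -real_normK ?num_real//.
      apply: (@le_trans _ _ ((2 * B * delta) ^+ 2)).
        by rewrite lerXn2r// nnegrE; nneg.
      rewrite (_ : _ ^+ 2 = 4 * B ^+ 2 * delta * delta); last by ring.
      rewrite (_ : 4 * B ^+ 3 * delta = 4 * B ^+ 2 * delta * B); last by ring.
      by rewrite ler_wpM2l//; [nneg | lra].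
    rewrite (_ : (Dp i + sg * w i) ^+ 2 = 2 * Dp i ^+ 2 + 2 * (sg ^+ 2 * w i ^+ 2) - (Dp i - sg * w i) ^+ 2); last by ring.
    by rewrite -mulrA; lra.
  have H6 : 0 <= n * n * (8 * B ^+ 3) * S by nneg.
  have H7 : 0 <= n * (2 * sg ^+ 2) * delta by nneg.
  have H8 : 0 <= n * (2 * B) * S by nneg.
  apply: (@le_trans _ _ (delta + n * (2 * B * delta) + 2 * (n * (n * (8 * B ^+ 3 * delta) + 2 * sg ^+ 2 * S)))).
    by rewrite !lerD// ler_wpM2l.
  rewrite -subr_ge0 (_ : _ - _ = S + n * (2 * B) * S + 2 * (n * n * (8 * B ^+ 3) * S) + 2 * (n * (2 * sg ^+ 2) * delta)); last by ring.
  by nneg.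
have second : `|T - kappa * g * h0 * delta - noise_term sg hp hpp delta w| <=
    2 * n * B * theta * delta + n * n * (B * (2 * B + 2 * B * (1 + 2 * B))) * eta * delta.
  have -> : T - kappa * g * h0 * delta - noise_term sg hp hpp delta w =
    - (\sum_i hq i * (Dq i - delta * v i)) - (\sum_i hp i * (Dp i - delta * b i))
    + \sum_i \sum_j taylor_weight i j * hpp i j * (Dp i * Dx j + sg * w i * Dp j).
    have E1 : \sum_i hq i * (Dq i - delta * v i) =
       - (\sum_i hq i * - Dq i) - delta * \sum_i hq i * v i.
      by rewrite mulr_sumr -sumrN -sumrB; apply: eq_bigr => i _; ring.
    have E2 : \sum_i hp i * (Dp i - delta * b i) =
       - (\sum_i hp i * - Dx i) - sg * (\sum_i hp i * w i) - delta * \sum_i hp i * b i.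
      by rewrite !mulr_sumr -sumrN -!sumrB; apply: eq_bigr => i _; rewrite /Dx; ring.
    (* Off the diagonal the compensator vanishes; on it the weight 1/2 makes it add up to the
       Laplacian term of the equation. *)
    have E3 : sg ^+ 2 * (\sum_i \sum_j taylor_weight i j * hpp i j *
         (w i * w j - (i == j)%:R * delta)) =
       sg ^+ 2 * (\sum_i \sum_j taylor_weight i j * hpp i j * (w i * w j)) -
       delta * (sg ^+ 2 / 2 * \sum_i hpp i i).
      rewrite !mulr_sumr -sumrB; apply: eq_bigr => i _.
      rewrite (bigD1 i)//= [in RHS](bigD1 i)//= !mulrDr eqxx.
      have -> : taylor_weight i i = 2^-1 :> R by rewrite /taylor_weight ltnn eqxx.
      have -> : \sum_(j < d | j != i) taylor_weight i j * hpp i j *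
           (w i * w j - (i == j)%:R * delta) =
         \sum_(j < d | j != i) taylor_weight i j * hpp i j * (w i * w j).
        by apply: eq_bigr => j ji; rewrite eq_sym (negbTE ji) mul0r subr0.
      by rewrite /=; field.
    have E4 : \sum_i \sum_j taylor_weight i j * hpp i j * - Dx i * - Dx j =
       \sum_i \sum_j taylor_weight i j * hpp i j * (Dp i * Dx j + sg * w i * Dp j)
       + sg ^+ 2 * (\sum_i \sum_j taylor_weight i j * hpp i j * (w i * w j)).
      rewrite mulr_sumr -big_split/=; apply: eq_bigr => i _.
      rewrite mulr_sumr -big_split/=; apply: eq_bigr => j _.
      by rewrite /Dx; ring.
    rewrite /T /noise_term -/(Dx) E1 E2 E3 E4.
    (* The backward equation enters here and cancels the terms of pure drift. *)
    have -> : kappa * g * h0 = - ht - \sum_i hq i * v i - \sum_i hp i * b i +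
      sg ^+ 2 / 2 * (\sum_i hpp i i) by apply/esym/subr0_eq.
    by ring.
  have F1 : `|\sum_i hq i * (Dq i - delta * v i)| <= n * (B * (theta * delta)).
    by apply: ler_norm_sum_cst => i; rewrite normrM ler_pM.
  have F2 : `|\sum_i hp i * (Dp i - delta * b i)| <= n * (B * (theta * delta)).
    by apply: ler_norm_sum_cst => i; rewrite normrM ler_pM.
  have F3 : `|\sum_i \sum_j taylor_weight i j * hpp i j *
       (Dp i * Dx j + sg * w i * Dp j)| <=
     n * (n * (B * ((2 * B + 2 * B * (1 + 2 * B)) * (eta * delta)))).
    apply: ler_norm_sum_cst => i; apply: ler_norm_sum_cst => j.
    rewrite normrM ler_pM//.
      by rewrite normrM -[leRHS]mul1r ler_pM// taylor_weight_bound.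
    apply: le_trans (ler_normD _ _) _; rewrite [X in _ <= X * _]addrC mulrDl addrC.
    (* The noise displacement is the total displacement, at most eta, minus the drift part, at most
       2 B delta; so it is O(eta) too. *)
    have swB : `|sg * w i| <= (1 + 2 * B) * eta.
      rewrite (_ : sg * w i = Dx i - Dp i); last by rewrite /Dx; ring.
      apply: le_trans (ler_normB _ _) _.
      by have := DwE i; have := DpB i; rewrite -/(Dx i); nra.
    apply: lerD.
      rewrite normrM (_ : _ * (eta * delta) = ((1 + 2 * B) * eta) * (2 * B * delta)); last by ring.
      by rewrite ler_pM.
    rewrite normrM (_ : _ * (eta * delta) = (2 * B * delta) * eta); last by ring.
    by rewrite ler_pM//; exact: DwE.
  apply: le_trans (ler_normD _ _) _.
  apply: le_trans (lerD (ler_normB _ _) (lexx _)) _; rewrite normrN.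
  apply: le_trans (lerD (lerD F1 F2) F3) _.
  by rewrite le_eqVlt; apply/orP; left; apply/eqP; ring.
rewrite (_ : h1 - h0 - _ - _ = (h1 - h0 - T) +
  (T - kappa * g * h0 * delta - noise_term sg hp hpp delta w)); last by ring.
apply: le_trans (ler_normD _ _) _.
apply: le_trans (lerD (le_trans taylor first_rem) second) _.
set C1 := 1 + n * (2 * B) + _; set C2 := n * n * (B * _).
have C10 : 0 <= C1 by rewrite /C1; nneg.
have C20 : 0 <= C2 by rewrite /C2; nneg.
have C30 : 0 <= 2 * n * B by nneg.
have eqn : (2 * n * B + C2 + C1) * (theta + eta) * (delta + S) -
  (C1 * theta * (delta + S) + (2 * n * B * theta * delta + C2 * eta * delta)) =
  C1 * eta * (delta + S) + 2 * n * B * theta * S + 2 * n * B * eta * (delta + S)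
  + C2 * theta * (delta + S) + C2 * eta * S by ring.
have dS : 0 <= delta + S by rewrite addr_ge0.
by rewrite -subr_ge0 eqn; nneg.
Qed.

End one_step.

(** Discrete product rule: the first-order part of the exponential contributes - kappa Dz h1, which
    cancels, up to errors of the stated size, the drift kappa g h0 delta left by
    [unweighted_step_bound]. [E] bounds the weight at the later end. *)
Lemma weighted_step_bound {R : realType} (kappa B E C1 : R) :
  0 <= kappa -> 1 <= B -> 0 <= E -> 0 <= C1 ->
  exists2 C, 0 <= C & forall (delta theta eta h0 h1 g z Dz N S : R),
  0 <= delta -> delta <= eta -> eta <= B -> 0 <= theta -> theta <= B -> 0 <= S ->
  `|h1| <= B -> `|g| <= B -> `|h1 - h0| <= theta ->
  `|Dz - delta * g| <= theta * delta -> expR (- kappa * z) <= E ->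
  `|h1 - h0 - kappa * g * h0 * delta - N| <= C1 * (theta + eta) * (delta + S) ->
  `|expR (- kappa * (z + Dz)) * h1 - expR (- kappa * z) * h0
     - expR (- kappa * z) * N| <= C * (theta + eta) * (delta + S).
Proof.
move=> kappa0 B1 E0 C10.
have B0 : 0 <= B by lra.
pose A := expR (2 * kappa * B ^+ 2) * (4 * kappa ^+ 2 * B ^+ 3).
have A0 : 0 <= A by rewrite /A; nneg.
exists (E * (C1 + A + 2 * kappa * B)); first by nneg.
move=> delta theta eta h0 h1 g z Dz N S d0 deta etaB th0 thB S0 h1B gB h01 DzE zE main.
have eta0 : 0 <= eta by lra.
have DzB : `|Dz| <= 2 * B * delta.
  rewrite -[Dz](subrK (delta * g)).
  apply: le_trans (ler_normD _ _) _; rewrite normrM (ger0_norm d0).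
  by nra.
have expE : `|expR (- kappa * Dz) - 1 + kappa * Dz| <=
    expR (2 * kappa * B ^+ 2) * (4 * kappa ^+ 2 * B ^+ 2 * delta * eta).
  rewrite (_ : _ + kappa * Dz = expR (- kappa * Dz) - 1 - (- kappa * Dz)); last by ring.
  apply: le_trans (@expR_second_order _ _ (2 * kappa * B ^+ 2) _) _.
    rewrite normrM normrN (ger0_norm kappa0) mulrC.
    apply: (@le_trans _ _ (2 * B * delta * kappa)); first by rewrite ler_wpM2r.
    rewrite (_ : 2 * kappa * B ^+ 2 = 2 * B * B * kappa); last by ring.
    by rewrite ler_wpM2r// ler_wpM2l//; [nneg | lra].
  rewrite ler_wpM2l ?expR_ge0//.
  apply: (@le_trans _ _ (kappa ^+ 2 * (2 * B * delta) ^+ 2)).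
    rewrite exprMn sqrrN ler_wpM2l ?sqr_ge0//.
    by rewrite -real_normK ?num_real// lerXn2r// nnegrE; nneg.
  rewrite (_ : kappa ^+ 2 * _ = 4 * kappa ^+ 2 * B ^+ 2 * delta * delta); last by ring.
  by rewrite ler_wpM2l//; nneg.
(* The three groups are the error for h, the second-order error of the exponential, and the mismatch
   between kappa Dz h1 and kappa g h0 delta. *)
rewrite (_ : _ - _ - _ = expR (- kappa * z) *
   ((h1 - h0 - kappa * g * h0 * delta - N)
    + (expR (- kappa * Dz) - 1 + kappa * Dz) * h1
    - (kappa * (Dz - delta * g) * h1 + kappa * delta * g * (h1 - h0)))); last first.
  by rewrite mulrDr expRD; ring.
rewrite normrM (ger0_norm (expR_ge0 _)) -[leRHS]mulrA -[leRHS]mulrA ler_pM ?expR_ge0//.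
apply: le_trans (ler_normB _ _) _.
apply: le_trans (lerD (ler_normD _ _) (ler_normD _ _)) _.
have F1 : `|(expR (- kappa * Dz) - 1 + kappa * Dz) * h1| <= A * (eta * delta).
  rewrite normrM (_ : A * _ = (expR (2 * kappa * B ^+ 2) *
    (4 * kappa ^+ 2 * B ^+ 2 * delta * eta)) * B); last by rewrite /A; ring.
  by rewrite ler_pM.
have F2 : `|kappa * (Dz - delta * g) * h1| <= kappa * B * (theta * delta).
  rewrite !normrM (ger0_norm kappa0) -!mulrA ler_wpM2l// [leRHS]mulrC.
  by rewrite ler_pM.
have F3 : `|kappa * delta * g * (h1 - h0)| <= kappa * B * (theta * delta).
  rewrite !normrM (ger0_norm kappa0) (ger0_norm d0) -!mulrA ler_wpM2l//.
  rewrite (_ : B * (theta * delta) = delta * (B * theta)); last by ring.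
  by rewrite ler_wpM2l// ler_pM.
apply: le_trans (lerD (lerD main F1) (lerD F2 F3)) _.
rewrite -subr_ge0 (_ : _ - _ = A * (theta * (delta + S) + eta * S) +
  2 * kappa * B * (theta * S + eta * (delta + S))); last by ring.
by nneg.
Qed.

Lemma between_close {R : realFieldType} (a t s s' u eta : R) :
  a <= s <= t -> a <= s' <= t -> `|s - s'| < eta ->
  Num.min s s' <= u <= Num.max s s' -> a <= u <= t /\ `|s - u| < eta.
Proof.
rewrite !ltr_norml ge_min le_max => /andP[? ?] /andP[? ?] /andP[? ?].
by move=> /andP[/orP[?|?] /orP[?|?]]; split; apply/andP; split; lra.
Qed.

(** * Taylor expansion in phase space *)

Section phase_space.
Context {R : realType} {d : nat}.
Notation V := 'rV[R]_d.

Definition phase_box (a t n : R) : set (R * (V * V)) :=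
  `[a, t] `*` ([set q : V | forall i, `|q 0 i| <= n] `*` [set p : V | forall i, `|p 0 i| <= n]).

Lemma compact_phase_box a t n : compact (phase_box a t n).
Proof.
apply: compact_setX; first exact: segment_compact.
have H : compact [set v : V | forall i, `|v 0 i| <= n].
  rewrite (_ : [set v | _] = [set v : V | forall i, `[- n, n]%classic (v ord0 i)]).
    exact: (@rV_compact R d (fun=> `[- n, n]%classic) (fun=> @segment_compact _ _ _)).
  apply/seteqP; split => v /= vn i; have := vn i; rewrite ?in_itv/= ler_norml//.
exact: compact_setX.
Qed.

(** One derivative in t and q, two in p, as the noise acts on p alone. All of this is asked for on
    the open half-line t > ti, where the equation holds. *)
Record twice_differentiable (ti : R) (h : R -> V -> V -> R) : Prop := {
  td_t : forall t q p, ti < t -> derivable (fun s => h s q p) t 1;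
  td_q : forall t q p i, ti < t -> has_partial i (fun q' => h t q' p) q;
  td_p : forall t q p i, ti < t -> has_partial i (h t q) p;
  td_pp : forall t q p i j, ti < t -> has_partial j (partial i (h t q)) p;
  td_continuous : jointly_continuous_on `]ti, +oo[ h;
  td_continuous_t :
    jointly_continuous_on `]ti, +oo[ (fun t q p => derive1 (fun s => h s q p) t);
  td_continuous_q : forall i, jointly_continuous_on `]ti, +oo[
      (fun t q p => partial i (fun q' => h t q' p) q);
  td_continuous_p : forall i,
    jointly_continuous_on `]ti, +oo[ (fun t q p => partial i (h t q) p);
  td_continuous_pp : forall i j,
    jointly_continuous_on `]ti, +oo[ (fun t q p => partial j (partial i (h t q)) p) }.

Definition oscillation_le (K : set (R * (V * V))) (eta theta : R)
    (F : R -> V -> V -> R) : Prop :=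
  forall x y, K x -> K y -> ball x eta y ->
    `|F x.1 x.2.1 x.2.2 - F y.1 y.2.1 y.2.2| <= theta.

Lemma hull_bounded n (x y z : V) : (forall i, `|x 0 i| <= n) ->
  (forall i, `|y 0 i| <= n) -> in_hull x y z -> forall i, `|z 0 i| <= n.
Proof.
move=> xn yn zh i; have := zh i; have := xn i; have := yn i.
rewrite !ler_norml ge_min le_max.
by move=> /andP[? ?] /andP[? ?] /andP[/orP[?|?] /orP[?|?]]; apply/andP; split; lra.
Qed.

Lemma hull_close (eta : R) (x y z : V) : (forall i, `|y 0 i - x 0 i| < eta) ->
  in_hull x y z -> forall i, `|x 0 i - z 0 i| < eta.
Proof.
move=> yx zh i; have := zh i; have := yx i.
rewrite !ltr_norml ge_min le_max.
by move=> /andP[? ?] /andP[/orP[?|?] /orP[?|?]]; apply/andP; split; lra.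
Qed.

Lemma ball_rV (eta : R) (x y : V) : 0 < eta -> (forall i, `|x 0 i - y 0 i| < eta) ->
  ball x eta y.
Proof. by move=> eta0 H; split => // i j; rewrite ord1; exact: H. Qed.

(** The way from (s, q, p) to (s', q', p') changes p first, then q, then s. Along a path the
    increments of p are of the order of the square root of the time step, so their leg starts at the
    base point and is expanded there to second order. Those of q and s are of the order of the step;
    for them it suffices that the first derivatives at displaced points stay within theta of those
    at the base point. *)
Lemma phase_taylor ti h a t n eta theta : twice_differentiable ti h -> ti < a ->
  let K := phase_box a t n in
  oscillation_le K eta theta (fun t q p => derive1 (fun s => h s q p) t) ->
  (forall i, oscillation_le K eta theta
    (fun t q p => partial i (fun q' => h t q' p) q)) ->
  (forall i j, oscillation_le K eta theta
    (fun t q p => partial j (partial i (h t q)) p)) ->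
  forall s q p s' q' p', K (s, (q, p)) -> K (s', (q', p')) ->
  `|s - s'| < eta -> (forall i, `|q' 0 i - q 0 i| < eta) ->
  (forall i, `|p' 0 i - p 0 i| < eta) ->
  `|h s' q' p' - h s q p - ((s' - s) * derive1 (fun s => h s q p) s
     + \sum_i partial i (fun q' => h s q' p) q * (q' 0 i - q 0 i)
     + \sum_i partial i (h s q) p * (p' 0 i - p 0 i)
     + \sum_i \sum_j taylor_weight i j * partial j (partial i (h s q)) p
         * (p' 0 i - p 0 i) * (p' 0 j - p 0 j))|
  <= theta * (`|s' - s| + \sum_i `|q' 0 i - q 0 i|
      + 2 * (\sum_i `|p' 0 i - p 0 i|) ^+ 2).
Proof.
move=> hreg tia K ot oq op s q p s' q' p' Kx Ky ss qq pp.
have eta0 : 0 < eta by exact: le_lt_trans (normr_ge0 _) ss.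
have [/= /itvP sI [/= qn pn]] := Kx; have [/= /itvP sI' [/= qn' pn']] := Ky.
have Kin u (y z : V) : a <= u <= t -> (forall i, `|y 0 i| <= n) ->
    (forall i, `|z 0 i| <= n) -> K (u, (y, z)).
  by move=> uat yn zn; split; [rewrite /= in_itv|split].
have sat : a <= s <= t by rewrite !sI.
have bsym (x y : V) : ball x eta y -> ball y eta x by exact: ball_sym.
have tis : ti < s by rewrite (lt_le_trans tia)// sI.
have hull_refl (x y : V) : in_hull x y x.
  by move=> j; rewrite ge_min le_max !lexx.
have hull_refl' (x y : V) : in_hull x y y.
  by move=> j; rewrite ge_min le_max !lexx !orbT.
have P1 := @second_order_approx R d (h s q) p p'
  (fun i j => partial j (partial i (h s q)) p) theta
  (fun i z _ => td_p hreg tis) (fun i j z _ => td_pp hreg tis).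
have P2 := @first_order_approx R d (fun q' => h s q' p') q q'
  (fun i => partial i (fun q' => h s q' p) q) theta
  (fun i z _ => td_q hreg tis).
have P3 := @mean_value_approx R (fun s => h s q' p')
  (fun s => derive1 (fun s => h s q' p') s) s s' (derive1 (fun s => h s q p) s) theta.
rewrite mulrDr [theta * (_ + \sum_i _)]mulrDr mulrCA mulrA.
have {}P1 := P1 _; have {}P2 := P2 _; have {}P3 := P3 _ _.
set A1 := (X in `|X| <= _ * `|s' - s|) in P3.
set A2 := (X in `|X| <= _ * \sum_i `|q' 0 i - q 0 i|) in P2.
set A3 := (X in `|X| <= _) in P1.
rewrite (_ : _ - _ = A1 + A2 + A3); last by rewrite /A1 /A2 /A3; ring.
apply: le_trans (ler_normD _ _) _; apply: lerD; last first.
  apply: P1 => i j z zh; have := op i j (s, (q, z)) (s, (q, p)); apply => //=.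
  - by apply: Kin => //; exact: hull_bounded zh.
  - split; first exact: ballxx.
    split; first exact: ballxx.
    by apply: bsym; apply: ball_rV => //; exact: hull_close zh.
apply: le_trans (ler_normD _ _) _; apply: lerD; last first.
  apply: P2 => i z zh _; have := oq i (s, (z, p')) (s, (q, p)); apply => //=.
  - by apply: Kin => //; exact: hull_bounded zh.
  - split; first exact: ballxx.
    split; apply: bsym; apply: ball_rV => //; first exact: hull_close zh.
    exact: hull_close pp (hull_refl' _ _).
have uI (u : R) : Num.min s s' <= u <= Num.max s s' -> a <= u <= t /\ `|s - u| < eta.
  by apply: between_close ss; rewrite // !sI'.
apply: P3 => u /uI[uat us].
- have := @td_t _ _ hreg u q' p'.
  have tiu : ti < u by case/andP: uat => + _; exact: lt_le_trans.
  move=> /(_ tiu) H; rewrite derive1E; exact: derivableP.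
- have := ot (u, (q', p')) (s, (q, p)); apply => //=.
  split; first by rewrite /ball/= distrC.
  split; apply: bsym; apply: ball_rV => //.
    exact: hull_close qq (hull_refl' _ _).
  exact: hull_close pp (hull_refl' _ _).
Qed.

End phase_space.

(** * Integrals over short intervals *)

Section interval_integral.
Context {R : realType}.
Notation mu := (@lebesgue_measure R).
Implicit Types (g : R -> R) (a s t c theta : R).

Lemma integrable_subsegment g a t s s' : {within `[a, t], continuous g} ->
  a <= s' -> s <= t -> mu.-integrable `[s', s] (EFin \o g).
Proof.
move=> gc as' st; apply: continuous_compact_integrable; first exact: segment_compact.
apply: continuous_subspaceW gc => r /=; rewrite !in_itv/= => /andP[s'r rs].
by rewrite (le_trans as' s'r) (le_trans rs st).
Qed.

Lemma Rintegral_split g a t s s' : {within `[a, t], continuous g} ->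
  a <= s' -> s' <= s -> s <= t ->
  \int[mu]_(r in `[s', t]) g r =
  \int[mu]_(r in `[s', s]) g r + \int[mu]_(r in `[s, t]) g r.
Proof.
move=> gc as' s's st.
have gi := @integrable_subsegment g a t t s' gc as' (lexx _).
have gi' := @integrable_subsegment g a t t s gc (le_trans as' s's) (lexx _).
rewrite -(@Rintegral_itv_obnd_cbnd R s (BRight t) g); last first.
  by apply: integrableS gi' => //; exact: subset_itv_oc_cc.
rewrite -(@Rintegral_itvB _ g (BLeft s') (BRight t) s) ?bnd_simp//.
by rewrite addrC subrK.
Qed.

Lemma Rintegral_approx g a t s s' c theta : {within `[a, t], continuous g} ->
  a <= s' -> s' <= s -> s <= t ->
  (forall r, s' <= r <= s -> `|g r - c| <= theta) ->
  `|\int[mu]_(r in `[s', s]) g r - (s - s') * c| <= theta * (s - s').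
Proof.
move=> gc as' s's st gth.
have gi := integrable_subsegment gc as' st.
have ci (e : R) : mu.-integrable `[s', s] (EFin \o cst e).
  apply: continuous_compact_integrable; first exact: segment_compact.
  exact/continuous_subspaceT/cst_continuous.
have cI (e : R) : \int[mu]_(r in `[s', s]) e = e * (s - s').
  rewrite Rintegral_cst//= lebesgue_measure_itv/= lte_fin.
  by move: s's; rewrite le_eqVlt => /predU1P[->|->//]; rewrite ltxx subrr.
have -> : \int[mu]_(r in `[s', s]) g r - (s - s') * c =
    \int[mu]_(r in `[s', s]) (g r - c).
  rewrite [(s - s') * c]mulrC -cI; apply/esym.
  by apply: (RintegralB _ gi (ci c)); exact: measurable_itv.
have gci : mu.-integrable `[s', s] (EFin \o (fun r => g r - c)).
  by apply: (integrableB _ gi (ci c)); exact: measurable_itv.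
apply: le_trans (le_normr_Rintegral _ gci) _; first exact: measurable_itv.
rewrite -cI; apply: le_Rintegral => //.
- exact: (integrable_norm gci).
- exact: (ci theta).
Qed.

Lemma Rintegral_bound g a t s s' c : {within `[a, t], continuous g} ->
  a <= s' -> s' <= s -> s <= t ->
  (forall r, s' <= r <= s -> `|g r| <= c) ->
  `|\int[mu]_(r in `[s', s]) g r| <= c * (s - s').
Proof.
move=> gc as' s's st gth.
have := @Rintegral_approx g a t s s' 0 c gc as' s's st.
by rewrite mulr0 subr0; apply => r rs; rewrite subr0; exact: gth.
Qed.

End interval_integral.

(** As [s] is nonincreasing, the indices with [sigma < s k.+1] form an initial segment, over which
    the sum telescopes. The last two clauses place sigma in the cell between [s j.+1] and [s j], up
    to the ends of the grid. *)
Lemma telescope_until {R : realDomainType} (f s : nat -> R) (sigma : R) (n : nat) :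
  (forall k, s k.+1 <= s k) ->
  exists j, [/\ (j <= n)%N,
    \sum_(k < n) (if sigma < s k.+1 then f k.+1 - f k else 0) = f j - f 0%N,
    j = 0%N \/ sigma < s j & j = n \/ s j.+1 <= sigma].
Proof.
move=> sd; elim: n => [|n [j [jn sumE js jS]]].
  by exists 0%N; split; [|rewrite big_ord0 subrr|left|left].
rewrite big_ord_recr/= sumE; have [sn|sn] := ltrP sigma (s n.+1); last first.
  exists j; split => //; [exact: leqW|by rewrite addr0|].
  by case: jS => [->|]; right.
exists n.+1; split => //; [|by right|by left].
case: jS => [->|sj]; first by ring.
move: jn; rewrite leq_eqVlt => /predU1P[->|jn]; first by ring.
have : s n.+1 <= s j.+1.
  by apply: (nonincreasing_seqP s).1 => //; exact: ltnW.
by move=> /(lt_le_trans sn)/lt_le_trans/(_ sj); rewrite ltxx.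
Qed.

(** Meant for the single cell containing the stopping time, whose noise is not matched by an
    increment. The compensator is estimated crudely by delta for each of the d^2 pairs. *)
Lemma noise_term_bound {R : realType} (d : nat) (sg B delta : R)
    (hp w : 'I_d -> R) (hpp : 'I_d -> 'I_d -> R) : 0 <= sg -> 0 <= delta ->
  (forall i, `|hp i| <= B) -> (forall i j, `|hpp i j| <= B) ->
  `|noise_term sg hp hpp delta w| <= sg * B * (\sum_i `|w i|) +
    sg ^+ 2 * B * ((\sum_i `|w i|) ^+ 2 + d%:R ^+ 2 * delta).
Proof.
move=> sg0 d0 hpB hppB; pose W : R := \sum_i `|w i|; rewrite -/W.
apply: le_trans (ler_normD _ _) _; rewrite mulNr normrN [`|sg * _|]normrM [`|sg ^+ 2 * _|]normrM (ger0_norm sg0).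
rewrite (ger0_norm (sqr_ge0 _)) -[sg * B * W]mulrA -[sg ^+ 2 * B * _]mulrA.
apply: lerD; rewrite ler_wpM2l ?sqr_ge0//.
  rewrite mulr_sumr; apply: le_trans (ler_norm_sum _ _ _) _.
  by apply: ler_sum => i _; rewrite normrM ler_wpM2r.
have -> : W ^+ 2 + d%:R ^+ 2 * delta = \sum_i \sum_j (`|w i| * `|w j| + delta).
  under [RHS]eq_bigr do rewrite big_split/= -mulr_sumr sumr_const card_ord.
  rewrite big_split/= -mulr_suml sumr_const card_ord expr2 -/W.
  by rewrite -[in RHS]mulrnA -[in RHS]mulr_natl natrM expr2.
rewrite mulr_sumr; apply: le_trans (ler_norm_sum _ _ _) _; apply: ler_sum => i _.
rewrite mulr_sumr; apply: le_trans (ler_norm_sum _ _ _) _; apply: ler_sum => j _.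
rewrite !normrM -[leRHS]mul1r -mulrA; apply: ler_pM => //.
  exact: taylor_weight_bound.
apply: ler_pM => //; apply: le_trans (ler_normB _ _) _; rewrite normrM lerD2l.
by rewrite normrM (ger0_norm d0) ger0_norm ?ler0n// ler_piMl// lern1; case: (_ == _).
Qed.

Lemma within_continuous_comp {T1 T2 T3 : topologicalType} (A : set T1) (B : set T2)
    (X : T1 -> T2) (G : T2 -> T3) :
  {within A, continuous X} -> {within B, continuous G} ->
  (forall x, A x -> B (X x)) -> {within A, continuous (G \o X)}.
Proof.
move=> /subspace_continuousP XA /subspace_continuousP GB XAB.
apply/subspace_continuousP => x Ax /= U /(GB _ (XAB x Ax)) UB.
have := XA x Ax _ UB; rewrite /= /within/= /nbhs/= => H.
by apply: filterS H => y /= H Ay; apply: H => //; exact: XAB.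
Qed.

(** * Increments along a single path *)

Section backward_paths.
Context {R : realType} {d : nat} (m tau sg kappa ti : R).
Notation V := 'rV[R]_d.
Notation mu := (@lebesgue_measure R).
Variables (U : R -> V -> R) (h : R -> V -> V -> R).

Definition friction (i : 'I_d) (r : R) (q p : V) : R :=
  p 0 i / tau - grad (U r) q 0 i.
Definition velocity (i : 'I_d) (r : R) (q p : V) : R := p 0 i / m.
Definition power (r : R) (q p : V) : R := dot (grad (U r) q) p.

Definition time_derivative (t : R) (q p : V) : R := derive1 (fun s => h s q p) t.
Definition q_derivative (i : 'I_d) (t : R) (q p : V) : R :=
  partial i (fun q' => h t q' p) q.
Definition p_derivative (i : 'I_d) (t : R) (q p : V) : R := partial i (h t q) p.
Definition pp_derivative (i j : 'I_d) (t : R) (q p : V) : R :=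
  partial j (partial i (h t q)) p.

(** Gathers the functions of the one-step estimate under one predicate, so that boundedness and
    small oscillation are each established in one stroke. *)
Definition all_coefficients (Q : (R -> V -> V -> R) -> Prop) : Prop :=
  Q h /\ Q time_derivative /\ (forall i, Q (q_derivative i)) /\
  (forall i, Q (p_derivative i)) /\ (forall i j, Q (pp_derivative i j)) /\
  (forall i, Q (friction i)) /\ (forall i, Q (velocity i)) /\ Q power.

(** The generator of the process run downwards in time, in which the derivatives in t, q and p all
    carry a minus sign, multiplies [h] by kappa times the power. *)
Definition backward_equation_on : Prop := forall s q p, ti < s ->
  - time_derivative s q p - \sum_i q_derivative i s q p * velocity i s q p
  - \sum_i p_derivative i s q p * friction i s q p
  + sg ^+ 2 / 2 * (\sum_i pp_derivative i i s q p)
  - kappa * power s q p * h s q p = 0.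

Record backward_path (t : R) (q0 p0 : V) (w qs ps : R -> V) : Prop := {
  path_continuous_q : {within `[ti, t], continuous qs};
  path_continuous_p : {within `[ti, t], continuous ps};
  path_equation : forall s i, ti <= s -> s <= t ->
    qs s 0 i = q0 0 i - \int[mu]_(r in `[s, t]) velocity i r (qs r) (ps r) /\
    ps s 0 i = p0 0 i - \int[mu]_(r in `[s, t]) friction i r (qs r) (ps r)
      - sg * (w t - w s) 0 i }.

Definition work (t : R) (qs ps : R -> V) (s : R) : R :=
  \int[mu]_(r in `[s, t]) power r (qs r) (ps r).

Definition weighted_path (t : R) (qs ps : R -> V) (s : R) : R :=
  expR (- kappa * work t qs ps s) * h s (qs s) (ps s).

Definition path_noise (t : R) (w qs ps : R -> V) (s s' : R) : R :=
  expR (- kappa * work t qs ps s) *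
  noise_term sg (fun i => p_derivative i s (qs s) (ps s))
    (fun i j => pp_derivative i j s (qs s) (ps s)) (s - s')
    (fun i => (w s - w s') 0 i).

Lemma continuous_along_path (t : R) (qs ps : R -> V) (F : R -> V -> V -> R) :
  {within `[ti, t], continuous qs} -> {within `[ti, t], continuous ps} ->
  jointly_continuous_on `[ti, +oo[ F ->
  {within `[ti, t], continuous (fun r => F r (qs r) (ps r))}.
Proof.
move=> /subspace_continuousP cq /subspace_continuousP cp cF.
apply: (@within_continuous_comp _ _ _ _ _
  (fun r => (r, (qs r, ps r))) (fun z => F z.1 z.2.1 z.2.2) _ cF).
  apply/subspace_continuousP => x xA.
  apply: (cvg_pair (G := nbhs x) (H := nbhs (qs x, ps x))).
    exact: cvg_within.
  by apply: (cvg_pair (G := nbhs (qs x)) (H := nbhs (ps x))); [exact: cq|exact: cp].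
by move=> x /=; rewrite !in_itv/= andbT => /andP[].
Qed.

Hypotheses (hreg : twice_differentiable ti h) (hpde : backward_equation_on).
Hypothesis cU : forall i, jointly_continuous_on `[ti, +oo[
  (fun t q p => grad (U t) q 0 i).

Lemma coordinate_jointly_continuous (A : set R) (i : 'I_d) :
  jointly_continuous_on A (fun _ _ p => p 0 i).
Proof.
apply: continuous_subspaceT => z.
apply: (@continuous_comp _ _ _ (fun z : R * (V * V) => z.2.2) (fun p => p 0 i)).
  by apply: (@continuous_comp _ _ _ snd snd); exact: cvg_snd.
exact: coord_continuous.
Qed.

Lemma continuous_friction i : jointly_continuous_on `[ti, +oo[ (friction i).
Proof.
move=> x; apply: cvgB; last exact: cU.
by apply: cvgM; [exact: coordinate_jointly_continuous|exact: cvg_cst].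
Qed.

Lemma continuous_velocity i : jointly_continuous_on `[ti, +oo[ (velocity i).
Proof.
by move=> x; apply: cvgM; [exact: coordinate_jointly_continuous|exact: cvg_cst].
Qed.

Lemma continuous_power : jointly_continuous_on `[ti, +oo[ power.
Proof.
rewrite /power /dot => x; apply: cvg_big => [|i _]; first exact: add_continuous.
by apply: cvgM; [exact: cU|exact: coordinate_jointly_continuous].
Qed.

(** [C] is chosen before the path, from [B], [sg], [kappa], the dimension and [t - a]; this
    uniformity makes the remainder estimate usable under an expectation. *)
Lemma path_step_bound a t n B : ti < a -> 0 <= sg -> 0 <= kappa -> 1 <= B ->
  let K := phase_box a t n in
  all_coefficients (fun F => forall z, K z -> `|F z.1 z.2.1 z.2.2| <= B) ->
  exists2 C, 0 <= C & forall q0 p0 w qs ps, backward_path t q0 p0 w qs ps ->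
  forall s' s theta eta : R, a <= s' -> s' <= s -> s <= t ->
  0 < eta -> eta <= B -> 0 <= theta -> theta <= B ->
  all_coefficients (oscillation_le K eta theta) ->
  (forall r, s' <= r <= s -> ball (s, (qs s, ps s)) eta (r, (qs r, ps r))) ->
  (forall r, s' <= r <= t -> K (r, (qs r, ps r))) ->
  `|weighted_path t qs ps s' - weighted_path t qs ps s - path_noise t w qs ps s s'|
   <= C * (theta + eta) * ((s - s') + \sum_i (w s - w s') 0 i ^+ 2).
Proof.
move=> tia sg0 k0 B1 K [hB [htB [hqB [hpB [hppB [frB [veB poB]]]]]]].
have [C1 C10 step1] := @unweighted_step_bound R d sg kappa B sg0 k0 B1.
have B0 : 0 <= B by lra.
(* In the box the power is at most [B], so the work is at most B (t - a) in absolute value; this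
   gives the bound on the weight. *)
have [C C0 step2] := @weighted_step_bound R kappa B (expR (kappa * (B * (t - a)))) C1
  k0 B1 (expR_ge0 _) C10.
exists C => // q0 p0 w qs ps [cq cp eqn] s' s theta eta as' s's st eta0 etaB th0 thB.
move=> [oh [oht [ohq [ohp [ohpp [ofr [ove opo]]]]]]] close inK.
have tia' := ltW tia.
have as_ : a <= s by exact: le_trans s's.
have Ks : K (s, (qs s, ps s)) by apply: inK; rewrite s's.
have Ks' : K (s', (qs s', ps s')) by apply: inK; rewrite lexx (le_trans s's).
have tis' : ti <= s' by exact: le_trans as'.
have tis : ti <= s by exact: le_trans as_.
have d0 : 0 <= s - s' by rewrite subr_ge0.
have [/= ds [dq dp]] : ball (s, (qs s, ps s)) eta (s', (qs s', ps s')).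
  by apply: close; rewrite lexx.
have deta : s - s' <= eta by rewrite -[s - s']ger0_norm//; exact: ltW.
have ve_c i := continuous_along_path cq cp (@continuous_velocity i).
have fr_c i := continuous_along_path cq cp (@continuous_friction i).
have po_c := continuous_along_path cq cp (@continuous_power).
have approx F : oscillation_le K eta theta F ->
    {within `[ti, t], continuous (fun r => F r (qs r) (ps r))} ->
    `|\int[mu]_(r in `[s', s]) F r (qs r) (ps r) - (s - s') * F s (qs s) (ps s)|
      <= theta * (s - s').
  move=> oF cF'; apply: (Rintegral_approx cF') => // r rs.
  rewrite distrC; have := oF (s, (qs s, ps s)) (r, (qs r, ps r)); apply => //.
    by apply: inK; case/andP: rs => -> /=; move/le_trans; apply.
  exact: close.
pose Dq i := \int[mu]_(r in `[s', s]) velocity i r (qs r) (ps r).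
pose Dp i := \int[mu]_(r in `[s', s]) friction i r (qs r) (ps r).
pose Dz := \int[mu]_(r in `[s', s]) power r (qs r) (ps r).
pose dw i := (w s - w s') 0 i.
have qE i : qs s' 0 i - qs s 0 i = - Dq i.
  rewrite (eqn s' i tis' (le_trans s's st)).1 (eqn s i tis st).1.
  by rewrite (Rintegral_split (ve_c i) tis' s's st) /Dq; ring.
have pE i : ps s' 0 i - ps s 0 i = - (Dp i + sg * dw i).
  rewrite (eqn s' i tis' (le_trans s's st)).2 (eqn s i tis st).2.
  by rewrite (Rintegral_split (fr_c i) tis' s's st) /Dp /dw !mxE; ring.
have zE : work t qs ps s' = work t qs ps s + Dz.
  by rewrite /work (Rintegral_split po_c tis' s's st) addrC.
have dq' i : `|qs s' 0 i - qs s 0 i| < eta by rewrite distrC; exact: dq.2.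
have dp' i : `|ps s' 0 i - ps s 0 i| < eta by rewrite distrC; exact: dp.2.
have taylor := phase_taylor hreg tia oht ohq ohpp Ks Ks' ds dq' dp'.
have noise := step1 (s - s') theta eta (h s (qs s) (ps s)) (h s' (qs s') (ps s'))
  (time_derivative s (qs s) (ps s)) (power s (qs s) (ps s))
  (fun i => q_derivative i s (qs s) (ps s)) (fun i => p_derivative i s (qs s) (ps s))
  (fun i => friction i s (qs s) (ps s)) (fun i => velocity i s (qs s) (ps s))
  dw Dq Dp (fun i j => pp_derivative i j s (qs s) (ps s)).
rewrite /weighted_path /path_noise zE.
apply: (step2 (s - s') theta eta _ _ (power s (qs s) (ps s))) => //.
- by apply: sumr_ge0 => i _; exact: sqr_ge0.
- exact: (hB _ Ks').
- exact: (poB _ Ks).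
- by rewrite distrC; apply: oh Ks Ks' _; apply: close; rewrite lexx.
- exact: approx.
- rewrite ler_expR mulNr -mulrN ler_wpM2l//.
  apply: le_trans (ler_norm _) _; rewrite normrN.
  apply: le_trans (Rintegral_bound po_c tis st (lexx _) (c := B) _) _.
    move=> r /andP[sr rt]; have := poB (r, (qs r, ps r)); apply.
    by apply: inK; rewrite rt (le_trans s's).
  by rewrite ler_wpM2l// lerB.
apply: noise => //.
- by move=> i; exact: (hqB i _ Ks).
- by move=> i; exact: (hpB i _ Ks).
- by move=> i j; exact: (hppB i j _ Ks).
- by move=> i; exact: (frB i _ Ks).
- by move=> i; exact: (veB i _ Ks).
- by move=> i; exact: approx.
- by move=> i; exact: approx.
- by move=> i; rewrite -normrN -pE ltW.
- by apply: hpde; exact: lt_le_trans as_.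
have e1 : \sum_i `|qs s' 0 i - qs s 0 i| = \sum_i `|Dq i|.
  by apply: eq_bigr => i _; rewrite qE normrN.
have e2 : \sum_i `|ps s' 0 i - ps s 0 i| = \sum_i `|Dp i + sg * dw i|.
  by apply: eq_bigr => i _; rewrite pE normrN.
rewrite opprB; move: taylor; rewrite e1 e2 [`|s' - s|]distrC [`|s - s'|]ger0_norm//.
congr (`|_ - (_ + _ + _ + _)| <= _).
- by apply: eq_bigr => i _; rewrite qE.
- by apply: eq_bigr => i _; rewrite pE.
- by apply: eq_bigr => i _; apply: eq_bigr => j _; rewrite !pE.
Qed.

Definition grid (t delta : R) (k : nat) : R := t - k%:R * delta.

(* The increments are kept while the path is in the box over the whole cell, i.e.
   sigma < grid k.+1; the noise is kept for sigma < grid k, an event of the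
   filtration at time grid k, so that its coefficients are independent of the
   increment they multiply. The two sums differ in at most one cell. *)
Definition stopped_increments (t : R) (qs ps : R -> V) (sigma delta : R) (n : nat) : R :=
  \sum_(k < n) (if sigma < grid t delta k.+1 then
    weighted_path t qs ps (grid t delta k.+1) - weighted_path t qs ps (grid t delta k)
    else 0).

Definition stopped_noise (t : R) (w qs ps : R -> V) (sigma delta : R) (n : nat) : R :=
  \sum_(k < n) (if sigma < grid t delta k then
    path_noise t w qs ps (grid t delta k) (grid t delta k.+1) else 0).

Definition squared_increments (t : R) (w : R -> V) (delta : R) (n : nat) : R :=
  \sum_(k < n) \sum_i ((w (grid t delta k) - w (grid t delta k.+1)) 0 i) ^+ 2.

Lemma gridB t delta k : grid t delta k - grid t delta k.+1 = delta.
Proof. by rewrite /grid -natr1; ring. Qed.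

Lemma grid_le t delta k : 0 <= delta -> grid t delta k.+1 <= grid t delta k.
Proof. by move=> d0; rewrite -subr_ge0 gridB. Qed.

Lemma grid_itv a t delta n k : 0 <= delta -> n%:R * delta = t - a -> (k <= n)%N ->
  a <= grid t delta k <= t.
Proof.
move=> d0 nd kn; rewrite /grid gerBl mulr_ge0// andbT lerBrDr.
by rewrite -lerBrDl -nd ler_wpM2r// ler_nat.
Qed.

(** Cells entirely above sigma contribute the one-step error, which sums to (theta + eta) (t - a +
    Q). The one cell in which only the noise is kept contributes zeta + zeta^2 + delta, [zeta] being
    a bound for a single Wiener increment. *)
Lemma partition_bound a t n B : ti < a -> a <= t -> 0 <= sg -> 0 <= kappa -> 1 <= B ->
  let K := phase_box a t n in
  all_coefficients (fun F => forall z, K z -> `|F z.1 z.2.1 z.2.2| <= B) ->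
  exists2 C, 0 <= C & forall q0 p0 w qs ps, backward_path t q0 p0 w qs ps ->
  forall sigma : R, a <= sigma -> (forall r, sigma < r <= t -> K (r, (qs r, ps r))) ->
  forall (N : nat) (delta : R), (0 < N)%N -> 0 <= delta -> N%:R * delta = t - a ->
  forall theta eta zeta : R, 0 < eta -> eta <= B -> 0 <= theta -> theta <= B ->
  all_coefficients (oscillation_le K eta theta) ->
  (forall (k : 'I_N) r, sigma < grid t delta k.+1 ->
     grid t delta k.+1 <= r <= grid t delta k ->
     ball (grid t delta k, (qs (grid t delta k), ps (grid t delta k))) eta
       (r, (qs r, ps r))) ->
  (forall k : 'I_N, \sum_i `|(w (grid t delta k) - w (grid t delta k.+1)) 0 i| <= zeta) ->
  `|stopped_increments t qs ps sigma delta N - stopped_noise t w qs ps sigma delta N|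
   <= C * ((theta + eta) * (t - a + squared_increments t w delta N) +
           (zeta + zeta ^+ 2 + delta)).
Proof.
move=> tia at_ sg0 k0 B1 K KB.
have [C C0 step] := path_step_bound tia sg0 k0 B1 KB.
have B0 : 0 <= B by lra.
pose E := expR (kappa * (B * (t - a))).
pose C' := E * (sg * B + sg ^+ 2 * B * (1 + d%:R ^+ 2)).
have C'0 : 0 <= C' by rewrite /C' /E; nneg.
exists (C + C'); first by nneg.
move=> q0 p0 w qs ps path sigma asig inK N delta N0 d0 Nd theta eta zeta eta0 etaB th0 thB.
move=> osc close dw.
set g := grid t delta; set Q := squared_increments _ _ _ _.
have gB k : g k - g k.+1 = delta by exact: gridB.
pose dM k := weighted_path t qs ps (g k.+1) - weighted_path t qs ps (g k).
pose nz k := path_noise t w qs ps (g k) (g k.+1).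
have gitv (k : 'I_N) : [/\ a <= g k.+1, g k.+1 <= g k & g k <= t].
  have /andP[_ ?] := grid_itv d0 Nd (ltnW (ltn_ord k)).
  have /andP[? _] := grid_itv d0 Nd (ltn_ord k).
  by split => //; exact: grid_le.
have Q0 : 0 <= Q by rewrite /Q /squared_increments; nneg.
have ta0 : 0 <= t - a by rewrite subr_ge0.
have eta0' := ltW eta0.
have z0 : 0 <= zeta by apply: le_trans (dw (Ordinal N0)); nneg.
have F1 (k : 'I_N) : sigma < g k.+1 -> `|dM k - nz k| <=
    C * (theta + eta) * (delta + \sum_i ((w (g k) - w (g k.+1)) 0 i) ^+ 2).
  move=> sg'; have [ag gg gt] := gitv k.
  have := step _ _ _ _ _ path _ _ theta eta ag gg gt eta0 etaB th0 thB osc.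
  rewrite (gB k); apply; first by move=> r; exact: close.
  by move=> r /andP[gr rt]; apply: inK; rewrite rt (lt_le_trans sg').
have F2 (k : 'I_N) : sigma < g k -> `|nz k| <= C' * (zeta + zeta ^+ 2 + delta).
  move=> sgk; have [ag gg gt] := gitv k.
  have ag' : a <= g k by exact: le_trans gg.
  have Kg : K (g k, (qs (g k), ps (g k))) by apply: inK; rewrite sgk.
  have [_ [_ [_ [hpB [hppB [_ [_ poB]]]]]]] := KB.
  rewrite normrM -[C' * _]mulrA ler_pM ?normr_ge0//.
    rewrite ger0_norm ?expR_ge0// ler_expR mulNr -mulrN ler_wpM2l//.
    apply: le_trans (ler_norm _) _; rewrite normrN.
    have tig : ti <= g k by exact: le_trans (ltW tia) ag'.
    have po_c := continuous_along_path (path_continuous_q path)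
      (path_continuous_p path) (@continuous_power).
    apply: le_trans (Rintegral_bound po_c tig gt (lexx _) (c := B) _) _.
      move=> r /andP[sr rt]; have := poB (r, (qs r, ps r)); apply.
      by apply: inK; rewrite rt (lt_le_trans sgk).
    by rewrite ler_wpM2l// lerB.
  apply: le_trans (@noise_term_bound R d sg B _ _ _ _ sg0 _ _ _) _.
  - by rewrite subr_ge0.
  - by move=> i; exact: (hpB i _ Kg).
  - by move=> i j; exact: (hppB i j _ Kg).
  rewrite (gB k).
  have := dw k; rewrite -/g; set W := \sum_i _ => Wz.
  have W0 : 0 <= W by rewrite /W; nneg.
  apply: (@le_trans _ _ (sg * B * zeta + sg ^+ 2 * B * (zeta ^+ 2 + d%:R ^+ 2 * delta))).
    apply: lerD; rewrite ler_wpM2l//; [nneg|nneg|].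
    by rewrite lerD2r lerXn2r// nnegrE.
  rewrite -subr_ge0 (_ : _ - _ = sg * B * (zeta ^+ 2 + delta) +
    sg ^+ 2 * B * (zeta + delta + d%:R ^+ 2 * (zeta + zeta ^+ 2))); last by ring.
  by nneg.
have -> : stopped_increments t qs ps sigma delta N - stopped_noise t w qs ps sigma delta N =
   \sum_(k < N) ((if sigma < g k.+1 then dM k - nz k else 0) -
     (if (sigma < g k) && ~~ (sigma < g k.+1) then nz k else 0)).
  rewrite -sumrB; apply: eq_bigr => k _; rewrite -/g -/(dM k) -/(nz k).
  have [_ gg _] := gitv k.
  case: ifP => [sg'|_] /=; first by rewrite (lt_le_trans sg' gg)/= subr0.
  by rewrite andbT.
(* The difference of indicators singles out the cell containing sigma; its sum telescopes to at most
   1, so that cell is paid for at most once. *)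
pose T : R := \sum_(k < N) (C * (theta + eta) *
     (delta + \sum_i ((w (g k) - w (g k.+1)) 0 i) ^+ 2) +
   C' * (zeta + zeta ^+ 2 + delta) *
     ((sigma < g k)%R%:R - (sigma < g k.+1)%R%:R)).
apply: (@le_trans _ _ T); rewrite /T.
  apply: le_trans (ler_norm_sum _ _ _) _; apply: ler_sum => k _.
  apply: le_trans (ler_normB _ _) _; apply: lerD.
    case: ifP => [|_]; first exact: F1.
    by rewrite normr0; nneg.
  have [_ gg _] := gitv k.
  case: ifPn => [/andP[sg1 sg2]|].
    by rewrite sg1 (negbTE sg2)/= subr0 mulr1; exact: F2.
  rewrite normr0 => _; apply: mulr_ge0; first by nneg.
  have [sg2|_] := boolP (sigma < g k.+1); first by rewrite (lt_le_trans sg2 gg) subrr.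
  by rewrite subr0.
rewrite big_split/= -mulr_sumr -mulr_sumr big_split/= sumr_const card_ord.
rewrite -[delta *+ N]mulr_natl Nd -/Q.
have T1 : \sum_(k < N) ((sigma < g k)%R%:R - (sigma < g k.+1)%R%:R) <= 1 :> R.
  rewrite -(big_mkord xpredT (fun k => (sigma < g k)%R%:R - (sigma < g k.+1)%R%:R : R)).
  rewrite -[leLHS]opprK -sumrN.
  under eq_bigr do rewrite opprB.
  by rewrite telescope_sumr// opprB; case: (_ < _); case: (_ < _) => /=; lra.
apply: (@le_trans _ _ (C * (theta + eta) * (t - a + Q) + C' * (zeta + zeta ^+ 2 + delta))).
  by rewrite lerD2l -[leRHS]mulr1 ler_wpM2l//; nneg.
rewrite -subr_ge0 (_ : _ - _ = C' * ((theta + eta) * (t - a + Q)) +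
  C * (zeta + zeta ^+ 2 + delta)); last by ring.
by nneg.
Qed.

Definition mesh (a t : R) (N : nat) : R := (t - a) / N.+1%:R.

Lemma meshE a t N : N.+1%:R * mesh a t N = t - a.
Proof. by rewrite /mesh mulrC divfK// pnatr_eq0. Qed.

Lemma mesh_ge0 a t N : a <= t -> 0 <= mesh a t N.
Proof. by move=> at_; rewrite divr_ge0// subr_ge0. Qed.

Lemma mesh_lt a t x : 0 < x -> \forall N \near \oo, mesh a t N < x.
Proof.
move=> x0; have /cvgrPdist_lt/(_ _ x0) : mesh a t N @[N --> \oo] --> 0.
  rewrite -(mulr0 (t - a)); apply: cvgM; first exact: cvg_cst.
  exact: cvg_harmonic.
by apply: filterS => N /=; rewrite sub0r normrN; exact: le_lt_trans (ler_norm _).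
Qed.

Lemma all_coefficients_near (T : Type) (G : set_system T) {FG : Filter G}
    (Q : T -> (R -> V -> V -> R) -> Prop) :
  (forall F, jointly_continuous_on `]ti, +oo[ F -> \forall x \near G, Q x F) ->
  \forall x \near G, all_coefficients (Q x).
Proof.
have sub F : jointly_continuous_on `[ti, +oo[ F -> jointly_continuous_on `]ti, +oo[ F.
  apply: continuous_subspaceW => z /=; rewrite !in_itv/= !andbT; exact: ltW.
move=> H; rewrite /all_coefficients.
apply: filterI; first by apply: H; exact: td_continuous hreg.
apply: filterI; first by apply: H; exact: td_continuous_t hreg.
apply: filterI; first by apply: filter_forall => i; apply: H; exact: td_continuous_q hreg _.
apply: filterI; first by apply: filter_forall => i; apply: H; exact: td_continuous_p hreg _.
apply: filterI.
  by apply: filter_forall => i; apply: filter_forall => j; apply: H; exact: td_continuous_pp hreg _ _.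
apply: filterI.
  by apply: filter_forall => i; apply: H; apply: sub; exact: continuous_friction.
apply: filterI.
  by apply: filter_forall => i; apply: H; apply: sub; exact: continuous_velocity.
by apply: H; apply: sub; exact: continuous_power.
Qed.

Lemma all_coefficients_mono (Q Q' : (R -> V -> V -> R) -> Prop) :
  (forall F, Q F -> Q' F) -> all_coefficients Q -> all_coefficients Q'.
Proof.
move=> W [h1 [h2 [h3 [h4 [h5 [h6 [h7 h8]]]]]]].
by do 7![split; [by move=> *; exact: W|]]; exact: W.
Qed.

Lemma within_phase_box a t n (F : R -> V -> V -> R) : ti < a -> jointly_continuous_on `]ti, +oo[ F ->
  {within phase_box a t n, continuous (fun z => F z.1 z.2.1 z.2.2)}.
Proof.
move=> tia; apply: continuous_subspaceW => z [/= + _].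
by rewrite !in_itv/= andbT => /andP[+ _]; exact: lt_le_trans.
Qed.

Lemma coefficients_bounded a t n : ti < a ->
  \forall B \near +oo, all_coefficients (fun F =>
    forall z, phase_box a t n z -> `|F z.1 z.2.1 z.2.2| <= B).
Proof.
move=> tia; apply: all_coefficients_near => F /(within_phase_box (t := t) (n := n) tia) cF.
have /compact_bounded := continuous_compact cF (@compact_phase_box R d a t n).
by move=> [M [Mr HM]]; exists M; split => // B MB z Kz; apply: (HM B MB); exists z.
Qed.

Lemma coefficients_oscillation a t n theta : ti < a -> 0 < theta ->
  \forall eta \near 0^'+, all_coefficients (oscillation_le (phase_box a t n) eta theta).
Proof.
move=> tia th0; apply: all_coefficients_near => F.
move=> /(within_phase_box (t := t) (n := n) tia) cF.
exact: (compact_uniform_oscillation (@compact_phase_box R d a t n) cF th0).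
Qed.

(** With theta = eta = [B] the conditions on oscillation and closeness hold automatically inside the
    box, so one constant serves every path and every mesh. This is the domination that accompanies
    the pathwise limit in [fine_partition_bound]. *)
Lemma crude_partition_bound a t n : ti < a -> a <= t -> 0 <= sg -> 0 <= kappa ->
  let K := phase_box a t n in
  exists2 C, 0 <= C & forall q0 p0 w qs ps, backward_path t q0 p0 w qs ps ->
  forall sigma : R, a <= sigma -> (forall r, sigma < r <= t -> K (r, (qs r, ps r))) ->
  forall N : nat,
  `|stopped_increments t qs ps sigma (mesh a t N) N.+1
    - stopped_noise t w qs ps sigma (mesh a t N) N.+1|
   <= C * (1 + squared_increments t w (mesh a t N) N.+1).
Proof.
move=> tia at_ sg0 k0 K.
have [B [B1 nB tB KB]] : exists B, [/\ 1 <= B, 2 * n < B, t - a < B &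
    all_coefficients (fun F => forall z, K z -> `|F z.1 z.2.1 z.2.2| <= B / 2)].
  have [M [_ HM]] := coefficients_bounded t n tia.
  (* The factor 2 bounds the coefficients by B / 2, hence their oscillation by B; [n] and [t - a]
     are included so that any two points of the box are within distance [B]. *)
  pose B : R := 2 * (`|M| + `|n| + `|t - a| + 1).
  exists B; have := ler_norm M; have := ler_norm n; have := ler_norm (t - a).
  have := normr_ge0 M; have := normr_ge0 n; have := normr_ge0 (t - a) => *.
  split; [rewrite /B; lra|rewrite /B; lra|rewrite /B; lra|].
  by apply: HM; rewrite /B; lra.
have B0 : 0 <= B by lra.
have KB' : all_coefficients (fun F => forall z, K z -> `|F z.1 z.2.1 z.2.2| <= B).
  by apply: all_coefficients_mono KB => F H z /H; lra.
have KO : all_coefficients (oscillation_le K B B).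
  apply: all_coefficients_mono KB => F H x y /H xB /H yB _.
  by apply: le_trans (ler_normB _ _) _; lra.
have [C C0 bound] := partition_bound tia at_ sg0 k0 B1 KB'.
have ta0 : 0 <= t - a by rewrite subr_ge0.
exists (C * (2 * B * (t - a) + 1 + (t - a) + (2 * B + 2 * d%:R))); first by nneg.
move=> q0 p0 w qs ps path sigma asig inK N.
set delta := mesh a t N; set Q := squared_increments _ _ _ _.
have d0 : 0 <= delta := mesh_ge0 N at_.
have Q0 : 0 <= Q by rewrite /Q /squared_increments; nneg.
(* Cauchy-Schwarz within one cell, whose squares are part of [Q]. Below, zeta <= 1 + zeta^2 makes
   the bound affine in [Q]. *)
pose zeta := Num.sqrt (d%:R * Q).
have zeta2 : zeta ^+ 2 = d%:R * Q by rewrite sqr_sqrtr//; nneg.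
have zeta0 : 0 <= zeta by exact: sqrtr_ge0.
apply: le_trans (bound _ _ _ _ _ path sigma asig inK N.+1 delta isT d0 (meshE a t N)
  B B zeta _ (lexx _) B0 (lexx _) KO _ _) _.
- lra.
- move=> k r sgk /andP[gr rg].
  have [_ gt] := andP (grid_itv d0 (meshE a t N) (ltnW (ltn_ord k))).
  have [ag _] := andP (grid_itv d0 (meshE a t N) (ltn_ord k)).
  set g := grid t delta k; set g' := grid t delta k.+1 in sgk gr ag.
  have Kr : K (r, (qs r, ps r)) by apply: inK; rewrite (lt_le_trans sgk gr) (le_trans rg).
  have Kg : K (g, (qs g, ps g)).
    by apply: inK; rewrite gt (lt_le_trans sgk) // (le_trans gr).
  have B1' : 0 < B by lra.
  have cl (x y : V) : (forall i, `|x 0 i| <= n) -> (forall i, `|y 0 i| <= n) -> ball x B y.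
    move=> xn yn; apply: ball_rV => // i; apply: le_lt_trans (ler_normB _ _) _.
    by have := xn i; have := yn i; lra.
  split; last by split; apply: cl; [exact: Kg.2.1|exact: Kr.2.1|exact: Kg.2.2|exact: Kr.2.2].
  rewrite /ball/= ger0_norm ?subr_ge0//.
  apply: le_lt_trans tB; rewrite lerB//; exact: le_trans gr.
- move=> k; rewrite -ler_sqr ?nnegrE//; last by nneg.
  rewrite zeta2; apply: le_trans (sqr_sum_le _) _; rewrite card_ord ler_wpM2l//.
  rewrite /Q /squared_increments (bigD1 k)//= -[leLHS]addr0; apply: lerD; last by nneg.
  by apply: ler_sum => i _; rewrite real_normK// num_real.
have dta : delta <= t - a.
  by rewrite -(meshE a t N) -/delta ler_peMl// ler1n.
have zle : zeta <= 1 + d%:R * Q by rewrite -zeta2; have := sqr_ge0 (zeta - 1); nra.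
rewrite -mulrA ler_wpM2l// zeta2.
apply: (@le_trans _ _ ((B + B) * (t - a + Q) + (1 + d%:R * Q + d%:R * Q + (t - a)))).
  by rewrite lerD2l !lerD.
rewrite -subr_ge0 (_ : _ - _ = (2 * B * (t - a) + 1 + (t - a)) * Q + (2 * B + 2 * d%:R)); last by ring.
by nneg.
Qed.

Lemma path_uniform_continuity a t (f : R -> R) e : ti < a ->
  {within `[ti, t], continuous f} -> 0 < e ->
  \forall rho \near 0^'+, forall x y, a <= x <= t -> a <= y <= t ->
    `|x - y| < rho -> `|f x - f y| <= e.
Proof.
move=> tia cf e0.
have cf' : {within `[a, t], continuous f}.
  apply: continuous_subspaceW cf => r /=; rewrite !in_itv/= => /andP[ar ->].
  by rewrite (le_trans (ltW tia) ar).
have := compact_uniform_oscillation (@segment_compact R a t) cf' e0.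
by apply: filterS => rho H x y xt yt; apply: H; rewrite /= in_itv.
Qed.

(** The threshold for [N] depends on the path, through the moduli of continuity of [qs], [ps] and
    [w]. *)
Lemma fine_partition_bound a t n : ti < a -> a <= t -> 0 <= sg -> 0 <= kappa ->
  let K := phase_box a t n in
  forall q0 p0 w qs ps, backward_path t q0 p0 w qs ps ->
  {within `[ti, t], continuous w} ->
  forall sigma : R, a <= sigma -> (forall r, sigma < r <= t -> K (r, (qs r, ps r))) ->
  forall eps, 0 < eps -> \forall N \near \oo,
  `|stopped_increments t qs ps sigma (mesh a t N) N.+1
    - stopped_noise t w qs ps sigma (mesh a t N) N.+1|
   <= eps * (1 + squared_increments t w (mesh a t N) N.+1).
Proof.
move=> tia at_ sg0 k0 K q0 p0 w qs ps path cw sigma asig inK eps eps0.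
have [M [_ HM]] := coefficients_bounded t n tia.
pose B := `|M| + 1; have B1 : 1 <= B by rewrite lerDr.
have KB : all_coefficients (fun F => forall z, K z -> `|F z.1 z.2.1 z.2.2| <= B).
  by apply: HM; rewrite ltr_pwDr// ler_norm.
have [C C0 bound] := partition_bound tia at_ sg0 k0 B1 KB.
have ta0 : 0 <= t - a by rewrite subr_ge0.
(* Chosen so that C e (2 (t - a) + 5) <= eps, which covers the final estimate with theta = zeta =
   [e] and eta, delta <= [e]. [C + 1] keeps the denominator positive, and e <= 1 gives e^2 <= e. *)
pose e := Num.min 1 (eps / ((C + 1) * (2 * (t - a) + 5))).
have e0 : 0 < e.
  by rewrite lt_min ltr01 divr_gt0// mulr_gt0//; lra.
have e0' := ltW e0.
have e1 : e <= 1 by rewrite ge_min lexx.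
have eE : C * e * (2 * (t - a) + 5) <= eps.
  apply: (@le_trans _ _ (e * ((C + 1) * (2 * (t - a) + 5)))).
    rewrite -subr_ge0 (_ : _ - _ = e * (2 * (t - a) + 5)); last by ring.
    by nneg.
  by rewrite -ler_pdivlMr ?mulr_gt0//; [rewrite ge_min lexx orbT|lra|lra].
have [eta [eta0 etae osc]] : exists eta, [/\ 0 < eta, eta <= e &
    all_coefficients (oscillation_le K eta e)].
  near (0 : R)^'+ => eta; exists eta; split.
  - by near: eta; exact: nbhs_right_gt.
  - by near: eta; exact: nbhs_right_le.
  - by near: eta; exact: coefficients_oscillation.
have coordc (f : R -> V) i : {within `[ti, t], continuous f} ->
    {within `[ti, t], continuous (fun r => f r 0 i)}.
  by move=> cf x; apply: (cvg_comp _ (fun v : V => v 0 i) (cf x)); exact: coord_continuous.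
(* Halving turns the weak inequalities of uniform continuity into the strict ones of [ball];
   dividing by [d.+1] lets the [d] coordinates of an increment add up to at most [e]. *)
have eta2 : 0 < eta / 2 by rewrite divr_gt0.
have ed : 0 < e / d.+1%:R by rewrite divr_gt0.
have [rho [rho0 rhoe rhoq rhop rhow]] : exists rho, [/\ 0 < rho, rho <= eta,
   forall i x y, a <= x <= t -> a <= y <= t -> `|x - y| < rho -> `|qs x 0 i - qs y 0 i| <= eta / 2,
   forall i x y, a <= x <= t -> a <= y <= t -> `|x - y| < rho -> `|ps x 0 i - ps y 0 i| <= eta / 2 &
   forall i x y, a <= x <= t -> a <= y <= t -> `|x - y| < rho -> `|w x 0 i - w y 0 i| <= e / d.+1%:R].
  near (0 : R)^'+ => rho; exists rho; split.
  - by near: rho; exact: nbhs_right_gt.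
  - by near: rho; exact: nbhs_right_le.
  - near: rho; apply: filter_forall => i; apply: path_uniform_continuity => //.
    exact: coordc (path_continuous_q path).
  - near: rho; apply: filter_forall => i; apply: path_uniform_continuity => //.
    exact: coordc (path_continuous_p path).
  - near: rho; apply: filter_forall => i; apply: path_uniform_continuity => //.
    exact: coordc.
near=> N.
have Nrho : mesh a t N < rho by near: N; exact: mesh_lt.
set delta := mesh a t N in Nrho *; set Q := squared_increments _ _ _ _.
have d0 : 0 <= delta := mesh_ge0 N at_.
have Q0 : 0 <= Q by rewrite /Q /squared_increments; nneg.
apply: le_trans (bound _ _ _ _ _ path sigma asig inK N.+1 delta isT d0 (meshE a t N)
  e eta e eta0 _ (ltW e0) _ osc _ _) _.
- lra.
- lra.
- move=> k r sgk /andP[gr rg].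
  have gat := grid_itv d0 (meshE a t N) (ltnW (ltn_ord k)).
  have [ag _] := andP (grid_itv d0 (meshE a t N) (ltn_ord k)).
  have rat : a <= r <= t.
    by rewrite (le_trans ag gr) (le_trans rg)//; case/andP: gat.
  have gr' : `|grid t delta k - r| < rho.
    rewrite ger0_norm ?subr_ge0//; apply: le_lt_trans Nrho.
    by rewrite -[leRHS](gridB t delta k) lerB.
  split; first exact: lt_le_trans gr' _.
  split; apply: ball_rV => // i.
  + by apply: le_lt_trans (rhoq i _ _ gat rat gr') _; lra.
  + by apply: le_lt_trans (rhop i _ _ gat rat gr') _; lra.
- move=> k.
  have gat := grid_itv d0 (meshE a t N) (ltnW (ltn_ord k)).
  have gat' := grid_itv d0 (meshE a t N) (ltn_ord k).
  have gr' : `|grid t delta k - grid t delta k.+1| < rho by rewrite gridB ger0_norm.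
  apply: (@le_trans _ _ (d%:R * (e / d.+1%:R))).
    by apply: ler_sum_cst => i; rewrite !mxE; exact: rhow.
  rewrite mulrCA -[leRHS]mulr1 ler_wpM2l ?(ltW e0)//.
  by rewrite ler_pdivrMr// mul1r ler_nat.
have de : delta <= e by lra.
have ee : e ^+ 2 <= e by rewrite expr2 -[leRHS]mulr1 ler_wpM2l// ltW.
apply: (@le_trans _ _ (C * ((e + e) * (t - a + Q) + (e + e + e)))).
  rewrite ler_wpM2l//; apply: lerD; last by rewrite !lerD.
  by rewrite ler_wpM2r//; [nneg|rewrite lerD2l].
apply: (@le_trans _ _ (C * e * (2 * (t - a) + 5) * (1 + Q))); last first.
  by rewrite ler_wpM2r//; nneg.
rewrite -subr_ge0 (_ : _ - _ = C * e * (2 + (2 * (t - a) + 3) * Q)); last by ring.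
by nneg.
Unshelve. all: by end_near. Qed.

(** [r] is the last grid point at which increments are still kept, less than a cell or exactly one
    cell above sigma. The clause [r = t] or [sigma < r] says that it is still before the exit unless
    the sum vanishes. *)
Lemma stopped_increments_end a t (qs ps : R -> V) sigma N : a <= t -> a <= sigma -> sigma <= t ->
  exists r, [/\ sigma <= r <= t, r <= sigma + mesh a t N, r = t \/ sigma < r &
    stopped_increments t qs ps sigma (mesh a t N) N.+1 =
      weighted_path t qs ps r - weighted_path t qs ps t].
Proof.
move=> at_ asig sigt; set delta := mesh a t N.
have d0 : 0 <= delta := mesh_ge0 N at_.
have [j [jN sumE js jS]] := telescope_until
  (fun k => weighted_path t qs ps (grid t delta k)) sigma N.+1
  (fun k => grid_le t k d0).
have g0 : grid t delta 0 = t by rewrite /grid mul0r subr0.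
have gN : grid t delta N.+1 = a by rewrite /grid meshE; ring.
have sj : sigma <= grid t delta j by case: js => [->|/ltW//]; rewrite g0.
exists (grid t delta j); split.
- by rewrite sj; case/andP: (grid_itv d0 (meshE a t N) jN).
- rewrite -lerBlDr; case: jS => [jE|].
    by rewrite lerBlDr jE gN (le_trans asig)// lerDl.
  by have := gridB t delta j; lra.
- by case: js => [->|]; [left|right].
- by rewrite /stopped_increments sumE g0.
Qed.

End backward_paths.

(** * Moments and independence of Wiener increments *)

Section gaussian_moments.
Context {R : realType}.
Notation mu := (@lebesgue_measure R).
Implicit Types (s x : R).

(** The Radon-Nikodym derivative and [normal_pdf] agree almost everywhere, since both integrate to
    [normal_prob] over every measurable set. *)
Lemma ge0_integral_normal_prob (m s : R) (f : measurableTypeR R -> \bar R) :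
  measurable_fun setT f -> (forall x, 0 <= f x)%E ->
  (\int[normal_prob m s]_x f x = \int[mu]_x (f x * (normal_pdf m s x)%:E))%E.
Proof.
move=> mf f0.
have dom := @normal_prob_dominates R m s.
rewrite -(Radon_Nikodym_SigmaFinite.change_of_variables dom)//.
have mRN := measurable_int _ (Radon_Nikodym_SigmaFinite.f_integrable dom).
have mpdf : measurable_fun setT (fun x => (normal_pdf m s x)%:E).
  by apply/measurable_EFinP; exact: measurable_normal_pdf.
apply: ge0_ae_eq_integral => //.
- exact: emeasurable_funM.
- exact: emeasurable_funM.
- by move=> x _; rewrite mule_ge0//; exact: Radon_Nikodym_SigmaFinite.f_ge0.
- by move=> x _; rewrite mule_ge0// lee_fin normal_pdf_ge0.
- apply: ae_eqe_mul2l; apply: integral_ae_eq => //.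
    exact: Radon_Nikodym_SigmaFinite.f_integrable.
  by move=> E _ mE; rewrite -Radon_Nikodym_SigmaFinite.f_integral.
Qed.

Lemma is_derive_normal_pdf s x : 0 < s ->
  is_derive x 1 (normal_pdf 0 s) (- (x / s ^+ 2) * normal_pdf 0 s x).
Proof.
move=> s0; have sN0 : s != 0 by rewrite gt_eqF.
rewrite normal_pdfE// /normal_fun.
have H : is_derive x 1 (fun x : R => - (x - 0) ^+ 2 / (s ^+ 2 *+ 2)) (- (x / s ^+ 2)).
  apply: is_derive_eq; rewrite /GRing.scale/=.
  by rewrite !(mulr0, mul0r, addr0, subr0, mulr1, add0r); field.
have := @is_derive1_comp R expR (fun x : R => - (x - 0) ^+ 2 / (s ^+ 2 *+ 2)) x _ _ (is_derive_expR _) H.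
by move=> H'; apply: is_derive_eq; rewrite /GRing.scale/=; ring.
Qed.

(** Integration by parts, from phi' = - x phi / s^2 for the density phi. [F] is the boundary term,
    which vanishes at 0. *)
Lemma normal_pdf_partial_moment s (k : nat) (n : R) : 0 < s -> 0 < n ->
  (\int[mu]_(x in `[0%R, n]) (x ^+ k.+2 * normal_pdf 0 s x)%:E =
   (k.+1%:R * s ^+ 2)%:E * \int[mu]_(x in `[0%R, n]) (x ^+ k * normal_pdf 0 s x)%:E
   - (s ^+ 2 * n ^+ k.+1 * normal_pdf 0 s n)%:E)%E.
Proof.
move=> s0 n0; have sN0 : s != 0 by rewrite gt_eqF.
have cpdf := @continuous_normal_pdf R 0 s sN0.
have cmon (j : nat) : continuous (fun x : R => x ^+ j * normal_pdf 0 s x).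
  by move=> x; apply: cvgM; [exact: exprn_continuous|exact: cpdf].
have imon (j : nat) : mu.-integrable `[0%R, n] (EFin \o (fun x => x ^+ j * normal_pdf 0 s x)).
  apply: continuous_compact_integrable; first exact: segment_compact.
  exact: continuous_subspaceT.
pose f x : R := k.+1%:R * s ^+ 2 * (x ^+ k * normal_pdf 0 s x) - x ^+ k.+2 * normal_pdf 0 s x.
pose F x : R := s ^+ 2 * x ^+ k.+1 * normal_pdf 0 s x.
have dF x : is_derive x 1 F (f x).
  have dp := is_derive_normal_pdf x s0.
  have dm : is_derive x 1 (fun y : R => y ^+ k.+1) (k.+1%:R * x ^+ k).
    have := is_deriveX k.+1 (is_derive_id x (1 : R)).
    by rewrite exprfctE [_ *: 1]mulr1.
  have := is_deriveM (is_deriveZ (s ^+ 2) dm) dp.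
  move=> H; apply: (is_derive_eq H); rewrite /f /GRing.scale/=.
  by rewrite -[s ^+ 2 *: x ^+ k.+1]/(s ^+ 2 * x ^+ k.+1) !exprS; field.
have cf : continuous f.
  move=> x; apply: cvgB; last exact: cmon.
  by apply: cvgM; [exact: cvg_cst|exact: cmon].
have FTC : (\int[mu]_(x in `[0%R, n]) (f x)%:E = (F n)%:E - (F 0%R)%:E)%E.
  apply: (continuous_FTC2 n0 (continuous_subspaceT cf)).
    have cF : continuous F by move=> x; apply/differentiable_continuous/derivable1_diffP; have [] := dF x.
    split; first by move=> x _; have [] := dF x.
      by apply: cvg_at_right_filter; exact: cF.
    by apply: cvg_at_left_filter; exact: cF.
  by move=> x _; rewrite derive1E; have [] := dF x.
have fE : (\int[mu]_(x in `[0%R, n]) (f x)%:E =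
   (k.+1%:R * s ^+ 2)%:E * \int[mu]_(x in `[0%R, n]) (x ^+ k * normal_pdf 0 s x)%:E
   - \int[mu]_(x in `[0%R, n]) (x ^+ k.+2 * normal_pdf 0 s x)%:E)%E.
  rewrite /f; under eq_integral do rewrite EFinB EFinM.
  rewrite integralB//=; last 2 first.
  - by apply: integrableZl => //; exact: imon.
  - exact: imon.
  by rewrite integralZl//; exact: imon.
have fin j : (\int[mu]_(x in `[0%R, n]) (x ^+ j * normal_pdf 0 s x)%:E)%E \is a fin_num.
  by apply: integrable_fin_num => //; exact: imon.
move: fE; rewrite FTC /F expr0n/= mulr0 mul0r -(fineK (fin k)) -(fineK (fin k.+2)).
rewrite -!EFinM -!EFinB => -[E]; congr EFin; lra.
Qed.

(** By exp y >= 1 + y at y = x^2 / (2 s^2), the product x phi(x) is at most a constant over x. The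
    index is shifted to keep x positive. *)
Lemma normal_pdf_tail s : 0 < s ->
  (n%:R * normal_pdf 0 s n%:R @[n --> \oo] --> (0 : R)).
Proof.
move=> s0; have sN0 : s != 0 by rewrite gt_eqF.
have cvgb : (2 * s ^+ 2 * normal_peak s) * n.+1%:R^-1 @[n --> \oo] --> (0 : R).
  rewrite -(mulr0 (2 * s ^+ 2 * normal_peak s)); apply: cvgM; first exact: cvg_cst.
  exact: cvg_harmonic.
rewrite -cvg_shiftS/=; apply: (squeeze_cvgr _ (cvg_cst 0) cvgb).
apply: nearW => n; rewrite mulr_ge0 ?normal_pdf_ge0//=.
rewrite normal_pdfE// /normal_fun subr0; set x : R := n.+1%:R.
have x0 : 0 < x by rewrite ltr0n.
have x0' := ltW x0.
rewrite mulNr expRN.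
rewrite (_ : x * _ = normal_peak s * (x / expR (x ^+ 2 / (s ^+ 2 *+ 2)))); last by ring.
rewrite (_ : _ * x^-1 = normal_peak s * (2 * s ^+ 2 * x^-1)); last by ring.
rewrite ler_wpM2l ?normal_peak_ge0// ler_pdivrMr ?expR_gt0//.
apply: (@le_trans _ _ (2 * s ^+ 2 / x * (1 + x ^+ 2 / (s ^+ 2 *+ 2)))).
  rewrite mulrDr mulr1 (_ : _ * (_ / _) = x); last first.
    by rewrite -mulr_natl; field; rewrite sN0 gt_eqF.
  by rewrite lerDr; nneg.
rewrite ler_wpM2l ?expR_ge1Dx//.
by nneg.
Qed.

Lemma ge0_even_moment s (k : nat) : s != 0 -> ~~ odd k ->
  (\int[mu]_x (x ^+ k * normal_pdf 0 s x)%:E =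
   2%:E * \int[mu]_(x in `[0%R, +oo[) (x ^+ k * normal_pdf 0 s x)%:E)%E.
Proof.
move=> s0 ek; rewrite set_itvcy.
apply: (@ge0_symfun_integralT R (fun x => x ^+ k * normal_pdf 0 s x)).
- by move=> x; rewrite mulr_ge0 ?normal_pdf_ge0// exprn_even_ge0.
- move=> x; apply: cvgM; first exact: exprn_continuous.
  exact: continuous_normal_pdf.
- move=> x /=; rewrite exprNn -signr_odd (negbTE ek) mul1r.
  by rewrite normal_pdfE// /normal_fun !subr0 sqrrN.
Qed.

Lemma normal_pdf_second_moment s : 0 < s ->
  (\int[mu]_x (x ^+ 2 * normal_pdf 0 s x)%:E = (s ^+ 2)%:E)%E.
Proof.
move=> s0; have sN0 : s != 0 by rewrite gt_eqF.
pose g (k : nat) (x : R) := x ^+ k * normal_pdf 0 s x.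
have g0 k : ~~ odd k -> forall x, 0 <= g k x.
  by move=> ek x; rewrite mulr_ge0 ?normal_pdf_ge0// exprn_even_ge0.
have mg k : measurable_fun setT (g k).
  by apply: measurable_funM; [exact: measurable_funX|exact: measurable_normal_pdf].
have I0 : (\int[mu]_(x in `[0%R, +oo[) (g 0%N x)%:E = (2^-1)%:E)%E.
  have := ge0_even_moment sN0 (isT : ~~ odd 0).
  under eq_integral do rewrite expr0 mul1r.
  rewrite integral_normal_pdf => /(congr1 (fun z => (2^-1)%:E * z)%E).
  by rewrite mule1 muleA -EFinM mulVf ?pnatr_eq0// mul1e => ->.
have c0 := @ge0_cvgn_integral R lebesgue_measure _ (g0 0%N isT) (mg 0%N).
have c2 := @ge0_cvgn_integral R lebesgue_measure _ (g0 2%N isT) (mg 2%N).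
rewrite (@ge0_even_moment s 2 sN0 isT).
have cI : (\int[mu]_(x in `[0%R, n%:R]) (g 2%N x)%:E @[n --> \oo] --> (s ^+ 2 * 2^-1)%:E)%E.
  have c : ((s ^+ 2)%:E * \int[mu]_(x in `[0%R, n%:R]) (g 0%N x)%:E -
      (s ^+ 2 * (n%:R * normal_pdf 0 s n%:R))%:E @[n --> \oo] --> (s ^+ 2 * 2^-1)%:E)%E.
    rewrite [X in _ --> X](_ : _ = ((s ^+ 2)%:E * (2^-1)%:E - 0)%E); last by rewrite sube0 EFinM.
    apply: cvgeB => //.
      by apply: cvgeZl => //; rewrite -I0.
    apply: cvg_EFin; first exact: nearW.
    rewrite [X in _ --> X](_ : 0 = s ^+ 2 * 0); last by rewrite mulr0.
    apply: cvgM; first exact: cvg_cst.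
    exact: normal_pdf_tail.
  apply: cvg_trans c; apply: near_eq_cvg.
  exists 1%N => // n /= n1.
  rewrite (@normal_pdf_partial_moment s 0 n%:R)// ?ltr0n// mul1r expr1.
  by rewrite !mulrA.
have -> : (\int[mu]_(x in `[0%R, +oo[) (x ^+ 2 * normal_pdf 0 s x)%:E = (s ^+ 2 * 2^-1)%:E)%E.
  exact: (cvg_unique (@ereal_hausdorff R) c2 cI).
by rewrite -EFinM; congr EFin; field.
Qed.

(** The recursion with k = 2 gives 3 s^2 times the second moment, minus a nonnegative boundary term
    that is dropped; hence an inequality. *)
Lemma normal_pdf_fourth_moment s : 0 < s ->
  (\int[mu]_x (x ^+ 4 * normal_pdf 0 s x)%:E <= (3 * s ^+ 4)%:E)%E.
Proof.
move=> s0; have sN0 : s != 0 by rewrite gt_eqF.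
have g0 (k : nat) : ~~ odd k -> forall x, 0 <= x ^+ k * normal_pdf 0 s x.
  by move=> ek x; rewrite mulr_ge0 ?normal_pdf_ge0// exprn_even_ge0.
have mg (k : nat) : measurable_fun setT (fun x => x ^+ k * normal_pdf 0 s x).
  by apply: measurable_funM; [exact: measurable_funX|exact: measurable_normal_pdf].
have c4 := @ge0_cvgn_integral R lebesgue_measure _ (g0 4%N isT) (mg 4%N).
rewrite (@ge0_even_moment s 4 sN0 isT).
have H2 := @ge0_even_moment s 2 sN0 isT.
rewrite (normal_pdf_second_moment s0) in H2.
apply: (@le_trans _ _ (2%:E * ((3 * s ^+ 2)%:E *
   \int[mu]_(x in `[0%R, +oo[) (x ^+ 2 * normal_pdf 0 s x)%:E))%E); last first.
  by rewrite muleCA -H2 -EFinM lee_fin le_eqVlt; apply/orP; left; apply/eqP; ring.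
rewrite lee_pmul2l//; apply: (cvge_le _ c4).
have c2 := @ge0_cvgn_integral R lebesgue_measure _ (g0 2%N isT) (mg 2%N).
exists 1%N => // n /= n1.
rewrite (@normal_pdf_partial_moment s 2 n%:R)// ?ltr0n//.
apply: (@le_trans _ _ ((3 * s ^+ 2)%:E *
    \int[mu]_(x in `[0%R, n%:R]) (x ^+ 2 * normal_pdf 0 s x)%:E)%E).
  rewrite -[leRHS]adde0; apply: leeD2l; rewrite oppe_le0 lee_fin.
  by have := normal_pdf_ge0 0 s n%:R => p0; nneg.
rewrite lee_pmul2l//; last by rewrite lte_fin mulr_gt0// exprn_gt0.
apply: ge0_subset_integral => //.
- by apply/measurable_EFinP; apply: measurable_funTS; exact: mg.
- by move=> x _; rewrite lee_fin g0.
- by move=> x /=; rewrite !in_itv/= andbT => /andP[].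
Qed.

Lemma normal_prob_second_moment s : 0 < s ->
  (\int[normal_prob 0 s]_x (x ^+ 2)%:E = (s ^+ 2)%:E)%E.
Proof.
move=> s0; rewrite ge0_integral_normal_prob.
- exact: normal_pdf_second_moment.
- by apply/measurable_EFinP; exact: measurable_funX.
- by move=> x; rewrite lee_fin sqr_ge0.
Qed.

Lemma normal_prob_fourth_moment s : 0 < s ->
  (\int[normal_prob 0 s]_x (x ^+ 4)%:E <= (3 * s ^+ 4)%:E)%E.
Proof.
move=> s0; rewrite ge0_integral_normal_prob.
- exact: normal_pdf_fourth_moment.
- by apply/measurable_EFinP; exact: measurable_funX.
- by move=> x; rewrite lee_fin exprn_even_ge0.
Qed.

(** Positive and negative parts have the same integral [I] by the reflection of x into - x.
    Subtracting them requires [I] to be finite, which follows from x <= 1 + x^2 and the second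
    moment. *)
Lemma normal_prob_mean s : 0 < s -> (\int[normal_prob 0 s]_x x%:E = 0)%E.
Proof.
move=> s0; have sN0 : s != 0 by rewrite gt_eqF.
have cg : continuous (fun x : R => x * normal_pdf 0 s x).
  by move=> x; apply: cvgM; [exact: cvg_id|exact: continuous_normal_pdf].
have mid : measurable_fun setT (fun x : measurableTypeR R => x%:E).
  exact/measurable_EFinP.
pose I := (\int[mu]_(x in `[0%R, +oo[) (x * normal_pdf 0 s x)%:E)%E.
rewrite integralE.
rewrite !ge0_integral_normal_prob//; [|exact: measurable_funeneg|exact: measurable_funepos].
have -> : (\int[mu]_x ((fun x : R => x%:E)^\+ x * (normal_pdf 0 s x)%:E) = I)%E.
  rewrite /I [RHS]integral_mkcond; apply: eq_integral => x _.
  rewrite patchE funeposE/= mem_setE in_itv/= andbT.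
  have [x0|x0] := lerP 0 x; first by rewrite max_l ?lee_fin// EFinM.
  by rewrite max_r ?lee_fin ?(ltW x0)// mul0e.
have -> : (\int[mu]_x ((fun x : R => x%:E)^\- x * (normal_pdf 0 s x)%:E) = I)%E.
  have := @ge0_integration_by_substitutionNy R (fun x => - x * normal_pdf 0 s x) 0.
  rewrite oppr0 => sub.
  transitivity (\int[mu]_(x in `]-oo, 0%R]) (- x * normal_pdf 0 s x)%:E)%E.
    rewrite [RHS]integral_mkcond; apply: eq_integral => x _.
    rewrite patchE funenegE/= mem_setE in_itv/=.
    have [x0|x0] := lerP x 0; first by rewrite max_l ?lee_fin ?oppr_ge0// EFinM.
    by rewrite max_r ?lee_fin ?oppr_le0 ?(ltW x0)// mul0e.
  rewrite sub.
  - apply: eq_integral => x _; congr EFin => /=; rewrite opprK.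
    by rewrite normal_pdfE// /normal_fun !subr0 sqrrN.
  - apply: continuous_subspaceT => x; apply: cvgM; last exact: continuous_normal_pdf.
    by apply: cvgN; exact: cvg_id.
  - by move=> x; rewrite in_itv/= => x0; rewrite mulr_ge0 ?normal_pdf_ge0// oppr_ge0 ltW.
rewrite subee//.
have I0 : (0 <= I)%E.
  apply: integral_ge0 => x /=; rewrite in_itv/= andbT => x0.
  by rewrite lee_fin mulr_ge0// normal_pdf_ge0.
rewrite ge0_fin_numE//.
apply: (@le_lt_trans _ _ (\int[mu]_x (normal_pdf 0 s x + x ^+ 2 * normal_pdf 0 s x)%:E)%E).
  rewrite /I integral_mkcond; apply: ge0_le_integral => //.
  - move=> x _; rewrite patchE; case: ifPn => //.
    by rewrite mem_setE in_itv/= andbT => x0; rewrite lee_fin mulr_ge0// normal_pdf_ge0.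
  - apply/(measurable_restrictT _ _).1 => //.
    apply: measurable_funTS; apply/measurable_EFinP; exact: continuous_measurable_fun.
  - apply/measurable_EFinP; apply: measurable_funD; first exact: measurable_normal_pdf.
    by apply: measurable_funM; [exact: measurable_funX|exact: measurable_normal_pdf].
  - move=> x _; have p0 := normal_pdf_ge0 0 s x.
    have : x * normal_pdf 0 s x <= normal_pdf 0 s x + x ^+ 2 * normal_pdf 0 s x.
      rewrite -{2}[normal_pdf 0 s x]mul1r -mulrDl ler_wpM2r//.
      by have := sqr_ge0 (x - 1); nra.
    rewrite patchE; case: ifPn => _; rewrite lee_fin//.
    by move=> _; rewrite addr_ge0// mulr_ge0// sqr_ge0.
under eq_integral do rewrite EFinD.
rewrite ge0_integralD//=.
- by rewrite integral_normal_pdf normal_pdf_second_moment// -EFinD ltry.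
- by move=> x _; rewrite lee_fin normal_pdf_ge0.
- by apply/measurable_EFinP; exact: measurable_normal_pdf.
- by move=> x _; rewrite lee_fin mulr_ge0 ?normal_pdf_ge0// sqr_ge0.
- apply/measurable_EFinP; apply: measurable_funM; last exact: measurable_normal_pdf.
  exact: measurable_funX.
Qed.

End gaussian_moments.

(** * Independence and expectations of products *)

Section independence.
Context {R : realType} {disp : measure_display} {Omega : measurableType disp}
  (P : probability Omega R).
Local Open Scope ereal_scope.

(** Dynkin's argument: the events that satisfy the product rule with [B] form a lambda-system
    containing the pi-system [G]. *)
Lemma independent_sigma_algebra (G : set (set Omega)) (B : set Omega) :
  setI_closed G -> (forall A, G A -> measurable A) -> measurable B ->
  (forall A, G A -> P (A `&` B) = P A * P B) ->
  forall A, <<s G >> A -> P (A `&` B) = P A * P B.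
Proof.
move=> GI Gm mB GB.
pose H := [set A | measurable A /\ P (A `&` B) = P A * P B].
suff : <<s G >> `<=` H by move=> sub A /sub[].
apply: lambda_system_subset => //; last by move=> A GA; split; [exact: Gm|exact: GB].
have fin A : measurable A -> P A \is a fin_num by exact: fin_num_measure.
split.
- by move=> A _.
- by split; [exact: measurableT|rewrite setTI probability_setT mul1e].
- move=> C A AC [mC PC] [mA PA]; split; first exact: measurableD.
  have -> : (C `\` A) `&` B = (C `&` B) `\` (A `&` B).
    apply/seteqP; split => x /=; first by move=> [[Cx nAx] Bx]; split => // -[].
    by move=> [[Cx Bx] nAB]; split => //; split => // Ax; apply: nAB.
  rewrite !measureD//; try exact: measurableI; last 2 first.
  + by rewrite ltey_eq fin.
  + by rewrite ltey_eq fin//; exact: measurableI.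
  have -> : C `&` B `&` (A `&` B) = A `&` B.
    apply/seteqP; split => x /=; first by move=> [_].
    by move=> [Ax Bx]; split => //; split => //; exact: AC.
  transitivity (P C * P B - P A * P B); first by congr (_ - _).
  have fC := fin C mC; have fA := fin A mA; have fB := fin B mB.
  by rewrite (setIidr AC) muleBl// fin_num_adde_defl// fin_numN.
- move=> A ndA HA; have mA n : measurable (A n) by have [] := HA n.
  split; first exact: bigcup_measurable.
  have c1 : P (A n `&` B) @[n --> \oo] --> P (\bigcup_n (A n `&` B)).
    apply: nondecreasing_cvg_mu.
    + by move=> n; exact: measurableI.
    + by apply: bigcup_measurable => n _; exact: measurableI.
    + by move=> k l kl; apply/subsetPset; apply: setSI; apply/subsetPset; exact: ndA.
  have c2 : P (A n) * P B @[n --> \oo] --> P (\bigcup_n A n) * P B.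
    apply: cvgeZr; first exact: fin.
    by apply: nondecreasing_cvg_mu => //; exact: bigcup_measurable.
  have E : (fun n => P (A n `&` B)) = (fun n => P (A n) * P B).
    by apply/funext => n; exact: (HA n).2.
  by rewrite setI_bigcupl; rewrite E in c1; exact: (cvg_unique (@ereal_hausdorff R) c1 c2).
Qed.

Definition independent_variables (Y Z : Omega -> R) : Prop :=
  forall A B, measurable A -> measurable B ->
    P (Y @^-1` A `&` Z @^-1` B) = P (Y @^-1` A) * P (Z @^-1` B).

Lemma bounded_integrable (Y : Omega -> R) (c : R) : measurable_fun setT Y ->
  (forall x, (`|Y x| <= c)%R) -> P.-integrable setT (EFin \o Y).
Proof.
move=> mY Yc; apply: measurable_bounded_integrable => //.
  exact: le_lt_trans (probability_le1 P measurableT) (ltry 1).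
by exists c; split; rewrite ?num_real// => r cr x _ /=; rewrite (le_trans (Yc x))// ltW.
Qed.

Lemma bounded_mul_integrable (Y Z : Omega -> R) (c : R) :
  measurable_fun setT Y -> (forall x, (`|Y x| <= c)%R) ->
  P.-integrable setT (EFin \o Z) ->
  P.-integrable setT (EFin \o (fun x => Y x * Z x)%R).
Proof.
move=> mY Yc iZ; have mZ : measurable_fun setT Z by apply/measurable_EFinP; exact: measurable_int iZ.
apply: (@le_integrable _ _ _ P _ measurableT _ (fun x => c%:E * (Z x)%:E)).
- by apply/measurable_EFinP; exact: measurable_funM.
- move=> x _; rewrite lee_fin /= !normrM ler_wpM2r//.
  exact: le_trans (Yc x) (ler_norm _).
- exact: integrableZl.
Qed.

(** The joint law agrees with the product of the laws on rectangles, hence everywhere; Fubini then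
    splits the integral. *)
Lemma independent_expectation (Y Z : Omega -> R) :
  independent_variables Y Z ->
  P.-integrable setT (EFin \o Y) -> P.-integrable setT (EFin \o Z) ->
  P.-integrable setT (EFin \o (fun x => Y x * Z x)%R) ->
  \int[P]_x (Y x * Z x)%:E = \int[P]_x (Y x)%:E * \int[P]_x (Z x)%:E.
Proof.
move=> indep iY iZ iYZ.
have mY : measurable_fun setT Y by apply/measurable_EFinP; exact: measurable_int iY.
have mZ : measurable_fun setT Z by apply/measurable_EFinP; exact: measurable_int iZ.
have mYZ2 : measurable_fun setT (fun x => (Y x, Z x)) by exact: measurable_fun_pair.
pose Yf := mfun_Sub (mem_set mY : Y \in mfun).
pose Zf := mfun_Sub (mem_set mZ : Z \in mfun).
pose YZf := mfun_Sub (mem_set mYZ2 : (fun x => (Y x, Z x)) \in mfun).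
pose nu := distribution P YZf.
pose f (z : measurableTypeR R * measurableTypeR R) := (z.1 * z.2)%:E.
have mf : measurable_fun setT f.
  by apply/measurable_EFinP; apply: measurable_funM.
have lawE (A : set (measurableTypeR R * measurableTypeR R)) : measurable A ->
    (distribution P Yf \x distribution P Zf) A = nu A.
  by move=> mA; apply: (@product_measure_unique _ _ _ _ R (distribution P Yf) (distribution P Zf) (distribution P YZf)).
have -> : \int[P]_x (Y x * Z x)%:E = \int[nu]_z f z.
  by rewrite integral_distribution.
have <- : \int[distribution P Yf \x distribution P Zf]_z f z = \int[nu]_z f z.
  by apply: eq_measure_integral => A mA _; exact: lawE.
have iZ' : (distribution P Zf).-integrable setT EFin.
  apply/integrableP; split; first exact/measurable_EFinP.
  rewrite ge0_integral_distribution//; last by apply: measurableT_comp => //; exact/measurable_EFinP.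
  by case/integrableP : iZ.
have iY' : (distribution P Yf).-integrable setT EFin.
  apply/integrableP; split; first exact/measurable_EFinP.
  rewrite ge0_integral_distribution//; last by apply: measurableT_comp => //; exact/measurable_EFinP.
  by case/integrableP : iY.
have intf : (distribution P Yf \x distribution P Zf).-integrable setT f.
  apply/integrableP; split => //.
  have -> : \int[distribution P Yf \x distribution P Zf]_z `|f z| = \int[nu]_z `|f z|.
    by apply: eq_measure_integral => A mA _; exact: lawE.
  rewrite ge0_integral_distribution//; last exact: measurableT_comp.
  by case/integrableP : iYZ.
rewrite -integral12_prod_meas1//.
have -> : \int[P]_x (Y x)%:E = \int[distribution P Yf]_y y%:E.
  by rewrite integral_distribution.
have EZ : \int[P]_x (Z x)%:E = \int[distribution P Zf]_y y%:E.
  by rewrite integral_distribution.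
have finZ : \int[distribution P Zf]_y y%:E \is a fin_num by exact: integrable_fin_num.
rewrite EZ -(fineK finZ) -integralZr//.
apply: eq_integral => x _.
transitivity (\int[distribution P Zf]_y (x%:E * y%:E)); first by [].
by rewrite fineK// -integralZl.
Qed.

End independence.

(** The Wiener independence is stated along strictly increasing grids, so the points are sorted and
    duplicates removed. [s'] is put in front as [u 0], which makes [s', s] the first cell. *)
Lemma partition_through {R : realType} (s' s t : R) (J : finType) (r : J -> R) :
  s' < s -> s <= t -> (forall j, s <= r j <= t) ->
  exists n (u : nat -> R), [/\ (0 < n)%N, u 0%N = s' /\ u 1%N = s, u n = t,
    forall k, (k < n)%N -> u k < u k.+1 &
    forall j, exists k, (0 < k <= n)%N /\ u k = r j].
Proof.
move=> s's st rst.
pose L := sort <=%O (undup (s :: t :: [seq r j | j : J])).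
have Ls : sorted <%O L by rewrite lt_sorted_uniq_le sort_uniq undup_uniq sort_le_sorted.
have memL x : (x \in L) = (x \in s :: t :: [seq r j | j : J]) by rewrite mem_sort mem_undup.
have Lst x : x \in L -> s <= x <= t.
  rewrite memL !inE => /or3P[/eqP->|/eqP->|/mapP[j _ ->]]; rewrite ?lexx ?st//.
have sL : s \in L by rewrite memL !inE eqxx.
have tL : t \in L by rewrite memL !inE eqxx orbT.
have L0 : (0 < size L)%N by case: L sL {Ls memL Lst tL}.
have leL := lt_sorted_leq_nth t Ls.
exists (size L), (fun k => if k is k'.+1 then nth t L k' else s'); split => //.
- split => //; apply/eqP; rewrite eq_le; have [->_] := andP (Lst _ (mem_nth t L0)).
  rewrite andbT -[leRHS](nth_index t sL) leL// inE// index_mem//.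
- rewrite -[in LHS](prednK L0); apply/eqP; rewrite eq_le.
  have pL : ((size L).-1 < size L)%N by rewrite prednK.
  have [_ -> /=] := andP (Lst _ (mem_nth t pL)).
  by rewrite -[leLHS](nth_index t tL) leL// ?inE ?index_mem// -ltnS prednK// index_mem.
- move=> [|k] kL; first by apply: lt_le_trans s's _; case/andP: (Lst _ (mem_nth t L0)).
  by rewrite (lt_sorted_ltn_nth t Ls) ?inE// ltnW.
- move=> j; exists (index (r j) L).+1; rewrite /= index_mem nth_index.
    by split => //; rewrite memL !inE map_f ?orbT// mem_enum.
  by rewrite memL !inE map_f ?orbT// mem_enum.
Qed.

(** * Wiener increments against the backward filtration *)

Section wiener_increments.
Context {R : realType} {d : nat} {disp : measure_display}
  {Omega : measurableType disp} (P : probability Omega R).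
Variables (ti : R) (w : R -> Omega -> 'rV[R]_d).
Hypothesis hw : wiener_process P ti w.

Definition increment (r s : R) (i : 'I_d) (omega : Omega) : R :=
  (w s omega - w r omega) 0 i.

Definition increment_rectangles (r s : R) : set (set Omega) :=
  [set A | exists B : 'I_d -> set R, (forall i, measurable (B i)) /\
     A = [set omega | forall i, B i (increment r s i omega)]].

(* The index 0 is left free: the cell [u 0, u 1] is the one from which the later
   increments are independent. *)
Definition later_rectangles (n : nat) (u : nat -> R) : set (set Omega) :=
  [set A | exists B : 'I_n * 'I_d -> set R, (forall ki, measurable (B ki)) /\
     A = [set omega | forall ki : 'I_n * 'I_d, (0 < ki.1)%N ->
            B ki (increment (u ki.1) (u ki.1.+1) ki.2 omega)]].

Lemma measurable_increment (r s : R) i : ti <= r -> ti <= s ->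
  measurable_fun setT (increment r s i).
Proof.
move=> tir tis; rewrite /increment.
under eq_fun do rewrite !mxE.
by apply: measurable_funB; exact: wiener_measurable hw _ _ _.
Qed.

Lemma measurable_forall (I : finType) (d' : measure_display) (T : measurableType d')
    (A : I -> set T) : (forall i, measurable (A i)) -> measurable [set x | forall i, A i x].
Proof.
move=> mA; rewrite (_ : [set x | _] = \bigcap_(i in [set: I]) A i).
  by apply: fin_bigcap_measurable => //; exact: finite_finset.
by apply/seteqP; split => x /= H i; [move=> _|]; exact: H.
Qed.

Lemma measurable_preimage (d' : measure_display) (T : measurableType d') (f : T -> R)
  (B : set R) : measurable_fun setT f -> measurable B -> measurable (f @^-1` B).
Proof. by move=> mf mB; rewrite -[_ @^-1` _]setTI; exact: mf. Qed.

Lemma increment_rectangle_measurable (r s : R) A : ti <= r -> ti <= s ->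
  increment_rectangles r s A -> measurable A.
Proof.
move=> tir tis [B [mB ->]]; apply: measurable_forall => i.
by apply: measurable_preimage => //; exact: measurable_increment.
Qed.

(** All three events are written over the full index set, with [setT] on the cells left free; mutual
    independence factors each of them, and free factors equal 1. *)
Lemma independent_rectangles (n : nat) (u : nat -> R) (A D : set Omega) :
  (0 < n)%N -> ti <= u 0%N -> (forall k, (k < n)%N -> u k < u k.+1) ->
  later_rectangles n u A -> increment_rectangles (u 0%N) (u 1%N) D ->
  P (A `&` D) = (P A * P D)%E.
Proof.
move=> n0 tiu uinc [B [mB ->]] [C [mC ->]].
pose BA (ki : 'I_n * 'I_d) := if (0 < ki.1)%N then B ki else setT.
pose BD (ki : 'I_n * 'I_d) := if (0 < ki.1)%N then setT else C ki.2.
pose BAD (ki : 'I_n * 'I_d) := if (0 < ki.1)%N then B ki else C ki.2.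
have indep := wiener_independent hw tiu uinc.
have first (k : 'I_n) : ~~ (0 < k)%N -> k = Ordinal n0.
  by rewrite lt0n negbK => /eqP k0; exact: val_inj.
have EAD : [set omega | forall ki : 'I_n * 'I_d, (0 < ki.1)%N ->
      B ki (increment (u ki.1) (u ki.1.+1) ki.2 omega)] `&`
    [set omega | forall i, C i (increment (u 0%N) (u 1%N) i omega)] =
  [set omega | forall ki : 'I_n * 'I_d, BAD ki ((w (u ki.1.+1) omega - w (u ki.1) omega) 0 ki.2)].
  apply/seteqP; split => omega /=.
    move=> [HB HC] [k i]; rewrite /BAD/=; case: ifPn => k0; first exact: (HB (k, i)).
    by rewrite (first k k0)/=; exact: HC.
  move=> H; split; last by move=> i; have := H (Ordinal n0, i).
  by move=> ki k0; have := H ki; rewrite /BAD k0.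
have EA : [set omega | forall ki : 'I_n * 'I_d, (0 < ki.1)%N ->
      B ki (increment (u ki.1) (u ki.1.+1) ki.2 omega)] =
  [set omega | forall ki : 'I_n * 'I_d, BA ki ((w (u ki.1.+1) omega - w (u ki.1) omega) 0 ki.2)].
  apply/seteqP; split => omega /= H ki.
    by rewrite /BA; case: ifPn => // k0; exact: H.
  by move=> k0; have := H ki; rewrite /BA k0.
have ED : [set omega | forall i, C i (increment (u 0%N) (u 1%N) i omega)] =
  [set omega | forall ki : 'I_n * 'I_d, BD ki ((w (u ki.1.+1) omega - w (u ki.1) omega) 0 ki.2)].
  apply/seteqP; split => omega /= H.
    by move=> [k i]; rewrite /BD/=; case: ifPn => // k0; rewrite (first k k0); exact: H.
  by move=> i; have := H (Ordinal n0, i).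
have mBA ki : measurable (BA ki) by rewrite /BA; case: (0 < ki.1)%N.
have mBD ki : measurable (BD ki) by rewrite /BD; case: (0 < ki.1)%N.
have mBAD ki : measurable (BAD ki) by rewrite /BAD; case: (0 < ki.1)%N.
rewrite EAD EA ED !indep//.
rewrite -big_split/=; apply: eq_bigr => ki _; rewrite /BAD /BA /BD.
case: ifP => _; rewrite preimage_setT probability_setT ?mule1 ?mul1e//.
Qed.

Lemma later_rectangles_setI n u : setI_closed (later_rectangles n u).
Proof.
move=> _ _ [B [mB ->]] [C [mC ->]]; exists (fun ki => B ki `&` C ki); split.
  by move=> ki; exact: measurableI.
apply/seteqP; split => omega /=; first by move=> [H1 H2] ki k0; split; [exact: H1|exact: H2].
by move=> H; split => ki k0; have [] := H ki k0.
Qed.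

Lemma increment_rectangles_setI r s : setI_closed (increment_rectangles r s).
Proof.
move=> _ _ [B [mB ->]] [C [mC ->]]; exists (fun i => B i `&` C i); split.
  by move=> i; exact: measurableI.
apply/seteqP; split => omega /=; first by move=> [H1 H2] i; split; [exact: H1|exact: H2].
by move=> H; split => i; have [] := H i.
Qed.

(** Finite intersections of the generating events of the backward filtration: a pi-system whose
    sigma-algebra contains that filtration. The free index type lets an intersection be indexed by
    [J1 + J2]. *)
Definition backward_cylinders (t s : R) : set (set Omega) :=
  [set A | exists (J : finType) (r : J -> R) (i : J -> 'I_d) (B : J -> set R),
     [/\ forall j, s <= r j <= t, forall j, measurable (B j) &
     A = [set omega | forall j, B j (increment (r j) t (i j) omega)]]].

Lemma backward_cylinders_setI t s : setI_closed (backward_cylinders t s).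
Proof.
move=> _ _ [J1 [r1 [i1 [B1 [rs1 mB1 ->]]]]] [J2 [r2 [i2 [B2 [rs2 mB2 ->]]]]].
exists (J1 + J2)%type, (fun j => match j with inl j => r1 j | inr j => r2 j end),
  (fun j => match j with inl j => i1 j | inr j => i2 j end),
  (fun j => match j with inl j => B1 j | inr j => B2 j end); split.
- by case.
- by case.
- apply/seteqP; split => omega /=; first by move=> [H1 H2] [].
  by move=> H; split => j; [have := H (inl j)|have := H (inr j)].
Qed.

Lemma later_rectangle_measurable (n : nat) (u : nat -> R) A : ti <= u 0%N ->
  (forall k, (k < n)%N -> u k < u k.+1) -> later_rectangles n u A -> measurable A.
Proof.
move=> tiu uinc [B [mB ->]].
have tiuk k : (k <= n)%N -> ti <= u k.
  elim: k => // k IH kn; apply: le_trans (IH (ltnW kn)) _; exact/ltW/uinc.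
apply: measurable_forall => ki; have [k0|k0] := boolP (0 < ki.1)%N.
  rewrite (_ : (fun _ => _) = increment (u ki.1) (u ki.1.+1) ki.2 @^-1` B ki).
    by apply: measurable_preimage => //; apply: measurable_increment; apply: tiuk;
      rewrite // ltnW.
  by apply/seteqP; split => omega /=; [apply|].
by rewrite (_ : (fun _ => _) = setT)//; apply/seteqP; split.
Qed.

(** The increment from a grid point [u k] to [u n] is a sum of cell increments of index at least k >
    0, each measurable for the later rectangles. *)
Lemma later_generates (n : nat) (u : nat -> R) (J : finType) (r : J -> R)
    (i : J -> 'I_d) (B : J -> set R) :
  (forall j, exists k, (0 < k <= n)%N /\ u k = r j) -> (forall j, measurable (B j)) ->
  <<s later_rectangles n u >> [set omega | forall j, B j (increment (r j) (u n) (i j) omega)].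
Proof.
move=> ur mB.
pose T := g_sigma_algebraType (later_rectangles n u).
have minc (k : nat) (e : 'I_d) : (0 < k < n)%N ->
    measurable_fun setT (increment (u k) (u k.+1) e : T -> R).
  move=> /andP[k0 kn] _ C mC; rewrite setTI; apply: sub_sigma_algebra.
  exists (fun ki => if ki == (Ordinal kn, e) then C else setT); split.
    by move=> ki; case: ifP.
  apply/seteqP; split => omega /= H.
    by move=> ki k0'; case: eqP => // ->.
  by have := H (Ordinal kn, e) k0; rewrite eqxx.
apply: (@measurable_forall J _ T) => j.
apply: (@measurable_preimage _ T) => //.
have [k [/andP[k0 kn] <-]] := ur j.
have -> : (increment (u k) (u n) (i j) : T -> R) =
    (fun omega => \sum_(l <- index_iota k n) increment (u l) (u l.+1) (i j) omega).
  apply/funext => omega.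
  have := @telescope_sumr R k n (fun l => w (u l) omega 0 (i j)) kn.
  rewrite /increment !mxE => <-.
  by apply: eq_bigr => l _; rewrite !mxE.
rewrite (_ : (fun omega => _) = (fun omega : T => \sum_(l <- index_iota k n)
    (if (0 < l < n)%N then increment (u l) (u l.+1) (i j) omega else 0))).
  apply: measurable_sum => l; have [/minc|_] := boolP (0 < l < n)%N; first exact.
  exact: measurable_cst.
apply/funext => omega; apply: eq_big_seq => l; rewrite mem_index_iota => /andP[kl ln].
by rewrite ln (leq_trans k0 kl).
Qed.

(** Three applications of [independent_sigma_algebra]: from the later rectangles of a grid to a
    cylinder resolved by that grid, from cylinders to the filtration, and from rectangles over
    [s', s] to their sigma-algebra. The grid changes with the cylinder, which is why cylinders are
    treated one at a time. *)
Lemma wiener_backward_independence (t s s' : R) (A D : set Omega) :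
  ti <= s' -> s' < s -> s <= t ->
  backward_filtration w t s A -> <<s increment_rectangles s' s >> D ->
  P (A `&` D) = (P A * P D)%E.
Proof.
move=> tis' s's st FA.
have tis : ti <= s by rewrite (le_trans tis')// ltW.
have cylm C : backward_cylinders t s C -> measurable C.
  move=> [J [r [i [B [rs mB ->]]]]]; apply: measurable_forall => j.
  apply: measurable_preimage => //; apply: measurable_increment.
    by rewrite (le_trans tis)//; case/andP: (rs j).
  exact: le_trans st.
have sub : backward_filtration w t s `<=` <<s backward_cylinders t s >>.
  apply: smallest_sub; first exact: smallest_sigma_algebra.
  move=> _ [r [i [B [rs [mB ->]]]]]; apply: sub_sigma_algebra.
  exists unit, (fun=> r), (fun=> i), (fun=> B); split => //.
  by apply/seteqP; split => omega /= H; [move=> _; exact: H|exact: (H tt)].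
have mA : measurable A.
  by apply: (smallest_sub (@sigma_algebra_measurable _ Omega) cylm); exact: sub.
have rectm C : increment_rectangles s' s C -> measurable C.
  exact: increment_rectangle_measurable.
have step2 C : increment_rectangles s' s C -> P (A `&` C) = (P A * P C)%E.
  move=> rC; have mC := rectm _ rC.
  apply: (independent_sigma_algebra (@backward_cylinders_setI t s) cylm mC); last exact: sub.
  move=> _ [J [r [i [B [rs mB ->]]]]].
  have [n [u [n0 [u0 u1] un uinc ur]]] := partition_through s's st rs.
  have tiu : ti <= u 0%N by rewrite u0.
  have := later_generates i ur mB; rewrite un.
  apply: (independent_sigma_algebra (@later_rectangles_setI n u)) => //.
    by move=> E; exact: later_rectangle_measurable.
  move=> E rE; apply: (independent_rectangles n0 tiu uinc) => //.
  by rewrite u0 u1.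
move=> sD; rewrite setIC muleC.
apply: (independent_sigma_algebra (@increment_rectangles_setI s' s) rectm mA) sD.
by move=> C rC; rewrite setIC muleC; exact: step2.
Qed.

Lemma backward_filtration_measurable (t s : R) A : ti <= s -> s <= t ->
  backward_filtration w t s A -> measurable A.
Proof.
move=> tis st; apply: smallest_sub; first exact: sigma_algebra_measurable.
move=> _ [r [i [B [/andP[sr rt] [mB ->]]]]]; apply: measurable_preimage => //.
by apply: measurable_increment; [exact: le_trans sr|exact: le_trans st].
Qed.

Lemma backward_filtrationS (t r s : R) : r <= s ->
  backward_filtration w t s `<=` backward_filtration w t r.
Proof.
move=> rs; apply: smallest_sub; first exact: smallest_sigma_algebra.
move=> _ [u [i [B [/andP[su ut] [mB ->]]]]]; apply: sub_sigma_algebra.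
by exists u, i, B; rewrite (le_trans rs su).
Qed.

(** The filtration is put on [Omega] as a measurable structure of its own, so that the closure
    properties of [measurable_fun] apply to it. *)
Definition filtration_measurable (t s : R) (Y : Omega -> R) : Prop :=
  measurable_fun (setT : set (g_sigma_algebraType (backward_increment_events w t s)))
    (Y : g_sigma_algebraType (backward_increment_events w t s) -> R).

Lemma filtration_measurable_preimage (t s : R) (Y : Omega -> R) :
  filtration_measurable t s Y <->
  forall B, measurable B -> backward_filtration w t s (Y @^-1` B).
Proof.
split=> [mY B mB|H _ B mB]; last by rewrite setTI; exact: H.
have := mY measurableT B mB; rewrite setTI; exact.
Qed.

Lemma filtration_measurable_fun (t s : R) (Y : Omega -> R) : ti <= s -> s <= t ->
  filtration_measurable t s Y -> measurable_fun setT Y.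
Proof.
move=> tis st /filtration_measurable_preimage H _ B mB; rewrite setTI.
exact: backward_filtration_measurable (H B mB).
Qed.

Lemma ge0_integral_increment (r s : R) i (f : measurableTypeR R -> \bar R) :
  ti <= r -> r < s -> measurable_fun setT f -> (forall x, 0 <= f x)%E ->
  (\int[P]_omega f (increment r s i omega) =
   \int[normal_prob 0 (Num.sqrt (s - r))]_x f x)%E.
Proof.
move=> tir rs mf f0.
have mX : measurable_fun setT (increment r s i).
  by apply: measurable_increment => //; rewrite (le_trans tir)// ltW.
have mX' : measurable_fun setT (increment r s i : Omega -> measurableTypeR R) := mX.
pose X := mfun_Sub (mem_set mX' : (increment r s i : Omega -> measurableTypeR R) \in mfun).
rewrite -(@ge0_integral_distribution _ _ _ _ _ P X f mf f0).
by apply: eq_measure_integral => A mA _; exact: (wiener_gaussian hw).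
Qed.

Lemma integrable_increment_sqr (r s : R) i : ti <= r -> r < s ->
  P.-integrable setT (EFin \o (fun omega => increment r s i omega ^+ 2)).
Proof.
move=> tir rs.
have mX : measurable_fun setT (increment r s i).
  by apply: measurable_increment => //; rewrite (le_trans tir)// ltW.
apply/integrableP; split; first by apply/measurable_EFinP; exact: measurable_funX.
under eq_integral do rewrite /= ger0_norm ?sqr_ge0//.
rewrite (@ge0_integral_increment r s i (fun x => (x ^+ 2)%:E))//.
- by rewrite normal_prob_second_moment ?sqrtr_gt0 ?subr_gt0// ltry.
- by apply/measurable_EFinP; exact: measurable_funX.
- by move=> x; rewrite lee_fin sqr_ge0.
Qed.

Lemma integrable_increment (r s : R) i : ti <= r -> r < s ->
  P.-integrable setT (EFin \o increment r s i).
Proof.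
move=> tir rs.
have mX : measurable_fun setT (increment r s i).
  by apply: measurable_increment => //; rewrite (le_trans tir)// ltW.
apply: (@le_integrable _ _ _ P _ measurableT _
  (EFin \o (fun omega => 1 + increment r s i omega ^+ 2))).
- exact/measurable_EFinP.
- move=> x _; rewrite lee_fin /=; set z := increment _ _ _ _.
  rewrite [leRHS]ger0_norm ?addr_ge0 ?sqr_ge0//.
  by rewrite -[z ^+ 2]real_normK ?num_real//; have := sqr_ge0 (`|z| - 1); nra.
- have i1 : P.-integrable setT (EFin \o cst 1).
    by apply: (@bounded_integrable _ _ _ P _ 1) => // x; rewrite normr1.
  exact: (integrableD measurableT i1 (integrable_increment_sqr i tir rs)).
Qed.

Lemma increment_mean (r s : R) i : ti <= r -> r < s ->
  (\int[P]_omega (increment r s i omega)%:E = 0)%E.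
Proof.
move=> tir rs.
have mX : measurable_fun setT (increment r s i).
  by apply: measurable_increment => //; rewrite (le_trans tir)// ltW.
have mX' : measurable_fun setT (increment r s i : Omega -> measurableTypeR R) := mX.
pose X := mfun_Sub (mem_set mX' : (increment r s i : Omega -> measurableTypeR R) \in mfun).
have := @integral_distribution _ _ _ _ _ P X EFin.
rewrite /comp /= => <-.
- rewrite -(@normal_prob_mean R (Num.sqrt (s - r))) ?sqrtr_gt0 ?subr_gt0//.
  by apply: eq_measure_integral => A mA _; exact: (wiener_gaussian hw).
- exact/measurable_EFinP.
- exact: integrable_increment.
Qed.

Lemma increment_second_moment (r s : R) i : ti <= r -> r < s ->
  (\int[P]_omega (increment r s i omega ^+ 2)%:E = (s - r)%:E)%E.
Proof.
move=> tir rs; rewrite (@ge0_integral_increment r s i (fun x => (x ^+ 2)%:E))//.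
- by rewrite normal_prob_second_moment ?sqrtr_gt0 ?subr_gt0// sqr_sqrtr// subr_ge0 ltW.
- by apply/measurable_EFinP; exact: measurable_funX.
- by move=> x; rewrite lee_fin sqr_ge0.
Qed.

Lemma increment_fourth_moment (r s : R) i : ti <= r -> r < s ->
  (\int[P]_omega (increment r s i omega ^+ 4)%:E <= (3 * (s - r) ^+ 2)%:E)%E.
Proof.
move=> tir rs; rewrite (@ge0_integral_increment r s i (fun x => (x ^+ 4)%:E))//.
- apply: le_trans (normal_prob_fourth_moment _) _; first by rewrite sqrtr_gt0 subr_gt0.
  by rewrite (_ : 4%N = (2 * 2)%N)// exprM sqr_sqrtr// subr_ge0 ltW.
- by apply/measurable_EFinP; exact: measurable_funX.
- by move=> x; rewrite lee_fin exprn_even_ge0.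
Qed.

Lemma integrable_increment_mul (r s : R) i j : ti <= r -> r < s ->
  P.-integrable setT (EFin \o (fun omega => increment r s i omega * increment r s j omega)).
Proof.
move=> tir rs.
have mX k : measurable_fun setT (increment r s k).
  by apply: measurable_increment => //; rewrite (le_trans tir)// ltW.
apply: (le_integrable measurableT _ _ (integrableD measurableT
  (integrable_increment_sqr i tir rs) (integrable_increment_sqr j tir rs))).
- by apply/measurable_EFinP; exact: measurable_funM.
- move=> x _; rewrite lee_fin /=; move: (increment _ _ i x) (increment _ _ j x) => y z.
  rewrite [leRHS]ger0_norm ?addr_ge0 ?sqr_ge0// normrM.
  rewrite -[y ^+ 2]real_normK ?num_real// -[z ^+ 2]real_normK ?num_real//.
  by have := sqr_ge0 (`|y| - `|z|); have := sqr_ge0 (`|y| + `|z|); nra.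
Qed.

(** Wiener independence along a one-cell grid, with [setT] on all coordinates other than [i] and
    [j]. *)
Lemma independent_coordinates (r s : R) i j : ti <= r -> r < s -> i != j ->
  independent_variables P (increment r s i) (increment r s j).
Proof.
move=> tir rs ij A B mA mB.
pose u (k : nat) := if k is 0 then r else s.
have uinc k : (k < 1)%N -> u k < u k.+1 by case: k.
have indep := wiener_independent hw (tir : ti <= u 0%N) uinc.
pose C (a b : set R) (ki : 'I_1 * 'I_d) := if ki.2 == i then a else if ki.2 == j then b else setT.
have mC a b ki : measurable a -> measurable b -> measurable (C a b ki).
  by rewrite /C; case: (ki.2 == i) => //; case: (ki.2 == j).
have CE a b : measurable a -> measurable b ->
    P (increment r s i @^-1` a `&` increment r s j @^-1` b) =
    (P (increment r s i @^-1` a) * P (increment r s j @^-1` b))%E.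
  move=> ma mb.
  have -> : increment r s i @^-1` a `&` increment r s j @^-1` b =
     [set omega | forall ki : 'I_1 * 'I_d, C a b ki
        ((w (u ki.1.+1) omega - w (u ki.1) omega) 0 ki.2)].
    apply/seteqP; split => omega /=.
      move=> [Ha Hb] [k e]; rewrite ord1 /C /=.
      by case: eqP => [->//|_]; case: eqP => [->|].
    move=> H; split; first by have := H (ord0, i); rewrite /C /= eqxx.
    by have := H (ord0, j); rewrite /C /= eq_sym (negbTE ij) eqxx.
  rewrite indep; last by move=> ki; exact: mC.
  rewrite (bigD1 (ord0, i))//= (bigD1 (ord0, j))/=; last by rewrite xpair_eqE eqxx /= eq_sym.
  rewrite big1 ?mule1.
    by rewrite /C /= eqxx eq_sym (negbTE ij) eqxx.
  move=> [k e]; rewrite /C /= !xpair_eqE (ord1 k) !eqxx /= => /andP[/negbTE -> /negbTE ->].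
  by rewrite preimage_setT probability_setT.
exact: CE.
Qed.

Lemma increment_covariance (r s : R) i j : ti <= r -> r < s ->
  (\int[P]_omega (increment r s i omega * increment r s j omega)%:E =
   ((i == j)%:R * (s - r))%:E)%E.
Proof.
move=> tir rs; have [->|ij] := eqVneq i j.
  by under eq_integral do rewrite -expr2; rewrite increment_second_moment// mul1r.
rewrite (independent_expectation (independent_coordinates tir rs ij));
  [|exact: integrable_increment|exact: integrable_increment|exact: integrable_increment_mul].
by rewrite increment_mean// mul0e mul0r.
Qed.

Lemma filtration_independent (t r s : R) (Y Z : Omega -> R) :
  ti <= r -> r < s -> s <= t -> filtration_measurable t s Y ->
  measurable_fun (setT : set (g_sigma_algebraType (increment_rectangles r s)))
    (Z : g_sigma_algebraType (increment_rectangles r s) -> R) ->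
  independent_variables P Y Z.
Proof.
move=> tir rs st /filtration_measurable_preimage mY mZ A B mA mB.
apply: (wiener_backward_independence tir rs st); first exact: mY.
by have := mZ measurableT B mB; rewrite setTI; exact.
Qed.

Lemma increment_measurable_rectangles (r s : R) i :
  measurable_fun (setT : set (g_sigma_algebraType (increment_rectangles r s)))
    (increment r s i : g_sigma_algebraType (increment_rectangles r s) -> R).
Proof.
move=> _ B mB; rewrite setTI; apply: sub_sigma_algebra.
exists (fun j => if j == i then B else setT); split.
  by move=> j; case: (j == i).
apply/seteqP; split => omega /= H; last by have := H i; rewrite eqxx.
by move=> j; case: eqP => // ->.
Qed.

(** [Y] is known at the later time [s] while [Z] depends on the increment over [r, s], so the
    expectation of the product factors; boundedness of [Y] makes the product integrable. *)
Lemma martingale_term (t r s : R) (Y Z : Omega -> R) (c : R) :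
  ti <= r -> r < s -> s <= t -> filtration_measurable t s Y -> (forall x, `|Y x| <= c) ->
  measurable_fun (setT : set (g_sigma_algebraType (increment_rectangles r s)))
    (Z : g_sigma_algebraType (increment_rectangles r s) -> R) ->
  P.-integrable setT (EFin \o Z) -> (\int[P]_x (Z x)%:E = 0)%E ->
  P.-integrable setT (EFin \o (fun x => Y x * Z x)) /\
  (\int[P]_x (Y x * Z x)%:E = 0)%E.
Proof.
move=> tir rs st FY Yc mZ iZ EZ.
have tis : ti <= s by rewrite (le_trans tir)// ltW.
have mY := filtration_measurable_fun tis st FY.
have iY := bounded_integrable P mY Yc.
have iYZ := bounded_mul_integrable mY Yc iZ.
split => //; rewrite (independent_expectation (filtration_independent tir rs st FY mZ))//.
by rewrite EZ mule0.
Qed.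

Lemma martingale_linear_term (t r s : R) (Y : Omega -> R) (c : R) i :
  ti <= r -> r < s -> s <= t -> filtration_measurable t s Y -> (forall x, `|Y x| <= c) ->
  P.-integrable setT (EFin \o (fun x => Y x * increment r s i x)) /\
  (\int[P]_x (Y x * increment r s i x)%:E = 0)%E.
Proof.
move=> tir rs st FY Yc; apply: (martingale_term tir rs st FY Yc).
- exact: increment_measurable_rectangles.
- exact: integrable_increment.
- exact: increment_mean.
Qed.

Lemma martingale_quadratic_term (t r s : R) (Y : Omega -> R) (c : R) i j :
  ti <= r -> r < s -> s <= t -> filtration_measurable t s Y -> (forall x, `|Y x| <= c) ->
  P.-integrable setT (EFin \o (fun x => Y x *
    (increment r s i x * increment r s j x - (i == j)%:R * (s - r)))) /\
  (\int[P]_x (Y x *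
    (increment r s i x * increment r s j x - (i == j)%:R * (s - r)))%:E = 0)%E.
Proof.
move=> tir rs st FY Yc.
have ic : P.-integrable setT (EFin \o cst ((i == j)%:R * (s - r))).
  exact: (@bounded_integrable _ _ _ P _ `|(i == j)%:R * (s - r)|).
apply: (martingale_term tir rs st FY Yc).
- apply: measurable_funB => //.
  by apply: measurable_funM; exact: increment_measurable_rectangles.
- exact: (integrableB measurableT (integrable_increment_mul i j tir rs) ic).
- under eq_integral do rewrite EFinB.
  rewrite (integralB_EFin measurableT (integrable_increment_mul i j tir rs) ic).
  have Ec (e : R) : (\int[P]_x e%:E = e%:E)%E.
    rewrite (integral_cst P measurableT e%:E) -[RHS]mule1; congr (_ * _)%E.
    exact: probability_setT.
  by rewrite increment_covariance// [X in (_ - X)%E]Ec subee.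
Qed.

End wiener_increments.

(** * Limits of expectations *)

Section convergence_of_expectations.
Context {R : realType} {disp : measure_display} {Omega : measurableType disp}
  (P : probability Omega R).
Local Open Scope ereal_scope.

Lemma integrable_cst (c : R) : P.-integrable setT (EFin \o (fun=> c)).
Proof. exact: (@bounded_integrable _ _ _ P _ `|c|%R). Qed.

Lemma integral_cst_probability (c : R) : \int[P]_x c%:E = c%:E.
Proof.
rewrite (integral_cst P measurableT c%:E) -[RHS]mule1; congr (_ * _).
exact: probability_setT.
Qed.

(* Where Q <= lam the bounded convergence theorem applies; elsewhere the crude bound
   is at most 2 C Q^2 / lam. *)
Lemma integral_abs_vanishing (D Q : nat -> Omega -> R) (C C' : R) :
  (0 <= C)%R -> (0 <= C')%R ->
  (forall N, measurable_fun setT (D N)) -> (forall N, measurable_fun setT (Q N)) ->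
  (forall N x, (0 <= Q N x)%R) ->
  {ae P, forall x, (forall N, (`|D N x| <= C * (1 + Q N x))%R) /\
     (forall eps, (0 < eps)%R -> \forall N \near \oo, (`|D N x| <= eps * (1 + Q N x))%R)} ->
  (forall N, \int[P]_x ((Q N x) ^+ 2)%:E <= C'%:E) ->
  forall eps, (0 < eps)%R -> \forall N \near \oo, \int[P]_x `|D N x|%:E <= eps%:E.
Proof.
move=> C0 C'0 mD mQ Q0 aeD EQ eps eps0.
(* lam >= 1 gives (1 + Q) lam <= 2 Q^2 where Q > lam, and lam >= 4 C C' / eps makes the resulting
   tail 2 C C' / lam at most eps / 2. *)
pose lam : R := (Num.max 1 (4 * C * C' / eps))%R.
have lam1 : (1 <= lam)%R by rewrite le_max lexx.
have lam0 : (0 < lam)%R by rewrite (lt_le_trans ltr01).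
pose G N := [set x | (Q N x <= lam)%R].
have mG N : measurable (G N).
  rewrite (_ : G N = Q N @^-1` `]-oo, lam]).
    by rewrite -[_ @^-1` _]setTI; exact: mQ.
  by apply/seteqP; split => x /=; rewrite in_itv.
pose r N x : R := (\1_(G N) x * `|D N x|)%R.
have r0 N x : (0 <= r N x)%R by rewrite mulr_ge0.
have mabsD N : measurable_fun setT (fun x => `|D N x|)%R by exact: measurableT_comp.
have mr N : measurable_fun setT (r N) by exact: measurable_funM.
have cvgr : \int[P]_x (r N x)%:E @[N --> \oo] --> 0.
  have a1 : {ae P, forall x, setT x -> (r N x)%:E @[N --> \oo] --> 0}.
    apply: filterS aeD => x [_ H] _; apply: cvg_EFin; first exact: nearW.
    apply/cvgrPdist_le => e e0.
    have e1 : (0 < e / (1 + lam))%R by rewrite divr_gt0// addr_gt0.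
    have := H _ e1; apply: filterS => N DN /=.
    rewrite sub0r normrN ger0_norm// /r indicE.
    have [|_] := boolP (x \in G N); last by rewrite mul0r ltW.
    rewrite inE /G/= mul1r => Ql; apply: le_trans DN _.
    rewrite mulrAC ler_pdivrMr ?addr_gt0// ler_wpM2l ?(ltW e0)//; lra.
  have a2 : {ae P, forall x (N : nat), setT x -> `|(r N x)%:E| <= (C * (1 + lam))%:E}.
    apply: filterS aeD => x [H _] N _; rewrite lee_fin ger0_norm// /r indicE.
    have [|_] := boolP (x \in G N); last first.
      by rewrite mul0r mulr_ge0// addr_ge0// ltW.
    rewrite inE /G/= mul1r => Ql; apply: le_trans (H N) _.
    by rewrite ler_wpM2l//; lra.
  have [_ _] := @dominated_convergence _ _ _ P setT measurableT
    (fun N x => (r N x)%:E) (fun=> 0) (fun=> (C * (1 + lam))%:E)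
    (fun N => (measurable_EFinP _ _).2 (mr N)) (measurable_cst _) a1
    (integrable_cst _) a2.
  by rewrite integral0.
have eps2 : (0 < eps / 2)%R by rewrite divr_gt0.
have := cvgr; move/fine_cvgP => [_ /cvgrPdist_lt/(_ _ eps2)].
have finr : \forall N \near \oo, \int[P]_x (r N x)%:E \is a fin_num.
  by move/fine_cvgP : cvgr => [].
move=> H; near=> N.
have rN : \int[P]_x (r N x)%:E <= (eps / 2)%:E.
  rewrite -[leLHS]fineK; last by near: N.
  rewrite lee_fin; have : (`|0 - fine (\int[P]_x (r N x)%:E)| < eps / 2)%R by near: N.
  by rewrite sub0r normrN => /ltW; exact: le_trans (ler_norm _).
apply: (@le_trans _ _ (\int[P]_x ((r N x)%:E + (2 * C / lam)%:E * (Q N x ^+ 2)%:E))).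
  apply: ae_ge0_le_integral => //.
  - by apply/measurable_EFinP.
  - move=> x _; rewrite -EFinM -EFinD lee_fin addr_ge0// mulr_ge0 ?sqr_ge0//.
    by rewrite divr_ge0 ?mulr_ge0// ltW.
  - apply: emeasurable_funD; first exact/measurable_EFinP.
    by apply: emeasurable_funM => //; apply/measurable_EFinP; exact: measurable_funX.
  - apply: filterS aeD => x [HD _] _; rewrite -EFinM -EFinD lee_fin /r indicE.
    have [|] := boolP (x \in G N).
      by rewrite mul1r lerDl mulr_ge0 ?sqr_ge0// divr_ge0 ?mulr_ge0// ltW.
    rewrite notin_setE /G/= => /negP; rewrite -ltNge => lQ.
    rewrite mul0r add0r; apply: le_trans (HD N) _.
    rewrite mulrAC ler_pdivlMr// mulrAC [leRHS]mulrAC.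
    rewrite -!mulrA [leLHS]mulrCA !mulrA -!mulrA.
    have : ((1 + Q N x) * lam <= 2 * Q N x ^+ 2)%R by nra.
    by move=> /(ler_wpM2l C0); lra.
rewrite ge0_integralD//=.
- rewrite ge0_integralZl//.
  + apply: (@le_trans _ _ ((eps / 2)%:E + (2 * C / lam)%:E * C'%:E)).
      apply: leeD => //; apply: lee_wpmul2l => //.
      by rewrite lee_fin divr_ge0 ?mulr_ge0// ltW.
    rewrite -EFinM -EFinD lee_fin.
    suff : (2 * C / lam * C' <= eps / 2)%R by lra.
    rewrite mulrAC ler_pdivrMr//.
    have : (4 * C * C' / eps <= lam)%R by rewrite le_max lexx orbT.
    by rewrite ler_pdivrMr//; lra.
  + by apply/measurable_EFinP; exact: measurable_funX.
  + by move=> x _; rewrite lee_fin sqr_ge0.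
  + by rewrite lee_fin divr_ge0 ?mulr_ge0// ltW.
- by move=> x _; rewrite lee_fin.
- exact/measurable_EFinP.
- by move=> x _; rewrite -EFinM lee_fin mulr_ge0 ?sqr_ge0// divr_ge0 ?mulr_ge0// ltW.
- by apply: emeasurable_funM => //; apply/measurable_EFinP; exact: measurable_funX.
Unshelve. all: by end_near. Qed.

Definition clamp (K x : R) : R := Num.max (- K)%R (Num.min x K).

Lemma clamp_bound K x : (0 <= K)%R -> (`|clamp K x| <= K)%R.
Proof.
move=> K0; rewrite /clamp ler_norml le_max lexx /= ge_max; apply/andP; split; first lra.
by rewrite ge_min lexx orbT.
Qed.

Lemma clamp_id K x : (`|x| <= K)%R -> clamp K x = x.
Proof. by rewrite ler_norml => /andP[a b]; rewrite /clamp min_l// max_r. Qed.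

Lemma clamp_residual K x : (0 <= K)%R -> (`|x - clamp K x| <= `|x|)%R.
Proof.
move=> K0; rewrite /clamp.
case: (lerP x K) => xK; case: (lerP (- K) _) => Kx; rewrite ?subrr ?normr0//.
- rewrite ler0_norm ?[leRHS]ler0_norm; lra.
- rewrite ger0_norm ?[leRHS]ger0_norm; lra.
- lra.
Qed.

Lemma clamp_lipschitz K x y : (`|clamp K x - clamp K y| <= `|x - y|)%R.
Proof.
apply: (@le_trans _ _ (`|Num.min x K - Num.min y K|)%R).
  case: (ler0P (Num.min x K - Num.min y K)) => ?; rewrite /clamp ler_norml;
  case: (lerP (- K) (Num.min x K)) => ?; case: (lerP (- K) (Num.min y K)) => ?; lra.
case: (ler0P (x - y)) => ?; rewrite ler_norml;
case: (lerP x K) => ?; case: (lerP y K) => ?; lra.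
Qed.

Lemma clamp_continuous K : continuous (clamp K).
Proof.
move=> x; apply/cvgrPdist_lt => e e0; near=> y; apply: le_lt_trans (clamp_lipschitz _ _ _) _.
by near: y; apply: cvgr_dist_lt.
Unshelve. all: by end_near. Qed.

Lemma measurable_clamp K (Z : Omega -> R) : measurable_fun setT Z ->
  measurable_fun setT (fun x => clamp K (Z x)).
Proof.
move=> mZ; apply: (@measurable_maxr _ _ _ _ (cst (- K)%R) (fun x => Num.min (Z x) K)) => //.
exact: measurable_minr.
Qed.

Lemma measurable_abs_tail K (Z : Omega -> R) : measurable_fun setT Z ->
  measurable [set x | (K < `|Z x|)%R].
Proof.
move=> mZ; rewrite (_ : [set _ | _] = (fun x => `|Z x|)%R @^-1` `]K, +oo[).
  by rewrite -[_ @^-1` _]setTI; apply: measurableT_comp.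
by apply/seteqP; split => x /=; rewrite in_itv/= ?andbT.
Qed.

Lemma clamp_tail K (Z : Omega -> R) : (0 <= K)%R -> measurable_fun setT Z ->
  \int[P]_x `|Z x - clamp K (Z x)|%:E <=
  \int[P]_(x in [set x | (K < `|Z x|)%R]) `|Z x|%:E.
Proof.
move=> K0 mZ; have mA := measurable_abs_tail K mZ.
rewrite [leRHS]integral_mkcond; apply: ge0_le_integral => //.
- apply/measurable_EFinP/measurableT_comp => //.
  by apply: measurable_funB => //; exact: measurable_clamp.
- apply/(measurable_restrictT _ mA); apply: measurable_funTS.
  by apply/measurable_EFinP; exact: measurableT_comp.
- move=> x _; rewrite patchE; have [_|] := boolP (x \in _).
    by rewrite lee_fin clamp_residual.
  by rewrite notin_setE /= => /negP; rewrite -leNgt => /clamp_id ->; rewrite subrr normr0.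
Qed.

(** Vitali's theorem by truncation: the clamped variables converge in mean by dominated convergence,
    the residuals are small uniformly in [n], and Fatou passes that smallness on to [Y]. *)
Lemma uniformly_integrable_limit (X : nat -> Omega -> R) (Y : Omega -> R) (c : R) :
  (forall n, measurable_fun setT (X n)) ->
  (forall x, X n x @[n --> \oo] --> Y x) ->
  (forall eps, (0 < eps)%R -> exists K, forall n,
    \int[P]_(x in [set x | (K < `|X n x|)%R]) `|X n x|%:E <= eps%:E) ->
  (forall n, \int[P]_x (X n x)%:E = c%:E) ->
  \int[P]_x (Y x)%:E = c%:E.
Proof.
move=> mX XY UI EX.
have mY : measurable_fun setT Y.
  by apply: (measurable_fun_cvg mX) => x _; exact: XY.
have UI' eps : (0 < eps)%R -> exists K, (0 <= K)%R /\ forall n,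
    \int[P]_x `|X n x - clamp K (X n x)|%:E <= eps%:E.
  (* [clamp] is used at a nonnegative level; raising the level only shrinks the tail set. *)
  move=> /UI[K HK]; exists (Num.max 0 K)%R; split; first by rewrite le_max lexx.
  move=> n; apply: le_trans (HK n); apply: le_trans (clamp_tail _ (mX n)) _.
    by rewrite le_max lexx.
  have mA K' := measurable_abs_tail K' (mX n).
  apply: ge0_subset_integral => //.
    by apply/measurable_EFinP; apply: measurable_funTS; exact: measurableT_comp.
  by move=> x /=; apply: le_lt_trans; rewrite le_max lexx orbT.
have mres K (Z : Omega -> R) : measurable_fun setT Z ->
    measurable_fun setT (fun x => (Z x - clamp K (Z x))%R).
  by move=> mZ; apply: measurable_funB => //; exact: measurable_clamp.
have UIY eps K : (0 <= K)%R -> (forall n,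
    \int[P]_x `|X n x - clamp K (X n x)|%:E <= eps%:E) ->
    \int[P]_x `|Y x - clamp K (Y x)|%:E <= eps%:E.
  move=> K0 HK.
  have := @fatou _ _ _ P setT measurableT (fun n x => `|X n x - clamp K (X n x)|%:E).
  have -> : (fun x => limn_einf (fun n => `|X n x - clamp K (X n x)|%:E)) =
      (fun x => `|Y x - clamp K (Y x)|%:E).
    apply/funext => x; apply: (cvg_limn_einf_sup _).1; apply: cvg_EFin; first exact: nearW.
    apply: cvg_norm; apply: cvgB; first exact: XY.
    by apply: continuous_cvg; [exact: clamp_continuous|exact: XY].
  move=> H; apply: le_trans (H _ _) _.
  - by move=> n; apply/measurable_EFinP; apply: measurableT_comp => //; exact: mres.
  - by move=> n x _; rewrite lee_fin.
  rewrite limn_einf_lim; apply: lime_le; first exact: is_cvg_einfs.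
  by apply: nearW => n; apply: ge_ereal_inf; exists (\int[P]_x `|X n x - clamp K (X n x)|%:E); [by exists n => /=|exact: HK].
have iclamp K (Z : Omega -> R) : (0 <= K)%R -> measurable_fun setT Z ->
    P.-integrable setT (EFin \o (fun x => clamp K (Z x))).
  move=> K0 mZ; apply: (@bounded_integrable _ _ _ P _ K); first exact: measurable_clamp.
  by move=> x; exact: clamp_bound.
have ires eps K (Z : Omega -> R) : measurable_fun setT Z ->
    \int[P]_x `|Z x - clamp K (Z x)|%:E <= eps%:E ->
    P.-integrable setT (EFin \o (fun x => (Z x - clamp K (Z x))%R)).
  move=> mZ H; apply/integrableP; split; first by apply/measurable_EFinP; exact: mres.
  exact: le_lt_trans H (ltry _).
have small eps K (Z : Omega -> R) : (0 <= K)%R -> measurable_fun setT Z ->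
    \int[P]_x `|Z x - clamp K (Z x)|%:E <= eps%:E ->
    P.-integrable setT (EFin \o Z) /\
    (`|\int[P]_x Z x - \int[P]_x clamp K (Z x)| <= eps)%R.
  move=> K0 mZ H; have iZ : P.-integrable setT (EFin \o Z).
    apply: (eq_integrable measurableT) (integrableD measurableT (ires _ _ _ mZ H) (iclamp _ _ K0 mZ)).
    by move=> x _ /=; rewrite -EFinD subrK.
  split => //; rewrite -RintegralB//; last exact: iclamp.
  rewrite -lee_fin EFin_normr_Rintegral//; last exact: ires H.
  apply: le_trans H.
  by apply: le_abse_integral => //; apply/measurable_EFinP; exact: mres.
have [K1 [K10 HK1]] := UI' _ ltr01.
have [iY _] := small _ _ _ K10 mY (UIY _ _ K10 HK1).
have iX n : P.-integrable setT (EFin \o X n) by have [] := small _ _ _ K10 (mX n) (HK1 n).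
suff -> : c = (\int[P]_x Y x)%R by rewrite fineK//; exact: integrable_fin_num.
apply/esym/eqP; rewrite -subr_eq0 -normr_le0; apply/ler_addgt0Pr => e e0; rewrite add0r.
have e3 : (0 < e / 3)%R by rewrite divr_gt0.
have [K [K0 HK]] := UI' _ e3.
have [_ SY] := small _ _ _ K0 mY (UIY _ _ K0 HK).
have : (\int[P]_x clamp K (X n x))%R @[n --> \oo] --> (\int[P]_x clamp K (Y x))%R.
  apply: fine_cvg; rewrite fineK; last by apply: integrable_fin_num => //; exact: iclamp.
  have [|||||_ _ //] := @dominated_convergence _ _ _ P setT measurableT
    (fun n x => (clamp K (X n x))%:E) (fun x => (clamp K (Y x))%:E) (fun=> K%:E).
  - by move=> n; apply/measurable_EFinP; exact: measurable_clamp.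
  - by apply/measurable_EFinP; exact: measurable_clamp.
  - apply: aeW => x _; apply: cvg_EFin; first exact: nearW.
    by apply: continuous_cvg; [exact: clamp_continuous|exact: XY].
  - exact: integrable_cst.
  - by apply: aeW => x n _; rewrite lee_fin clamp_bound.
move=> /cvgrPdist_le/(_ _ e3)[N _ /(_ N (leqnn N))] SN.
have [_ SX] := small _ _ _ K0 (mX N) (HK N).
have EXN : (\int[P]_x X N x)%R = c by rewrite /Rintegral EX.
rewrite EXN in SX.
move: SY SN SX; rewrite !ler_norml => /andP[? ?] /andP[? ?] /andP[? ?]; lra.
Qed.

End convergence_of_expectations.

(** * Measurability *)

Section lattice_approximation.
Context {R : realType} {d : nat}.
Implicit Types (N : nat) (x : 'rV[R]_d).

Definition lattice_cell N x : 'rV[int]_d := \row_i Num.floor (N.+1%:R * x 0 i).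
Definition lattice_point N (z : 'rV[int]_d) : 'rV[R]_d := \row_i ((z 0 i)%:~R / N.+1%:R).

Lemma lattice_approximation (x : 'rV[R]_d) : lattice_point N (lattice_cell N x) @[N --> \oo] --> x.
Proof.
apply/cvg_ballP => e e0; near=> N; split=> // i j; rewrite ord1 !mxE.
have N0 : (0 : R) < N.+1%:R by rewrite ltr0n.
have /andP[lo hi] := floor_itv (N.+1%:R * x 0 j).
rewrite /ball/=; rewrite -[X in `|X - _|](mulfK (lt0r_neq0 N0)) -mulrBl.
rewrite normrM [`|_^-1|]gtr0_norm ?invr_gt0// ltr_pdivrMr//.
apply: (@le_lt_trans _ _ 1).
  rewrite ler_norml; move: lo hi; rewrite intrD [_ * x 0 j]mulrC; lra.
have : e^-1 < N.+1%:R by rewrite -natr1 ltr_wpDr//; near: N; exact: nbhs_infty_gtr.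
by rewrite -(ltr_pM2l e0) divff// lt0r_neq0.
Unshelve. all: by end_near. Qed.

Lemma measurable_lattice_cell (disp : measure_display) (T : measurableType disp)
    (X : T -> 'rV[R]_d) N z : (forall i, measurable_fun setT (fun y => X y 0 i)) ->
  measurable [set y | lattice_cell N (X y) = z].
Proof.
move=> mX; rewrite (_ : [set _ | _] = \bigcap_(i in [set: 'I_d])
    ((fun y => N.+1%:R * X y 0 i) @^-1` `[(z 0 i)%:~R, (z 0 i + 1)%:~R[)).
  apply: fin_bigcap_measurable => [|i _]; first exact: finite_finset.
  rewrite -[_ @^-1` _]setTI; have : measurable_fun setT (fun y => N.+1%:R * X y 0 i).
    exact: measurable_funM.
  exact.
apply/seteqP; split => y /=.
  by move=> <- i _; rewrite /= in_itv/= !mxE floor_itv.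
move=> H; apply/rowP => i; rewrite !mxE; apply/floor_def.
by have := H i I; rewrite /= in_itv.
Qed.

(** Measurability is given coordinatewise, and [F] is continuous. Rounding to the lattice of mesh 1
    / (N + 1) makes the composite take countably many values, each on measurable sets, and it tends
    pointwise to the original. *)
Lemma measurable_continuous_rows (disp : measure_display) (T : measurableType disp)
    (X Y : T -> 'rV[R]_d) (F : 'rV[R]_d * 'rV[R]_d -> R) :
  (forall i, measurable_fun setT (fun y => X y 0 i)) ->
  (forall i, measurable_fun setT (fun y => Y y 0 i)) ->
  continuous F -> measurable_fun setT (fun y => F (X y, Y y)).
Proof.
move=> mX mY cF.
pose G N y := F (lattice_point N (lattice_cell N (X y)), lattice_point N (lattice_cell N (Y y))).
apply: (@measurable_fun_cvg _ _ _ _ G) => [N _ B mB|y _]; last first.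
  have := @cvg_pair _ _ _ _ (nbhs (X y)) (nbhs (Y y)) _ _ _ _ _
    (@lattice_approximation (X y)) (@lattice_approximation (Y y)).
  by move=> H; apply: (cvg_comp _ _ (H _ _ _) (cF (X y, Y y))).
rewrite setTI (_ : _ @^-1` _ = \bigcup_(z : 'rV[int]_d * 'rV[int]_d)
  ([set y | B (F (lattice_point N z.1, lattice_point N z.2))] `&`
   ([set y | lattice_cell N (X y) = z.1] `&` [set y | lattice_cell N (Y y) = z.2]))).
  apply: countable_bigcupT_measurable => [|z]; first exact: countableP.
  apply: measurableI; last by apply: measurableI; exact: measurable_lattice_cell.
  have [H|H] := pselect (B (F (lattice_point N z.1, lattice_point N z.2))).
    by rewrite (_ : [set _ | _] = setT)//; apply/seteqP; split.
  by rewrite (_ : [set _ | _] = set0)//; apply/seteqP; split.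
apply/seteqP; split => y /=.
  by exists (lattice_cell N (X y), lattice_cell N (Y y)).
by move=> [z _ [/= H [E1 E2]]]; rewrite /G E1 E2.
Qed.

End lattice_approximation.

(** Left-endpoint Riemann sums are measurable and converge pointwise by uniform continuity. [T] is
    arbitrary so that the result applies to the structure given by the backward filtration. *)
Lemma measurable_Rintegral_continuous {R : realType} (disp : measure_display)
    (T : measurableType disp) (s t : R) (g : R -> T -> R) : s <= t ->
  (forall y, {within `[s, t], continuous (fun r => g r y)}) ->
  (forall r, s <= r <= t -> measurable_fun setT (g r)) ->
  measurable_fun setT (fun y => \int[lebesgue_measure]_(r in `[s, t]) g r y).
Proof.
move=> st cg mg.
pose u N k : R := s + k%:R * ((t - s) / N.+1%:R).
pose G N y : R := \sum_(k < N.+1) (u N k.+1 - u N k) * g (u N k) y.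
have N0 N : (0 : R) < N.+1%:R by rewrite ltr0n.
have us N : u N 0%N = s by rewrite /u mul0r addr0.
have ut N : u N N.+1 = t by rewrite /u mulrC divfK ?gt_eqF// addrC subrK.
have uS N k : u N k.+1 - u N k = (t - s) / N.+1%:R.
  by rewrite /u -natr1; ring.
have umono N k l : (k <= l)%N -> u N k <= u N l.
  by move=> kl; rewrite lerD2l ler_wpM2r ?ler_nat// divr_ge0// subr_ge0.
have urange N k : (k <= N.+1)%N -> s <= u N k <= t.
  by move=> kN; rewrite -{1}(us N) -(ut N) !umono.
apply: (@measurable_fun_cvg _ _ _ _ G) => [N|y _].
  apply: measurable_sum => k; apply: measurable_funM => //; apply: mg.
  by apply: urange; exact/ltnW/ltn_ord.
apply/cvgrPdist_le => e e0.
have th0 : 0 < e / (t - s + 1) by rewrite divr_gt0//; lra.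
have := compact_uniform_oscillation (@segment_compact R s t) (cg y) th0.
move=> H; near (0 : R)^'+ => eta.
have eta0 : 0 < eta by near: eta; exact: nbhs_right_gt.
have Heta : forall x x', s <= x <= t -> s <= x' <= t -> `|x - x'| < eta ->
    `|g x y - g x' y| <= e / (t - s + 1).
  by move=> x x' xs x's; have := near H eta; apply => //; rewrite /= in_itv.
near=> N.
have meshN : (t - s) / N.+1%:R < eta.
  have : (t - s) / eta < N.+1%:R by rewrite -natr1 ltr_wpDr//; near: N; exact: nbhs_infty_gtr.
  by rewrite !ltr_pdivrMr// mulrC.
(* By induction on the cells: the error grows in proportion to the length covered. *)
suff bound n : (n <= N.+1)%N ->
    `|\int[lebesgue_measure]_(r in `[s, u N n]) g r y -
      \sum_(k < n) (u N k.+1 - u N k) * g (u N k) y| <= e / (t - s + 1) * (u N n - s).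
  have := bound N.+1 (leqnn _); rewrite ut => Hb; apply: le_trans Hb _.
  rewrite mulrAC ler_pdivrMr ?ler_wpM2l ?(ltW e0)//; lra.
elim: n => [_|n IH nN].
  by rewrite big_ord0 us subrr mulr0 set_itv1 Rintegral_set1 subrr normr0.
have /andP[su unt] := urange N n (ltnW nN).
have /andP[_ unSt] := urange N _ nN.
have uu : u N n <= u N n.+1 by exact: umono.
have cg' : {within `[s, u N n.+1], continuous (fun r => g r y)}.
  apply: continuous_subspaceW (cg y) => r /=; rewrite !in_itv/= => /andP[-> ru].
  exact: le_trans ru unSt.
rewrite big_ord_recr/= (Rintegral_split cg' (lexx s) su uu).
have := IH (ltnW nN).
have : `|\int[lebesgue_measure]_(r in `[u N n, u N n.+1]) g r y -
    (u N n.+1 - u N n) * g (u N n) y| <= e / (t - s + 1) * (u N n.+1 - u N n).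
  apply: (Rintegral_approx (cg y) su uu unSt) => r /andP[ur ru].
  apply: Heta; rewrite ?su ?unt ?(le_trans su ur) ?(le_trans ru unSt)//.
  apply: le_lt_trans meshN; rewrite -(uS N n) ger0_norm ?subr_ge0//; lra.
rewrite !ler_norml => /andP[? ?] /andP[? ?]; lra.
Unshelve. all: by end_near. Qed.

(** * Optional stopping in a box *)

Section centered_variables.
Context {R : realType} {disp : measure_display} {Omega : measurableType disp}
  (P : probability Omega R).

Definition centered (Z : Omega -> R) : Prop :=
  P.-integrable setT (EFin \o Z) /\ (\int[P]_x (Z x)%:E = 0)%E.

Lemma centered_sum (I : finType) (Z : I -> Omega -> R) : (forall i, centered (Z i)) ->
  centered (fun x => \sum_i Z i x).
Proof.
move=> cZ; have iZ i : P.-integrable setT (EFin \o Z i) by case: (cZ i).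
have E : EFin \o (fun x => \sum_i Z i x) = (fun x => \sum_i (Z i x)%:E)%E.
  by apply/funext => x /=; rewrite sumEFin.
split; first by rewrite E; apply: integrable_sum => // i _; exact: iZ.
rewrite (_ : (fun x => _) = (fun x => \sum_i (Z i x)%:E)%E)//.
rewrite integral_sum//; rewrite big1// => i _; by case: (cZ i).
Qed.

Lemma centered_scale c (Z : Omega -> R) : centered Z -> centered (fun x => c * Z x).
Proof.
move=> [iZ Z0]; split.
  by apply: (eq_integrable measurableT) (integrableZl measurableT c iZ) => x _ /=; rewrite EFinM.
under eq_integral do rewrite EFinM.
by rewrite integralZl// Z0 mule0.
Qed.

Lemma centered_add (Y Z : Omega -> R) : centered Y -> centered Z ->
  centered (fun x => Y x + Z x).
Proof.
move=> [iY Y0] [iZ Z0]; split.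
  by apply: (eq_integrable measurableT) (integrableD measurableT iY iZ) => x _ /=; rewrite EFinD.
under eq_integral do rewrite EFinD.
by rewrite integralD// Y0 Z0 adde0.
Qed.

End centered_variables.

Section backward_process.
Context {R : realType} {d : nat} {disp : measure_display}
  {Omega : measurableType disp} (P : probability Omega R).
Notation V := 'rV[R]_d.
Variables (m tau sg kappa ti t : R) (U : R -> V -> R) (h : R -> V -> V -> R)
  (w qs ps : R -> Omega -> V) (q0 p0 : V).
Hypothesis hw : wiener_process P ti w.
Hypotheses (hreg : twice_differentiable ti h) (hcont : jointly_continuous_on `[ti, +oo[ h)
  (hpde : backward_equation_on m tau sg kappa ti U h).
Hypothesis cU : forall i, jointly_continuous_on `[ti, +oo[
  (fun t q p => grad (U t) q 0 i).
Hypotheses (adapted_q : backward_adapted ti t w qs) (adapted_p : backward_adapted ti t w ps).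
Hypotheses (cont_q : forall omega, {within `[ti, t], continuous (fun s => qs s omega)})
  (cont_p : forall omega, {within `[ti, t], continuous (fun s => ps s omega)}).
Hypothesis path_ae : {ae P, forall omega,
  backward_path m tau sg ti U t q0 p0 (w ^~ omega) (qs ^~ omega) (ps ^~ omega)}.
Hypotheses (sg0 : 0 <= sg) (kappa0 : 0 <= kappa).

Lemma adapted_coordinate (X : R -> Omega -> V) s r i : backward_adapted ti t w X ->
  ti <= s -> s <= r -> r <= t -> filtration_measurable w t s (fun omega => X r omega 0 i).
Proof.
move=> aX tis sr rt; apply/filtration_measurable_preimage => B mB.
by apply: (backward_filtrationS sr); apply: aX => //; exact: le_trans sr.
Qed.

Lemma jointly_continuous_slice (A : set R) (F : R -> V -> V -> R) r :
  jointly_continuous_on A F -> A r -> continuous (fun x : V * V => F r x.1 x.2).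
Proof.
move=> /subspace_continuousP cF Ar x.
have := cF (r, x) Ar; rewrite /=.
move=> H; apply: (cvg_comp (fun y : V * V => (r, y)) (fun z => F z.1 z.2.1 z.2.2)) H.
move=> W HW; have : nbhs x [set y | A (r, y).1 -> W (r, y)].
  have : (fun y : V * V => (r, y)) @ x --> (r, x).
    by apply: (cvg_pair (G := nbhs r) (H := nbhs x)); [exact: cvg_cst|exact: cvg_id].
  by move=> /(_ _ HW).
by apply: filterS => y; apply.
Qed.

Lemma adapted_path_function (A : set R) (F : R -> V -> V -> R) s r :
  jointly_continuous_on A F -> A r -> ti <= s -> s <= r -> r <= t ->
  filtration_measurable w t s (fun omega => F r (qs r omega) (ps r omega)).
Proof.
move=> cF Ar tis sr rt.
apply: (@measurable_continuous_rows R d _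
  (g_sigma_algebraType (backward_increment_events w t s)) (qs r) (ps r)
  (fun x => F r x.1 x.2)).
- by move=> i; exact: adapted_coordinate.
- by move=> i; exact: adapted_coordinate.
- exact: jointly_continuous_slice cF Ar.
Qed.

Lemma adapted_work s : ti <= s -> s <= t ->
  filtration_measurable w t s (fun omega => work U t (qs ^~ omega) (ps ^~ omega) s).
Proof.
move=> tis st; apply: (@measurable_Rintegral_continuous R _
  (g_sigma_algebraType (backward_increment_events w t s)) s t
  (fun r omega => power U r (qs r omega) (ps r omega)) st) => [omega|r /andP[sr rt]].
  have := continuous_along_path (@cont_q omega) (@cont_p omega) (continuous_power cU).
  apply: continuous_subspaceW => r /=; rewrite !in_itv/= => /andP[sr ->].
  by rewrite (le_trans tis sr).
apply: (adapted_path_function (continuous_power cU)) => //=.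
by rewrite in_itv/= (le_trans tis sr).
Qed.

Lemma adapted_weighted_path s : ti <= s -> s <= t ->
  filtration_measurable w t s (fun omega => weighted_path kappa U h t (qs ^~ omega) (ps ^~ omega) s).
Proof.
move=> tis st; apply: measurable_funM.
  apply: measurableT_comp => //; apply: measurable_funM => //.
  exact: adapted_work.
by apply: (adapted_path_function hcont) => //=; rewrite in_itv/= andbT.
Qed.

Lemma adapted_stopping (sigma : Omega -> R) s (Y : Omega -> R) :
  backward_stopping_time ti t w sigma -> ti <= s -> s <= t -> filtration_measurable w t s Y ->
  filtration_measurable w t s (fun omega => if sigma omega < s then Y omega else 0).
Proof.
move=> [_ st] tis s_t mY; apply: measurable_fun_ifT => //.
apply: (measurable_fun_bool true); rewrite setTI.
rewrite (_ : _ @^-1` _ = ~` [set omega | s <= sigma omega]).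
  by apply: measurableC; exact: st.
by apply/seteqP; split => omega /=; rewrite leNgt; case: (sigma omega < s).
Qed.

Lemma measurable_stopping (sigma : Omega -> R) s (Y : Omega -> R) :
  backward_stopping_time ti t w sigma -> ti <= s -> s <= t -> measurable_fun setT Y ->
  measurable_fun setT (fun omega => if sigma omega < s then Y omega else 0).
Proof.
move=> [_ st] tis s_t mY; apply: measurable_fun_ifT => //.
apply: (measurable_fun_bool true); rewrite setTI.
rewrite (_ : _ @^-1` _ = ~` [set omega | s <= sigma omega]).
  by apply: measurableC; apply: (backward_filtration_measurable hw tis s_t); exact: st.
by apply/seteqP; split => omega /=; rewrite leNgt; case: (sigma omega < s).
Qed.

Lemma measurable_weighted_path s : ti <= s -> s <= t ->
  measurable_fun setT (fun omega => weighted_path kappa U h t (qs ^~ omega) (ps ^~ omega) s).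
Proof.
by move=> tis st; exact: (filtration_measurable_fun hw tis st (adapted_weighted_path tis st)).
Qed.

Lemma within_continuous_sequence (A : set R) (f : R -> R) (u : nat -> R) (x : R) :
  {within A, continuous f} -> (forall N, A (u N)) -> A x -> u N @[N --> \oo] --> x ->
  f (u N) @[N --> \oo] --> f x.
Proof.
move=> /subspace_continuousP cf Au Ax ux; apply: (cvg_comp u f) (cf x Ax).
move=> W HW; have : (fun N => u N) @ \oo `=>` nbhs x := ux.
move=> /(_ _ HW); rewrite /nbhs/=; apply: filterS => N; apply; exact: Au.
Qed.

Lemma continuous_weighted_path omega : ti <= t ->
  {within `[ti, t], continuous (weighted_path kappa U h t (qs ^~ omega) (ps ^~ omega))}.
Proof.
move=> tit.
have cpow := continuous_along_path (@cont_q omega) (@cont_p omega) (continuous_power cU).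
have ch := continuous_along_path (@cont_q omega) (@cont_p omega) hcont.
have ipow := integrable_subsegment cpow (lexx ti) (lexx t).
have cI := parameterized_integral_continuous tit ipow.
(* Passing to the integral from [ti] turns [s] into an upper limit of integration, where continuity
   of the integral is available. *)
have workE s : `[ti, t]%classic s -> work U t (qs ^~ omega) (ps ^~ omega) s =
    work U t (qs ^~ omega) (ps ^~ omega) ti -
    parameterized_integral lebesgue_measure ti s (fun r => power U r (qs r omega) (ps r omega)).
  rewrite /= in_itv/= => /andP[tis st].
  by rewrite /work (Rintegral_split cpow (lexx ti) tis st) [RHS]addrAC subrr add0r.
have cw : {within `[ti, t], continuous (work U t (qs ^~ omega) (ps ^~ omega))}.
  apply: (@subspace_eq_continuous _ _ _ (fun s => work U t (qs ^~ omega) (ps ^~ omega) ti -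
      parameterized_integral lebesgue_measure ti s (fun r => power U r (qs r omega) (ps r omega)))).
    by move=> s; rewrite inE => /workE E; exact/esym/E.
  by move=> s; apply: cvgB; [exact: cvg_cst|exact: cI].
move=> s; apply: cvgM; last exact: ch.
apply: continuous_cvg; first exact: continuous_expR.
by apply: cvgM; [exact: cvg_cst|exact: cw].
Qed.

Notation M := (fun s omega => weighted_path kappa U h t (qs ^~ omega) (ps ^~ omega) s).

Lemma terminal_value_ae : ti <= t -> {ae P, forall omega, M t omega = h t q0 p0}.
Proof.
move=> tit; apply: filterS path_ae => omega [_ _ eqn].
rewrite /weighted_path /work set_itv1 Rintegral_set1 mulr0 expR0 mul1r.
have E i := eqn t i tit (lexx t).
congr (h t _ _); apply/rowP => i; have [Eq Ep] := E i.
  by rewrite Eq set_itv1 Rintegral_set1 subr0.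
by rewrite Ep set_itv1 Rintegral_set1 subrr !mxE mulr0 !subr0.
Qed.

Section stopped_path.
Variables (a n : R) (sigma : Omega -> R).
Hypotheses (tia : ti < a) (a_t : a < t) (stop : backward_stopping_time ti t w sigma)
  (a_sigma : forall omega, a <= sigma omega)
  (in_box : forall omega r, sigma omega < r <= t ->
     phase_box a t n (r, (qs r omega, ps r omega))).

Lemma stopped_weight_bound (B : R) (F : R -> V -> V -> R) s omega :
  (forall z, phase_box a t n z -> `|power U z.1 z.2.1 z.2.2| <= B) ->
  (forall z, phase_box a t n z -> `|F z.1 z.2.1 z.2.2| <= B) ->
  sigma omega < s -> s <= t ->
  `|expR (- kappa * work U t (qs ^~ omega) (ps ^~ omega) s) * F s (qs s omega) (ps s omega)|
    <= expR (kappa * (B * (t - a))) * B.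
Proof.
move=> powB FB sig_s st; have as_ : a <= s by rewrite (le_trans (a_sigma omega))// ltW.
have K r : s <= r -> r <= t -> phase_box a t n (r, (qs r omega, ps r omega)).
  by move=> sr rt; apply: in_box; rewrite rt (lt_le_trans sig_s).
have B0 : 0 <= B by rewrite (le_trans _ (FB _ (K s (lexx s) st))).
rewrite normrM ger0_norm ?expR_ge0// ler_pM ?expR_ge0//; last exact: (FB _ (K s (lexx s) st)).
have B_work : `|work U t (qs ^~ omega) (ps ^~ omega) s| <= B * (t - s).
  have cpow := continuous_along_path (@cont_q omega) (@cont_p omega) (continuous_power cU).
  apply: (Rintegral_bound cpow) => // [|r /andP[sr rt]]; first by rewrite (le_trans (ltW tia)).
  exact: (powB _ (K r sr rt)).
rewrite ler_expR mulNr -mulrN ler_wpM2l// -lerN2 opprK.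
apply: le_trans (lerNnormlW B_work); rewrite lerN2 ler_wpM2l//; lra.
Qed.

(** Abstracts over the noise factor [Z], linear or quadratic in the increment. The indicator and the
    weight belong to the coefficient, which is bounded and measurable for the filtration at [s]. *)
Lemma stopped_coefficient_centered (F : R -> V -> V -> R) (B s s' : R) (Z : Omega -> R) :
  jointly_continuous_on `]ti, +oo[ F ->
  (forall z, phase_box a t n z -> `|power U z.1 z.2.1 z.2.2| <= B) ->
  (forall z, phase_box a t n z -> `|F z.1 z.2.1 z.2.2| <= B) -> a <= s' -> s' < s -> s <= t ->
  (forall Y (c : R), filtration_measurable w t s Y -> (forall omega, `|Y omega| <= c) ->
     centered P (fun omega => Y omega * Z omega)) ->
  centered P (fun omega => (if sigma omega < s then
    expR (- kappa * work U t (qs ^~ omega) (ps ^~ omega) s) * F s (qs s omega) (ps s omega)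
    else 0) * Z omega).
Proof.
move=> cF powB FB as' s's st HZ.
(* The absolute value of [B] is taken because, off the event [sigma omega < s], the coefficient is 0
   and no point of the box is at hand to force [B] to be nonnegative. *)
apply: (HZ _ (expR (kappa * (B * (t - a))) * `|B|)) => [|omega].
  have tis : ti < s by rewrite (lt_trans tia)// (le_lt_trans as').
  apply: (adapted_stopping stop) => //; first exact: ltW.
  apply: measurable_funM.
    apply: measurableT_comp => //; apply: measurable_funM => //.
    by apply: adapted_work => //; exact: ltW.
  by apply: (adapted_path_function cF) => //=; [rewrite in_itv/= andbT|exact: ltW].
have [sig_s|_] := boolP (sigma omega < s); last by rewrite normr0 mulr_ge0// expR_ge0.
apply: le_trans (stopped_weight_bound powB FB sig_s st) _.
by rewrite ler_wpM2l ?expR_ge0// ler_norm.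
Qed.

Lemma stopped_noise_centered N :
  centered P (fun omega => stopped_noise sg kappa U h t (w ^~ omega) (qs ^~ omega) (ps ^~ omega)
    (sigma omega) (mesh a t N) N.+1).
Proof.
have [M [_ HM]] := coefficients_bounded m tau hreg cU t n tia.
pose B := `|M| + 1.
have B0 : 0 <= B by rewrite addr_ge0.
have [_ [_ [_ [pB [ppB [_ [_ powB]]]]]]] := HM B (ltr_pwDr ltr01 (ler_norm M)).
set delta := mesh a t N.
have d0 : 0 < delta by rewrite divr_gt0// subr_gt0.
rewrite /stopped_noise; apply: centered_sum => k.
set s := grid t delta k; set s' := grid t delta k.+1.
have s's : s' < s by rewrite -subr_gt0 gridB.
have /andP[as' _] : a <= s' <= t by apply: grid_itv (ltW d0) (meshE a t N) _; exact: ltn_ord.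
have /andP[_ st] : a <= s <= t by apply: grid_itv (ltW d0) (meshE a t N) _; exact/ltnW/ltn_ord.
pose Y F omega := if sigma omega < s then
  expR (- kappa * work U t (qs ^~ omega) (ps ^~ omega) s) * F s (qs s omega) (ps s omega) else 0.
pose dw i omega : R := increment w s' s i omega.
rewrite (_ : (fun omega => _) = (fun omega => - sg * (\sum_i Y (p_derivative h i) omega * dw i omega) +
  sg ^+ 2 * \sum_i \sum_j @taylor_weight R d i j * (Y (pp_derivative h i j) omega *
     (dw i omega * dw j omega - (i == j)%:R * (s - s'))))); last first.
  apply/funext => omega; rewrite /Y; case: (sigma omega < s).
    rewrite /path_noise /noise_term mulrDr; congr (_ + _).
      by rewrite mulrCA mulr_sumr; congr (_ * _); apply: eq_bigr => i _; rewrite mulrA.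
    rewrite mulrCA mulr_sumr; congr (_ * _); apply: eq_bigr => i _.
    rewrite mulr_sumr; apply: eq_bigr => j _; rewrite /dw /increment; ring.
  rewrite !big1 ?mulr0 ?addr0// => i _; last by rewrite mul0r.
  by rewrite big1// => j _; rewrite mul0r mulr0.
have tis' : ti <= s' by rewrite (le_trans (ltW tia)).
apply: centered_add; apply: centered_scale; apply: centered_sum => i.
  apply: (stopped_coefficient_centered (F := p_derivative h i) (Z := dw i)
    (@td_continuous_p _ _ _ _ hreg i) powB (pB i) as' s's st).
  by move=> Y' c FY Yc; exact: (martingale_linear_term hw i tis' s's st FY Yc).
apply: centered_sum => j; apply: centered_scale.
apply: (stopped_coefficient_centered (F := pp_derivative h i j)
  (Z := fun omega => dw i omega * dw j omega - (i == j)%:R * (s - s'))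
  (@td_continuous_pp _ _ _ _ hreg i j) powB (ppB i j) as' s's st).
by move=> Y' c FY Yc; exact: (martingale_quadratic_term hw i j tis' s's st FY Yc).
Qed.

Notation noise := (fun N omega => stopped_noise sg kappa U h t (w ^~ omega) (qs ^~ omega)
  (ps ^~ omega) (sigma omega) (mesh a t N) N.+1).
Notation increments := (fun N omega => stopped_increments kappa U h t (qs ^~ omega)
  (ps ^~ omega) (sigma omega) (mesh a t N) N.+1).
Notation squares := (fun N omega => squared_increments t (w ^~ omega) (mesh a t N) N.+1).

Lemma measurable_squared_increments N : measurable_fun setT (squares N).
Proof.
rewrite /squared_increments; apply: measurable_sum => k; apply: measurable_sum => i.
have gt k' : (k' <= N.+1)%N -> ti <= grid t (mesh a t N) k'.
  move=> kN; have /andP[+ _] := grid_itv (mesh_ge0 N (ltW a_t)) (meshE a t N) kN.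
  exact: le_trans (ltW tia).
by apply: measurable_funX; apply: (measurable_increment hw); apply: gt; [|apply: ltnW].
Qed.

Lemma measurable_stopped_increments N : measurable_fun setT (increments N).
Proof.
rewrite /stopped_increments; apply: measurable_sum => k.
have d0 := mesh_ge0 N (ltW a_t).
have /andP[as' s't] : a <= grid t (mesh a t N) k.+1 <= t.
  by apply: grid_itv d0 (meshE a t N) _; exact: ltn_ord.
have /andP[as_ st] : a <= grid t (mesh a t N) k <= t.
  by apply: grid_itv d0 (meshE a t N) _; exact/ltnW/ltn_ord.
have tis' : ti <= grid t (mesh a t N) k.+1 by rewrite ltW// (lt_le_trans tia).
apply: (measurable_stopping stop) => //.
by apply: measurable_funB; apply: measurable_weighted_path => //; rewrite ltW// (lt_le_trans tia).
Qed.

(** Cauchy-Schwarz over (N + 1) d terms, with fourth moments at most 3 delta^2, gives 3 ((N + 1) d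
    delta)^2; since (N + 1) delta = t - a, the bound is free of [N]. *)
Lemma squared_increments_second_moment N :
  (\int[P]_omega ((squares N omega) ^+ 2)%:E <= (3 * d%:R ^+ 2 * (t - a) ^+ 2)%:E)%E.
Proof.
set delta := mesh a t N.
have d0 : 0 < delta by rewrite divr_gt0// subr_gt0.
pose dw (z : 'I_N.+1 * 'I_d) omega :=
  increment w (grid t delta z.1.+1) (grid t delta z.1) z.2 omega.
have E omega : squares N omega = \sum_z dw z omega ^+ 2.
  by rewrite /squared_increments pair_bigA.
have gN (k : 'I_N.+1) : ti <= grid t delta k.+1.
  have /andP[ak _] : a <= grid t delta k.+1 <= t.
    by apply: grid_itv (ltW d0) (meshE a t N) _; exact: ltn_ord.
  by rewrite (le_trans (ltW tia)).
have gS (k : 'I_N.+1) : grid t delta k.+1 < grid t delta k by rewrite -subr_gt0 gridB.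
have m4 z : measurable_fun setT (fun omega => (dw z omega ^+ 4)%:E).
  apply/measurable_EFinP/measurable_funX; apply: (measurable_increment hw) => //.
  exact: le_trans (ltW (gS _)).
have e4 (x : R) : x ^+ 4 = (x ^+ 2) ^+ 2 by rewrite -exprM.
apply: (@le_trans _ _ (\int[P]_omega ((N.+1%:R * d%:R)%:E * \sum_z (dw z omega ^+ 4)%:E))%E).
  apply: ge0_le_integral => //.
  - by move=> omega _; rewrite lee_fin sqr_ge0.
  - by apply/measurable_EFinP/measurable_funX; exact: measurable_squared_increments.
  - by apply: emeasurable_funM => //; apply: emeasurable_sum.
  - move=> omega _; rewrite sumEFin -EFinM lee_fin E.
    apply: le_trans (sqr_sum_le _) _; rewrite card_prod !card_ord natrM.
    by rewrite le_eqVlt; apply/orP; left; apply/eqP; congr (_ * _); apply: eq_bigr => z _; rewrite e4.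
rewrite ge0_integralZl//; last first.
- by move=> omega _; rewrite sumEFin lee_fin sumr_ge0// => z _; rewrite e4 sqr_ge0.
- by apply: emeasurable_sum.
rewrite ge0_integral_sum//; last by move=> z omega _; rewrite lee_fin e4 sqr_ge0.
apply: (@le_trans _ _ ((N.+1%:R * d%:R)%:E * \sum_(z : 'I_N.+1 * 'I_d) (3 * delta ^+ 2)%:E)%E).
  apply: lee_wpmul2l; first by rewrite lee_fin mulr_ge0.
  apply: lee_sum => z _; rewrite -[delta](gridB t delta z.1).
  exact: (increment_fourth_moment hw z.2 (gN _) (gS _)).
rewrite sumEFin -EFinM lee_fin sumr_const card_prod !card_ord -[_ *+ (_ * _)%N]mulr_natl natrM.
rewrite -(meshE a t N) -/delta le_eqVlt; apply/orP; left; apply/eqP; ring.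
Qed.

Lemma stopped_increments_mean eps : 0 < eps ->
  \forall N \near \oo, (`|\int[P]_omega (increments N omega)%:E| <= eps%:E)%E.
Proof.
move=> eps0.
have [C C0 crude] := crude_partition_bound hreg hpde cU n tia (ltW a_t) sg0 kappa0.
have mD N : measurable_fun setT (fun omega => increments N omega - noise N omega).
  apply: measurable_funB; first exact: measurable_stopped_increments.
  by have [/measurable_int/measurable_EFinP] := stopped_noise_centered N.
have : {ae P, forall omega,
    (forall N, `|increments N omega - noise N omega| <= C * (1 + squares N omega)) /\
    (forall eps, 0 < eps -> \forall N \near \oo,
      `|increments N omega - noise N omega| <= eps * (1 + squares N omega))}.
  apply: filterS path_ae => omega path; split=> [N|e e0].
    exact: (crude _ _ _ _ _ path _ (a_sigma omega) (@in_box omega)).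
  apply: (fine_partition_bound hreg hpde cU tia (ltW a_t) sg0 kappa0 path) (@in_box omega) _ _ => //.
  apply: continuous_subspaceW (@wiener_continuous _ _ _ _ _ _ _ hw omega) => r /=.
  by rewrite !in_itv/= andbT => /andP[].
move=> ae_bound.
have Q0 N omega : 0 <= squares N omega.
  by apply: sumr_ge0 => k _; apply: sumr_ge0 => i _; exact: sqr_ge0.
have C'0 : 0 <= 3 * d%:R ^+ 2 * (t - a) ^+ 2 by nneg.
have := integral_abs_vanishing C0 C'0 mD measurable_squared_increments Q0 ae_bound
  squared_increments_second_moment eps0.
apply: filterS => N HN; have [iN N0] := stopped_noise_centered N.
have iD : P.-integrable setT (EFin \o (fun omega => increments N omega - noise N omega)).
  apply/integrableP; split; first exact/measurable_EFinP.
  exact: le_lt_trans HN (ltry _).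
(* Adding back the noise leaves the expectation unchanged, as it is centred. *)
under eq_integral => omega _ do
  rewrite -[stopped_increments _ _ _ _ _ _ _ _ _](subrK (noise N omega)) EFinD.
rewrite integralD// N0 adde0; apply: le_trans HN.
by apply: le_abse_integral => //; exact/measurable_EFinP.
Qed.

Lemma stopped_increments_cvg omega :
  increments N omega @[N --> \oo] --> M (sigma omega) omega - M t omega.
Proof.
have sig_t : sigma omega <= t by case: stop => /(_ omega)/andP[].
have H N := stopped_increments_end kappa U h (qs ^~ omega) (ps ^~ omega) N
  (ltW a_t) (a_sigma omega) sig_t.
have [r Hr] := choice H.
rewrite (_ : (fun N => _) = (fun N => M (r N) omega - M t omega)); last first.
  by apply/funext => N; have [_ _ _ ->] := Hr N.
apply: cvgB; last exact: cvg_cst.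
have tis : ti <= sigma omega by rewrite (le_trans (ltW tia)).
have tit : ti <= t by rewrite ltW// (lt_trans tia).
apply: (within_continuous_sequence (@continuous_weighted_path omega tit)).
- move=> N; have [/andP[sr rt] _ _ _] := Hr N.
  by rewrite /= in_itv/= (le_trans tis sr).
- by rewrite /= in_itv/= tis.
- apply/cvgrPdist_lt => e e0; near=> N.
  have [/andP[sr _] rm _ _] := Hr N.
  have : mesh a t N < e by near: N; exact: mesh_lt.
  by rewrite ler0_norm; lra.
Unshelve. all: by end_near. Qed.

(** The end point [r] lies above sigma, hence in the box, unless it is [t], and then the sum is 0.
    This is the domination for [stopped_value_mean]. *)
Lemma stopped_increments_bounded : exists c, forall N omega, `|increments N omega| <= c.
Proof.
have [B0 [_ HB]] := coefficients_bounded m tau hreg cU t n tia.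
pose B := `|B0| + 1.
have Bge0 : 0 <= B by rewrite addr_ge0.
have [hB [_ [_ [_ [_ [_ [_ powB]]]]]]] := HB B (ltr_pwDr ltr01 (ler_norm B0)).
exists (2 * (expR (kappa * (B * (t - a))) * B)) => N omega.
have sig_t : sigma omega <= t by case: stop => /(_ omega)/andP[].
have [r [/andP[sr rt] _ rE ->]] := stopped_increments_end kappa U h (qs ^~ omega) (ps ^~ omega) N
  (ltW a_t) (a_sigma omega) sig_t.
case: rE => [->|sig_r]; first by rewrite subrr normr0 mulr_ge0// mulr_ge0// expR_ge0.
apply: le_trans (ler_normB _ _) _; rewrite mulr2n mulrDl mul1r lerD//.
  exact: (stopped_weight_bound powB hB sig_r rt).
by apply: (stopped_weight_bound powB hB _ (lexx t)); exact: lt_le_trans rt.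
Qed.

(** [M] is evaluated at a random time; measurability is inherited from the stopped increments, which
    converge at every omega. *)
Lemma measurable_stopped_value : measurable_fun setT (fun omega => M (sigma omega) omega).
Proof.
have mt : measurable_fun setT (M t).
  by apply: measurable_weighted_path => //; exact/ltW/(lt_trans tia).
rewrite (_ : (fun omega => _) = (fun omega => (M (sigma omega) omega - M t omega) + M t omega)).
  apply: measurable_funD => //; apply: (measurable_fun_cvg measurable_stopped_increments).
  by move=> omega _; exact: stopped_increments_cvg.
by apply/funext => omega; rewrite subrK.
Qed.

Lemma stopped_value_mean : (\int[P]_omega (M (sigma omega) omega)%:E = (h t q0 p0)%:E)%E.
Proof.
have [c Sc] := stopped_increments_bounded.
have mS := measurable_stopped_value.
have mt : measurable_fun setT (M t).
  by apply: measurable_weighted_path => //; exact/ltW/(lt_trans tia).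
have mD : measurable_fun setT (fun omega => (M (sigma omega) omega - M t omega)%:E).
  by apply/measurable_EFinP; exact: measurable_funB.
have cvg_ae : {ae P, forall omega, setT omega ->
    (increments N omega)%:E @[N --> \oo] --> (M (sigma omega) omega - M t omega)%:E}.
  apply: aeW => omega _; apply: cvg_EFin; first exact: nearW.
  exact: stopped_increments_cvg.
have bound_ae : {ae P, forall omega (N : nat), setT omega ->
    (`|(increments N omega)%:E| <= c%:E)%E} by apply: aeW => omega N _; exact: Sc.
have [iD _ cvgS] := dominated_convergence measurableT
  (fun N => (measurable_EFinP _ _).2 (measurable_stopped_increments N)) mD cvg_ae
  (integrable_cst P c) bound_ae.
have D0 : (\int[P]_omega (M (sigma omega) omega - M t omega)%:E = 0)%E.
  have fD : (\int[P]_omega (M (sigma omega) omega - M t omega)%:E)%E \is a fin_num.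
    exact: integrable_fin_num.
  rewrite -(fineK fD); congr (_%:E); apply/eqP; rewrite -normr_le0.
  apply/ler_addgt0Pr => e e0; rewrite add0r.
  have eps0 : 0 < e / 2 by rewrite divr_gt0.
  move: cvgS; rewrite -(fineK fD) => /fine_cvgP[_ /cvgrPdist_le/(_ _ eps0)].
  move=> H; near \oo => N.
  have : `|fine (\int[P]_omega (M (sigma omega) omega - M t omega)%:E)%E
    - fine (\int[P]_omega (increments N omega)%:E)%E| <= e / 2 by near: N.
  have : (`|\int[P]_omega (increments N omega)%:E| <= (e / 2)%:E)%E.
    by near: N; exact: stopped_increments_mean.
  case: (\int[P]_omega (increments N omega)%:E)%E => [r|//|//] /=; rewrite lee_fin.
  rewrite !ler_norml => /andP[? ?] /andP[? ?]; lra.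
rewrite (ae_eq_integral (fun omega => (M (sigma omega) omega - M t omega)%:E + (h t q0 p0)%:E)%E)//.
- rewrite integralD//; last exact: integrable_cst.
  by rewrite D0 add0e integral_cst_probability.
- by apply/measurable_EFinP.
- by apply: emeasurable_funD.
- apply: filterS (terminal_value_ae (ltW (lt_trans tia a_t))) => omega E _.
  by rewrite -EFinD -E subrK.
Unshelve. all: by end_near. Qed.

End stopped_path.

(** * First exit from a box *)

Definition radius (_ : R) (q p : V) : R := Num.max `|q| `|p|.

Lemma continuous_radius (A : set R) : jointly_continuous_on A radius.
Proof.
apply: continuous_subspaceT => z; rewrite /radius.
apply: (@continuous_max R _ (fun z : R * (V * V) => `|z.2.1|) (fun z => `|z.2.2|)).
  apply: continuous_comp; last exact: norm_continuous.
  by apply: (@continuous_comp _ _ _ snd fst); [exact: cvg_snd|exact: cvg_fst].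
apply: continuous_comp; last exact: norm_continuous.
by apply: (@continuous_comp _ _ _ snd snd); exact: cvg_snd.
Qed.

Lemma coordinate_lt_norm (x : V) c i : `|x| < c -> `|x 0 i| < c.
Proof.
move=> xc; have : ball (0 : V) c x by rewrite mx_norm_ball /ball_/= sub0r normrN.
by move=> [_ /(_ 0 i)]; rewrite /ball/= mxE sub0r normrN.
Qed.

Notation size_at := (fun r omega => radius r (qs r omega) (ps r omega)).

(* Time runs down from t, so the first exit from the box is a supremum; a is added
   to keep the set nonempty. *)
Definition exit_times (a n : R) (omega : Omega) : set R :=
  [set s | s = a \/ (a <= s <= t /\ n <= size_at s omega)].

Definition exit_time (a n : R) (omega : Omega) : R := sup (exit_times a n omega).

Lemma continuous_size omega : {within `[ti, t], continuous (fun r => size_at r omega)}.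
Proof.
exact: continuous_along_path (@cont_q omega) (@cont_p omega) (@continuous_radius _).
Qed.

Section first_exit.
Variables (a n : R).
Hypotheses (tia : ti < a) (a_t : a < t).

Lemma exit_times_has_ub omega : has_ubound (exit_times a n omega).
Proof. by exists t => s [->|[/andP[]]//]; exact: ltW. Qed.

Lemma exit_time_ge omega s : exit_times a n omega s -> s <= exit_time a n omega.
Proof. exact/ub_le_sup/exit_times_has_ub. Qed.

Lemma exit_time_itv omega : a <= exit_time a n omega <= t.
Proof.
rewrite exit_time_ge/=; last by left.
apply: ge_sup; first by exists a; left.
by move=> s [->|[/andP[]]//]; exact: ltW.
Qed.

Lemma before_exit omega r : exit_time a n omega < r <= t ->
  phase_box a t n (r, (qs r omega, ps r omega)).
Proof.
move=> /andP[er rt]; have /andP[ae _] := exit_time_itv omega.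
have ar : a <= r by rewrite (le_trans ae)// ltW.
have : size_at r omega < n.
  rewrite ltNge; apply/negP => nr; have := @exit_time_ge omega r _.
  by rewrite leNgt er => H; have := H (or_intror _); rewrite ar rt nr => /(_ (conj isT isT)).
rewrite /radius gt_max => /andP[qn pn]; split; first by rewrite /= in_itv/= ar.
by split => i; apply/ltW; exact: coordinate_lt_norm.
Qed.

(** By continuity a supremum above [a] is itself a time at which the size is at least [n]. The
    strict inequality [a < s] excludes the element [a] that was added by hand. *)
Lemma exit_time_geP omega s : a < s -> s <= t ->
  s <= exit_time a n omega <-> exists2 r, s <= r <= t & n <= size_at r omega.
Proof.
move=> as_ st; split => [sE|[r /andP[sr rt] nr]]; last first.
  apply: (le_trans sr); apply: exit_time_ge; right.
  by rewrite rt nr (le_trans (ltW as_) sr).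
have [u Eu us] : exists2 u : R^nat, forall N, exit_times a n omega (u N) & u N @[N --> \oo] --> exit_time a n omega.
  have sup_cond N : exists x, exit_times a n omega x /\ exit_time a n omega - N.+1%:R^-1 < x.
    have N0 : 0 < (N.+1%:R^-1 : R) by rewrite invr_gt0.
    have [|x Ex xs] := @sup_adherent _ (exit_times a n omega) _ N0; last by exists x.
    by split; [exists a; left|exact: exit_times_has_ub].
  have [u Hu] := choice sup_cond; exists u => [N|]; first by case: (Hu N).
  apply/cvgrPdist_lt => e e0; near=> N; have [EN uN] := Hu N.
  have uE := exit_time_ge EN; rewrite ger0_norm ?subr_ge0//.
  have Ne : N.+1%:R^-1 < e by near: N; exact: (near_infty_natSinv_lt (PosNum e0)).
  by apply: lt_trans Ne; rewrite ltrBlDr -ltrBlDl.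
exists (exit_time a n omega); first by rewrite sE; have /andP[] := exit_time_itv omega.
have aE : a < exit_time a n omega by exact: lt_le_trans sE.
have tu N : `[ti, t]%classic (u N).
  rewrite /= in_itv/=; have [->|[/andP[au ->] _]] := Eu N; first by rewrite !ltW.
  by rewrite (le_trans (ltW tia) au).
have tE : `[ti, t]%classic (exit_time a n omega).
  have /andP[aE' Et] := exit_time_itv omega.
  by rewrite /= in_itv/= Et (le_trans (ltW tia) aE').
have cG := within_continuous_sequence (@continuous_size omega) tu tE us.
apply: (cvgr_to_ge cG); near=> N.
have [uNa|[_ //]] := Eu N.
have : a < u N by near: N; exact: cvgr_gt us _ aE.
by rewrite uNa ltxx.
Unshelve. all: by end_near. Qed.

(** By [exit_time_geP] the event says that the size reaches [n] somewhere on [s, t]. Continuity lets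
    rational times detect values above n - 1 / (N + 1) for every N, and compactness turns these near
    hits into an attained maximum of at least [n]. So the event is a countable combination of events
    known at [s]; for s <= a it is the whole space. *)
Lemma exit_time_stopping : backward_stopping_time ti t w (exit_time a n).
Proof.
split => [omega|s tis st].
  have /andP[aE ->] := exit_time_itv omega.
  by rewrite (le_trans (ltW tia) aE).
have [sa|as_] := lerP s a.
  rewrite (_ : [set omega | _] = setT).
    by have := @measurableT _ (g_sigma_algebraType (backward_increment_events w t s)).
  apply/seteqP; split => omega //= _; have /andP[aE _] := exit_time_itv omega.
  exact: le_trans aE.
(* Rational times are projected onto [s, t]: [G] is then continuous on the whole line, where the
   rationals are dense, and reads the path only at times known at [s]. *)
pose c (x : R) : R := Num.max s (Num.min x t).
have cst x : s <= c x <= t.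
  by rewrite /c le_max lexx/= ge_max st ge_min lexx orbT.
have c_id x : s <= x <= t -> c x = x.
  by move=> /andP[sx xt]; rewrite /c min_l// max_r.
pose G x omega := size_at (c x) omega.
have cc : continuous c.
  move=> x; apply: (@continuous_max R _ (fun=> s) (fun x => Num.min x t)); first exact: cvg_cst.
  by apply: (@continuous_min R _ id (fun=> t)); [exact: cvg_id|exact: cvg_cst].
have cG omega : continuous (G ^~ omega).
  apply/continuous_subspace_setT.
  apply: (@within_continuous_comp _ _ _ setT `[ti, t]%classic c (fun r => size_at r omega)).
  - exact: continuous_subspaceT.
  - exact: continuous_size.
  - move=> x _; have /andP[scx cxt] := cst x.
    by rewrite /= in_itv/= cxt (le_trans tis scx).
rewrite (_ : [set omega | _] = \bigcap_(N in [set: nat]) \bigcup_(x in [set: rat])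
    (G (ratr x) @^-1` `]n - N.+1%:R^-1, +oo[)).
  apply: (@bigcapT_measurable _ (g_sigma_algebraType (backward_increment_events w t s))) => N.
  apply: countable_bigcupT_measurable => [|x]; first exact: countableP.
  apply: measurable_preimage => //.
  have /andP[scx cxt] := cst (ratr x).
  exact: (adapted_path_function (@continuous_radius setT)).
apply/seteqP; split => omega /=.
  move=> /(exit_time_geP omega as_ st)[r rst nr] N _.
  have rN : n - N.+1%:R^-1 < G r omega.
    by rewrite /G c_id//; apply: lt_le_trans nr; rewrite ltrBlDr ltrDl invr_gt0.
  have op : open [set x | n - N.+1%:R^-1 < G x omega].
    rewrite (_ : [set x | _] = G ^~ omega @^-1` [set y | n - N.+1%:R^-1 < y])//.
    by apply: open_comp => [x _|]; [exact: cG|exact: open_gt].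
  have [x [xN [y _ yx]]] := @dense_rat R _ (ex_intro _ r rN) op.
  by exists y => //=; rewrite in_itv/= andbT yx.
move=> H; apply/(exit_time_geP omega as_ st).
have cs : {within `[s, t], continuous (fun r => size_at r omega)}.
  apply: continuous_subspaceW (@continuous_size omega) => r /=; rewrite !in_itv/= => /andP[sr ->].
  by rewrite (le_trans tis sr).
have [r rst rmax] := EVT_max st cs.
exists r; first by move: rst; rewrite in_itv.
apply/ler_addgt0Pr => e e0.
have [N Ne] : exists N : nat, N.+1%:R^-1 < e.
  by near \oo => N; exists N; near: N; exact: (near_infty_natSinv_lt (PosNum e0)).
have [x _] := H N I; rewrite /= in_itv/= andbT /G => xN.
have : size_at (c (ratr x)) omega <= size_at r omega by apply: rmax; rewrite in_itv/= cst.
move=> xr; move: xN; rewrite ltrBlDr => xN; apply: (le_trans (ltW xN)).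
by apply: lerD => //; exact: ltW.
Unshelve. all: by end_near. Qed.

End first_exit.

Hypothesis UI : class_D P ti t w (fun s omega => M s omega).

(** The size of each path is bounded on [ti, t], so once [N] exceeds that bound the path stays in
    the box and the exit time equals [a N], which tends to [ti]. *)
Lemma initial_value_mean : ti <= t -> (\int[P]_omega (M ti omega)%:E = (h t q0 p0)%:E)%E.
Proof.
rewrite le_eqVlt => /predU1P[tit|tit].
  have mt : measurable_fun setT (M ti) by apply: measurable_weighted_path; rewrite ?lexx ?tit.
  rewrite (ae_eq_integral (fun=> (h t q0 p0)%:E))//.
  - exact: integral_cst_probability.
  - exact/measurable_EFinP.
  - have tit' : ti <= t by rewrite tit.
    by apply: filterS (terminal_value_ae tit') => omega + _; rewrite tit => ->.
(* [N.+2] keeps [a N] strictly below [t] already at N = 0. *)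
pose a (N : nat) : R := ti + (t - ti) / N.+2%:R.
have tit0 : 0 < t - ti by rewrite subr_gt0.
have tia N : ti < a N by rewrite ltrDl divr_gt0.
have a_t N : a N < t.
  rewrite /a -ltrBrDl ltr_pdivrMr// ltr_pMr// ltr1n//.
pose sigma N := exit_time (a N) N%:R.
have stop N : backward_stopping_time ti t w (sigma N) by exact: exit_time_stopping.
have a_sigma N omega : a N <= sigma N omega by have /andP[] := exit_time_itv N%:R (a_t N) omega.
apply: (uniformly_integrable_limit (X := fun N omega => M (sigma N omega) omega)).
- move=> N; apply: (measurable_stopped_value (tia N) (a_t N) (stop N) (a_sigma N)).
- move=> omega; apply: (within_continuous_sequence (@continuous_weighted_path omega (ltW tit))).
  + move=> N; rewrite /= in_itv/=; exact: (stop N).1.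
  + by rewrite /= in_itv/= lexx ltW.
  + have [c _ cmax] := EVT_max (ltW tit) (@continuous_size omega).
    have sE : \forall N \near \oo, sigma N omega = a N.
      near=> N; apply/eqP; rewrite eq_le a_sigma andbT.
      apply: ge_sup; first by exists (a N); left.
      move=> s [->//|[/andP[as_ st]]]; rewrite leNgt => /negP[].
      apply: (@le_lt_trans _ _ (size_at c omega)).
        by apply: cmax; rewrite in_itv/= st (le_trans (ltW (tia N)) as_).
      by near: N; exact: nbhs_infty_gtr.
    have : a N @[N --> \oo] --> ti.
      rewrite -[X in _ --> X]addr0; apply: cvgD; first exact: cvg_cst.
      rewrite -(mulr0 (t - ti)); apply: cvgM; first exact: cvg_cst.
      by have := @cvg_harmonic R; rewrite -cvg_shiftS.
    apply: cvg_trans; apply: near_eq_cvg; apply: filterS sE => N ->//.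
- move=> eps /UI[K HK]; exists K => N; exact: HK.
- move=> N; apply: (stopped_value_mean (tia N) (a_t N) (stop N) (a_sigma N)).
  by move=> omega r; exact: before_exit.
Unshelve. all: by end_near. Qed.

End backward_process.

(** * The weighted solution of the Fokker-Planck equation *)

Section gaussian_weighting.
Context {R : realType} {d : nat}.
Notation V := 'rV[R]_d.
Variables (kappa : R).

(** For kappa = beta / m this is, up to a constant, the reciprocal of the Maxwell-Boltzmann density
    of the momentum. *)
Definition gaussian_weight (p : V) : R := expR (kappa / 2 * dot p p).

Lemma derivative_along_line (f : V -> R) (x v : V) (df : R) :
  is_derive (0 : R) (1 : R) (fun s : R => f (s *: v + x)) df -> is_derive x v f df.
Proof.
have E : (fun s : R => s^-1 *: ((fun s => f (s *: v + x)) (s *: 1 + 0) - f (0 *: v + x))) =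
    (fun s => s^-1 *: (f (s *: v + x) - f x)).
  by apply/funext => s; rewrite scale0r add0r addr0 [s *: 1]mulr1.
move=> [drv der]; apply: DeriveDef.
  by move: drv; rewrite /derivable E.
by move: der; rewrite /derive E.
Qed.

Lemma is_derive_coordinate (p : V) i j :
  is_derive p (delta_mx 0 i) (fun p : V => p 0 j) ((i == j)%:R : R).
Proof.
apply: derivative_along_line.
rewrite (_ : (fun s : R => _) = (id : R -> R) * cst ((i == j)%:R) + cst (p 0 j)).
  by apply: is_derive_eq; rewrite /GRing.scale/= mulr0 add0r mulr1 addr0.
by apply/funext => s; rewrite !fctE !mxE eqxx eq_sym.
Qed.

Lemma is_derive_gaussian_weight (p : V) i :
  is_derive p (delta_mx 0 i) gaussian_weight (kappa * p 0 i * gaussian_weight p).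
Proof.
apply: derivative_along_line.
pose c := dot p p; pose b := 2 * p 0 i; pose k := kappa / 2.
pose g (s : R) : R := k * (c + b * s + s ^+ 2).
have dg : is_derive (0 : R) (1 : R) g (k * b).
  rewrite /g; apply: is_derive_eq; rewrite /GRing.scale/=.
  rewrite !(mulr0, mul0r, addr0, add0r, mulr1).
  by rewrite mul1r.
rewrite (_ : (fun s : R => _) = expR \o g).
  have g0 : g 0 = kappa / 2 * dot p p by rewrite /g expr0n/= mulr0 !addr0.
  apply: is_derive_eq; rewrite g0 -/(gaussian_weight p) mulrC; congr (_ * _).
  by rewrite /k /b; field.
apply/funext => s; rewrite /gaussian_weight; congr (expR (_ * _)).
rewrite /c /dot (bigD1 i)//= [X in _ = X + _ + _](bigD1 i)//=.
rewrite (eq_bigr (fun j => p 0 j * p 0 j)) => [|j ji].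
  by rewrite !mxE !eqxx mulr1 /b; ring.
by rewrite !mxE eqxx/= (negbTE ji) mulr0 add0r.
Qed.

Lemma gaussian_weight_continuous (A : set R) : jointly_continuous_on A (fun _ _ p => gaussian_weight p).
Proof.
rewrite /gaussian_weight => z; apply: continuous_cvg; first exact: continuous_expR.
apply: cvgM; first exact: cvg_cst.
rewrite /dot; apply: cvg_big => [|i _]; first exact: add_continuous.
by apply: cvgM; exact: coordinate_jointly_continuous.
Qed.

End gaussian_weighting.

Section fokker_planck_weighting.
Context {R : realType} {d : nat}.
Notation V := 'rV[R]_d.
Variables (ti m tau beta : R) (U : R -> V -> R) (rho : R -> V -> V -> R).
Hypotheses (hm : 0 < m) (htau : 0 < tau) (hbeta : 0 < beta).
Hypothesis sol : fokker_planck_solution ti m tau beta U rho.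
Notation kappa := (beta / m).
Notation E := (gaussian_weight kappa).

Definition weighted_solution (s : R) (q p : V) : R := E p * rho s q p.
Notation h := weighted_solution.

Lemma is_derive_weighted_t s q p : ti < s ->
  is_derive s 1 (fun r => h r q p) (E p * derive1 (fun r => rho r q p) s).
Proof.
move=> tis; have D := derivableP (@fp_derivable_t _ _ _ _ _ _ _ _ sol s q p tis).
rewrite (_ : (fun r => h r q p) = cst (E p) * (fun r => rho r q p))//.
by apply: is_derive_eq; rewrite scaler0 addr0 derive1E.
Qed.

Lemma is_derive_weighted_q s q p i : ti < s ->
  is_derive q (delta_mx 0 i) (fun q => h s q p) (E p * partial i (fun q => rho s q p) q).
Proof.
move=> tis; have D := derivableP (@fp_derivable_q _ _ _ _ _ _ _ _ sol s q p i tis).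
rewrite (_ : (fun q => h s q p) = cst (E p) * (fun q => rho s q p))//.
by apply: is_derive_eq; rewrite scaler0 addr0.
Qed.

Lemma is_derive_weighted_p s q p i : ti < s ->
  is_derive p (delta_mx 0 i) (h s q)
    (E p * (partial i (rho s q) p + kappa * p 0 i * rho s q p)).
Proof.
move=> tis; have D := derivableP (@fp_derivable_p _ _ _ _ _ _ _ _ sol s q p i tis).
have DE := is_derive_gaussian_weight kappa p i.
rewrite (_ : h s q = E * rho s q)//.
apply: is_derive_eq; rewrite /GRing.scale/= /partial; ring.
Qed.

Lemma weighted_pE s q i : ti < s -> partial i (h s q) =
  fun p => E p * (partial i (rho s q) p + kappa * p 0 i * rho s q p).
Proof. by move=> tis; apply/funext => p; case: (is_derive_weighted_p q p i tis). Qed.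

Lemma weighted_tE s q p : ti < s ->
  derive1 (fun r => h r q p) s = E p * derive1 (fun r => rho r q p) s.
Proof. by move=> tis; rewrite [LHS]derive1E; case: (is_derive_weighted_t q p tis). Qed.

Lemma weighted_qE s q p i : ti < s ->
  partial i (fun q => h s q p) q = E p * partial i (fun q => rho s q p) q.
Proof. by move=> tis; case: (is_derive_weighted_q q p i tis). Qed.

Lemma is_derive_weighted_pp s q p i j : ti < s ->
  is_derive p (delta_mx 0 j) (partial i (h s q))
    (E p * (partial j (partial i (rho s q)) p
      + kappa * (p 0 j * partial i (rho s q) p + p 0 i * partial j (rho s q) p)
      + (kappa * (i == j)%:R + kappa ^+ 2 * p 0 i * p 0 j) * rho s q p)).
Proof.
move=> tis; rewrite weighted_pE//.
have D := derivableP (@fp_derivable_p _ _ _ _ _ _ _ _ sol s q p j tis).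
have DD := derivableP (@fp_derivable_pp _ _ _ _ _ _ _ _ sol s q p i j tis).
have DE := is_derive_gaussian_weight kappa p j.
have Dp := is_derive_coordinate p j i.
pose f := E * (partial i (rho s q) + cst kappa * (fun p : V => p 0 i) * rho s q).
suff : is_derive p (delta_mx 0 j) f (E p * (partial j (partial i (rho s q)) p
      + kappa * (p 0 j * partial i (rho s q) p + p 0 i * partial j (rho s q) p)
      + (kappa * (i == j)%:R + kappa ^+ 2 * p 0 i * p 0 j) * rho s q p)) by [].
have D4 := is_deriveM DE (is_deriveD DD (is_deriveM (is_deriveM (is_derive_cst kappa p (delta_mx 0 j)) Dp) D)).
apply: (is_derive_eq D4).
rewrite /GRing.scale/= -/(partial j (rho s q) p) -/(partial j (partial i (rho s q)) p).
move: (partial j _ _) (partial j _ _) => a b.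
rewrite !fctE eq_sym; move: (partial i _ _) (E p) (rho s q p) => x y z.
move: (_ : bool)%:R => c. ring.
Qed.

Lemma weighted_ppE s q p i j : ti < s -> partial j (partial i (h s q)) p =
  E p * (partial j (partial i (rho s q)) p
    + kappa * (p 0 j * partial i (rho s q) p + p 0 i * partial j (rho s q) p)
    + (kappa * (i == j)%:R + kappa ^+ 2 * p 0 i * p 0 j) * rho s q p).
Proof. by move=> tis; case: (is_derive_weighted_pp q p i j tis). Qed.

Lemma eq_jointly_continuous (A : set R) (F G : R -> V -> V -> R) :
  (forall s q p, A s -> F s q p = G s q p) -> jointly_continuous_on A F ->
  jointly_continuous_on A G.
Proof.
move=> FG; apply: subspace_eq_continuous => -[s [q p]].
by rewrite inE => /= As; exact: FG.
Qed.

Lemma weighted_solution_continuous : jointly_continuous_on `[ti, +oo[ h.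
Proof. by move=> z; apply: cvgM; [exact: gaussian_weight_continuous|exact: (fp_continuous sol)]. Qed.

Lemma weighted_solution_differentiable : twice_differentiable ti h.
Proof.
have cE := @gaussian_weight_continuous R d kappa `]ti, +oo[.
have cp i := @coordinate_jointly_continuous R d `]ti, +oo[ i.
have crho : jointly_continuous_on `]ti, +oo[ rho.
  apply: continuous_subspaceW (fp_continuous sol) => z /=.
  by rewrite !in_itv/= !andbT; exact: ltW.
have inA s : `]ti, +oo[%classic s -> ti < s by rewrite /= in_itv/= andbT.
split.
- by move=> s q p tis; have [] := is_derive_weighted_t q p tis.
- by move=> s q p i tis; have [] := is_derive_weighted_q q p i tis.
- by move=> s q p i tis; have [] := is_derive_weighted_p q p i tis.
- by move=> s q p i j tis; have [] := is_derive_weighted_pp q p i j tis.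
- by move=> z; apply: cvgM; [exact: cE|exact: crho].
- apply: (@eq_jointly_continuous _ (fun s q p => E p * derive1 (fun r => rho r q p) s)).
    by move=> s q p /inA tis; rewrite weighted_tE.
  by move=> z; apply: cvgM; [exact: cE|exact: (fp_continuous_t sol)].
- move=> i; apply: (@eq_jointly_continuous _ (fun s q p => E p * partial i (fun q => rho s q p) q)).
    by move=> s q p /inA tis; rewrite weighted_qE.
  by move=> z; apply: cvgM; [exact: cE|exact: (fp_continuous_q sol)].
- move=> i; apply: (@eq_jointly_continuous _ (fun s q p =>
      E p * (partial i (rho s q) p + kappa * p 0 i * rho s q p))).
    by move=> s q p /inA tis; rewrite weighted_pE.
  move=> z; apply: cvgM; first exact: cE.
  apply: cvgD; first exact: (fp_continuous_p sol).
  by apply: cvgM; [apply: cvgM; [exact: cvg_cst|exact: cp]|exact: crho].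
- move=> i j; apply: (@eq_jointly_continuous _ (fun s q p =>
      E p * (partial j (partial i (rho s q)) p
      + kappa * (p 0 j * partial i (rho s q) p + p 0 i * partial j (rho s q) p)
      + (kappa * (i == j)%:R + kappa ^+ 2 * p 0 i * p 0 j) * rho s q p))).
    by move=> s q p /inA tis; rewrite weighted_ppE.
  move=> z; apply: cvgM; first exact: cE.
  apply: cvgD; first apply: cvgD; first exact: (fp_continuous_pp sol).
    apply: cvgM; first exact: cvg_cst.
    by apply: cvgD; apply: cvgM; [exact: cp|exact: (fp_continuous_p sol)|exact: cp|exact: (fp_continuous_p sol)].
  apply: cvgM; last exact: crho.
  apply: cvgD; first exact: cvg_cst.
  by apply: cvgM; [apply: cvgM; [exact: cvg_cst|exact: cp]|exact: cp].
Qed.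

(** With sg^2 / 2 = 1 / (tau kappa), the Laplacian of the weighted function yields a |p|^2 term that
    cancels the one from the friction, a term in d that becomes the d / tau of the divergence, and
    twice the friction term with the opposite sign. The power term produced by the force cancels
    against kappa times the power. *)
Lemma weighted_solution_backward_equation :
  backward_equation_on m tau (Num.sqrt (2 * m / (tau * beta))) kappa ti U h.
Proof.
move=> s q p tis.
have m0 := lt0r_neq0 hm; have tau0 := lt0r_neq0 htau; have beta0 := lt0r_neq0 hbeta.
rewrite sqr_sqrtr; last by rewrite divr_ge0 ?mulr_ge0// ltW.
have -> : time_derivative h s q p = E p * derive1 (fun r => rho r q p) s.
  exact: weighted_tE.
have := @fp_equation _ _ _ _ _ _ _ _ sol s q p tis; rewrite /fokker_planck_equation.
set rt := derive1 _ _; set r := rho s q p.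
pose a i := partial i (fun q => rho s q p) q; pose b i := partial i (rho s q) p.
pose c i := partial i (partial i (rho s q)) p; pose g i := grad (U s) q 0 i.
have -> : divergence (fun p' => rho s q p' *: (tau^-1 *: p')) p =
    \sum_i (tau^-1 * (b i * p 0 i) + tau^-1 * r).
  apply: eq_bigr => i _.
  rewrite (_ : (fun y : V => _) = rho s q * (cst tau^-1 * (fun y : V => y 0 i))); last first.
    by apply/funext => y; rewrite !mxE !fctE.
  have D := derivableP (@fp_derivable_p _ _ _ _ _ _ _ _ sol s q p i tis).
  have Dp := is_derive_coordinate p i i.
  suff : is_derive p (delta_mx 0 i) (rho s q * (cst tau^-1 * (fun y : V => y 0 i)))
    (tau^-1 * (b i * p 0 i) + tau^-1 * r) by case.
  apply: is_derive_eq; rewrite /GRing.scale/= -/(partial i (rho s q) p) -/(b i) !fctE eqxx -/r.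
  rewrite -[true%:R]/(1 : R); ring.
have -> : dot (m^-1 *: p) (grad (fun q' => rho s q' p) q) = m^-1 * \sum_i a i * p 0 i.
  by rewrite mulr_sumr; apply: eq_bigr => i _; rewrite !mxE /a; ring.
have -> : dot (grad (U s) q) (grad (rho s q) p) = \sum_i g i * b i.
  by apply: eq_bigr => i _; rewrite [grad (rho s q) p 0 i]mxE.
rewrite /laplacian big_split/= -mulr_sumr sumr_const card_ord -[_ *+ d]mulr_natl => FP.
have -> : \sum_i q_derivative h i s q p * velocity m i s q p = E p * (m^-1 * \sum_i a i * p 0 i).
  rewrite !mulr_sumr; apply: eq_bigr => i _.
  by rewrite /q_derivative weighted_qE// /velocity /a; ring.
have -> : \sum_i p_derivative h i s q p * friction tau U i s q p =
    E p * (tau^-1 * \sum_i b i * p 0 i - \sum_i g i * b i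
      + kappa * r * (tau^-1 * \sum_i p 0 i ^+ 2 - power U s q p)).
  rewrite /power /dot !mulr_sumr -!sumrB mulr_sumr -big_split/= mulr_sumr; apply: eq_bigr => i _.
  rewrite /p_derivative weighted_pE// /friction -/(b i) -/(g i) -/r; ring.
have -> : \sum_i pp_derivative h i i s q p =
    E p * (\sum_i c i + 2 * kappa * \sum_i b i * p 0 i + d%:R * kappa * r
      + kappa ^+ 2 * r * \sum_i p 0 i ^+ 2).
  rewrite (_ : d%:R * kappa * r = \sum_(i < d) kappa * r); last first.
    by rewrite sumr_const card_ord -[RHS]mulr_natl; exact/esym/mulrA.
  rewrite !mulr_sumr -!big_split/= mulr_sumr; apply: eq_bigr => i _.
  rewrite /pp_derivative weighted_ppE//.
  by rewrite eqxx -/(b i) -/(c i) -/r -[true%:R]/(1 : R); ring.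
rewrite /h -/r; move: FP.
have -> : \sum_i partial i (partial i (rho s q)) p = \sum_i c i by [].
move: (\sum_i a i * p 0 i) (\sum_i b i * p 0 i) (\sum_i c i) (\sum_i g i * b i) => A B C G.
move: (\sum_i p 0 i ^+ 2) (power U s q p) (E p) r rt => S W e r' rt'.
move=> FP.
(* The backward expression is - E(p) times the Fokker-Planck expression. *)
rewrite -[RHS](mulr0 (- e)) -FP; field.
by rewrite m0 tau0 beta0.
Qed.

End fokker_planck_weighting.

Lemma gaussian_weight_enorm {R : realType} {d : nat} (beta m : R) (p : 'rV[R]_d) :
  gaussian_weight (beta / m) p = expR (beta * enorm p ^+ 2 / (2 * m)).
Proof.
rewrite /gaussian_weight /enorm sqr_sqrtr; last first.
  by apply: sumr_ge0 => i _; rewrite -expr2 sqr_ge0.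
by congr expR; rewrite invfM; ring.
Qed.

Lemma force_jointly_continuous {R : realType} {d : nat} (ti : R) (U : R -> 'rV[R]_d -> R) i :
  regular_potential ti U -> jointly_continuous_on `[ti, +oo[ (fun t q p => grad (U t) q 0 i).
Proof.
move=> hU; apply: (@within_continuous_comp _ _ _ _ [set z : R * 'rV[R]_d | ti <= z.1]
  (fun z => (z.1, z.2.1)) (fun z => grad (U z.1) z.2 0 i)).
- apply: continuous_subspaceT => z; apply: (cvg_pair (G := nbhs z.1) (H := nbhs z.2.1)).
    exact: cvg_fst.
  by apply: (@continuous_comp _ _ _ snd fst); [exact: cvg_snd|exact: cvg_fst].
- move=> z; apply: (cvg_comp _ (fun u : 'rV[R]_d => u 0 i) (@force_continuous _ _ _ _ hU z)).
  exact: coord_continuous.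
- by move=> z /=; rewrite in_itv/= andbT.
Qed.

Theorem proposition3p1 (R : realType) (d : nat) (m tau beta ti : R)
    (U : R -> 'rV[R]_d -> R) (rho : R -> 'rV[R]_d -> 'rV[R]_d -> R)
    (hd : (0 < d)%N) (hm : 0 < m) (htau : 0 < tau) (hbeta : 0 < beta)
    (hU : regular_potential ti U)
    (hrho : fokker_planck_solution ti m tau beta U rho)
    (hrho0 : probability_density (rho ti))
    (t : R) (ht : ti <= t) (q p : 'rV[R]_d)
    (disp : measure_display) (Omega : measurableType disp)
    (P : probability Omega R) (w qs ps : R -> Omega -> 'rV[R]_d)
    (hw : wiener_process P ti w)
    (hQV : backward_solution P ti m tau beta U w t q p qs ps)
    (hM : class_D P ti t w (weighted_density m beta U rho qs ps t)) :
  (rho t q p)%:E =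
  ((expR (- (beta * enorm p ^+ 2 / (2 * m))))%:E *
   'E_P[(fun omega =>
      expR (beta * enorm (ps ti omega) ^+ 2 / (2 * m))
      * rho ti (qs ti omega) (ps ti omega)
      * expR (- (beta / m) * (\int[lebesgue_measure]_(s in `[ti, t])
                 dot (grad (U s) (qs s omega)) (ps s omega))))%R])%E.
Proof.
have weightedE : (fun s omega => weighted_path (beta / m) U (weighted_solution m beta rho) t
    (qs ^~ omega) (ps ^~ omega) s) = weighted_density m beta U rho qs ps t.
  apply/funext => s; apply/funext => omega.
  by rewrite /weighted_path /weighted_solution gaussian_weight_enorm mulrA.
have path_ae : {ae P, forall omega, backward_path m tau (Num.sqrt (2 * m / (tau * beta)))
    ti U t q p (w ^~ omega) (qs ^~ omega) (ps ^~ omega)}.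
  apply: filterS (backward_equation hQV) => omega eqn; split.
  - exact: backward_continuous_q hQV omega.
  - exact: backward_continuous_p hQV omega.
  - exact: eqn.
have cU i := @force_jointly_continuous R d ti U i hU.
have := initial_value_mean hw (weighted_solution_differentiable hrho)
  (weighted_solution_continuous hrho) (weighted_solution_backward_equation hm htau hbeta hrho)
  cU (backward_adapted_q hQV) (backward_adapted_p hQV)
  (@backward_continuous_q _ _ _ _ _ _ _ _ _ _ _ _ _ _ _ _ hQV)
  (@backward_continuous_p _ _ _ _ _ _ _ _ _ _ _ _ _ _ _ _ hQV) path_ae (sqrtr_ge0 _)
  (divr_ge0 (ltW hbeta) (ltW hm)).
move=> /(_ _ ht); rewrite -weightedE in hM; move=> /(_ hM) E.
rewrite unlock (eq_integral (fun omega => (weighted_path (beta / m) U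
    (weighted_solution m beta rho) t (qs ^~ omega) (ps ^~ omega) ti)%:E)).
  (* The prefactor is the inverse of the weight at [p], so it turns the value of the weighted
     solution at (t, q, p) back into [rho t q p]. *)
  by rewrite E /weighted_solution gaussian_weight_enorm -EFinM mulrA -expRD addNr expR0 mul1r.
move=> omega _; rewrite /weighted_path /weighted_solution gaussian_weight_enorm.
by rewrite mulrC.
Qed.
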